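(* Consider restarted Halpern PDHG with the adaptive restart scheme and step-size $\eta\le\frac1{2\|A\|_2}$ applied to a feasible and bounded LP $\min_{x\ge0}c^\top x$ s.t. $Ax=b$. Let $\{z^{n,k}\}$ be its iterates and let $z^*$ be the converging optimal solution, i.e. $z^{n,k}\to z^*$ as $n\to\infty$. With $\delta$, $\alpha_\eta^{L_1}$ and $\alpha_\eta^{L_2}$ the quantities associated with $z^*$ defined in the context, let $$\bar n:=\max\left\{n:\ \|z^{n,0}-T(z^{n,0})\|\ge\frac{\alpha_\eta^{L_1}\delta}{18\sqrt{2\eta}}\right\}$$ (this set being nonempty). Then for every $n>\bar n$: (i) the restart length satisfies $\displaystyle \tau^n\le\frac{2e}{\alpha_\eta^{L_2}}$; (ii) $\displaystyle \|z^{n,0}-z^*\|\le\frac{2}{\alpha_\eta^{L_2}}\left(\frac1e\right)^{n-\bar n-1}\|z^{\bar n+1,0}-T(z^{\bar n+1,0})\|$.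
   Context: Let $A\in\mathbb R^{m\times d}$ be nonzero with columns $A_i$, $b\in\mathbb R^m$, $c\in\mathbb R^d$. The LP has primal-dual form $\min_{x\ge 0}\max_{y} c^\top x+y^\top Ax-b^\top y$; write $z=(x,y)\in\mathbb R^{d+m}$. $\|\cdot\|_2$ is the Euclidean norm for vectors and the spectral norm for matrices, $\mathrm{dist}_2$ the Euclidean distance. For an index set $S$, $x_S$ denotes the subvector and $A_S$ the submatrix of columns indexed by $S$; $[\cdot]^+$ is the componentwise positive part; vector inequalities are componentwise. The PDHG operator $T(x,y)=(x^+,y^+)$ is $$x^+=\mathrm{proj}_{\mathbb R^d_+}(x-\eta A^\top y-\eta c),\qquad y^+=y+\eta A(2x^+-x)-\eta b,$$ with $\eta>0$; primal-dual optimal solutions are exactly the fixed points of $T$. Let $P_\eta=\begin{pmatrix}\frac1\eta I&-A^\top\\-A&\frac1\eta I\end{pmatrix}$ and $\|z\|=\sqrt{\langle z,P_\eta z\rangle}$. Restarted Halpern PDHG: start from $z^{0,0}$. In outer loop $n=0,1,2,\dots$, for inner counter $k=0,1,\dots$ set $$z^{n,k+1}=\frac{k+1}{k+2}T(z^{n,k})+\frac1{k+2}z^{n,0}$$ until a restart condition holds at the current $k$ (checked after each inner step); then set $z^{n+1,0}=T(z^{n,k})$ with this $k$ and start outer loop $n+1$. Adaptive restart scheme: for $n=0$ the inner loop is terminated as soon as $k>\tau^0$, where $\tau^0$ is a prescribed nonnegative integer; for $n\ge1$ it is terminated as soon as $\|z^{n,k}-T(z^{n,k})\|\le\frac1e\|z^{n,0}-T(z^{n,0})\|$,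 and the restart length $\tau^n$ is the value of $k$ at which this happens. Index partition associated with $z^*=(x^*,y^* )$: $N=\{i: c_i+A_i^\top y^*>0\}$, $B_1=\{i: c_i+A_i^\top y^*=0,\ x_i^*>0\}$, $B_2=\{i: c_i+A_i^\top y^*=0,\ x_i^*=0\}$, and $B=B_1\cup B_2$. Non-degeneracy metric: $$\delta=\min\left\{\min_{i\in N}\frac{c_i+A_i^\top y^*}{\|A\|_2},\ \min_{i\in B_1}x_i^*\right\}>0.$$ For $\rho>0$ let $\mathcal K_\rho=\{(u,v)\in\mathbb R^{d+m}: -A_B^\top v\le0,\ A u=0,\ u_{N\cup B_2}\ge0,\ \frac1\rho(c^\top u+b^\top v)\le0\}$, and call $\alpha>0$ a sharpness constant of this system if for all $(u,v)\in\mathbb R^{d+m}$ $$\alpha\,\mathrm{dist}_2((u,v),\mathcal K_\rho)\le\left\|\begin{pmatrix}[-A_B^\top v]^+ \\ A u \\ [-u_{N\cup B_2}]^+ \\ \frac1\rho[c^\top u+b^\top v]^+\end{pmatrix}\right\|_2 .$$ $\alpha_{L_1}$ is the sharpness constant for $\rho=R:=2(\|z^{0,0}-z^*\|_2+\|z^*\|_2)$, and $\alpha_{L_2}$ is the sharpness constant for $\rho=R_2:=\delta$. Finally $\alpha_\eta^{L_1}=\frac{\eta\alpha_{L_1}}{\eta\alpha_{L_1}+2}$ and $\alpha_\eta^{L_2}=\frac{\eta\alpha_{L_2}}{\eta\alpha_{L_2}+2}$. *)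

(* Defs.v *)
From HB Require Import structures.
From mathcomp Require Import all_boot all_order all_algebra.
From mathcomp Require Import all_classical all_reals all_analysis.
Set Implicit Arguments.
Unset Strict Implicit.
Unset Printing Implicit Defensive.
Import Order.TTheory GRing.Theory Num.Theory.
Import numFieldNormedType.Exports.
Local Open Scope classical_set_scope.
Local Open Scope ring_scope.

Section Euclidean.
Variable R : realType.

Definition dotv n (u v : 'cV[R]_n) : R := (u^T *m v) 0 0.

(* The norm provided by the library on matrices is the max norm. *)
Definition norm2 n (v : 'cV[R]_n) : R := Num.sqrt (dotv v v).

Definition spectral_norm m n (M : 'M[R]_(m, n)) : R :=
  sup [set norm2 (M *m u) | u in [set u : 'cV[R]_n | norm2 u <= 1]].

Definition dist2 n (w : 'cV[R]_n) (K : set 'cV[R]_n) : R :=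
  inf [set norm2 (w - k) | k in K].

Definition nonneg n (v : 'cV[R]_n) : Prop := forall i, 0 <= v i 0.

Definition pospart n (v : 'cV[R]_n) : 'cV[R]_n :=
  \col_i Num.max 0 (v i 0).

Definition subvec n (S : {set 'I_n}) (v : 'cV[R]_n) : 'cV[R]_#|S| :=
  rowsub (@enum_val _ (mem S)) v.

Definition colsubmx m n (S : {set 'I_n}) (M : 'M[R]_(m, n)) : 'M[R]_(m, #|S|) :=
  colsub (@enum_val _ (mem S)) M.

Definition is_minimum (D : set R) (r : R) : Prop := D r /\ lbound D r.

Lemma norm2E n (v : 'cV[R]_n) : norm2 v = Num.sqrt (\sum_i v i 0 ^+ 2).
Proof.
by rewrite /norm2 /dotv mxE; congr Num.sqrt; apply: eq_bigr => i _; rewrite mxE expr2.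
Qed.

(* [pospart] is the Euclidean projection onto the nonnegative orthant. *)
Lemma pospart_proj n (v p : 'cV[R]_n) : nonneg p ->
  nonneg (pospart v) /\ norm2 (v - pospart v) <= norm2 (v - p).
Proof.
move=> p0; split=> [i|]; first by rewrite mxE le_max lexx.
rewrite !norm2E ler_wsqrtr//; apply: ler_sum => i _; rewrite !mxE.
case: (leP 0 (v i 0)) => v0.
  by rewrite subrr expr0n sqr_ge0.
rewrite subr0 -sqrrN -[leRHS]sqrrN lerXn2r ?nnegrE ?oppr_ge0 ?(ltW v0)//.
  by rewrite subr_le0 (le_trans (ltW v0)).
by rewrite lerN2 gerBl.
Qed.

End Euclidean.

Section LP.
Variables (R : realType) (m d : nat).
Variables (A : 'M[R]_(m, d)) (b : 'cV[R]_m) (c : 'cV[R]_d).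
Implicit Types (x : 'cV[R]_d) (y : 'cV[R]_m) (z w : 'cV[R]_(d + m)).

(* A primal-dual point z = (x, y) is [col_mx x y]; its components are
   [usubmx z] and [dsubmx z]. *)

Definition primal_feasible x : Prop := nonneg x /\ A *m x = b.

Definition lp_feasible : Prop := exists x, primal_feasible x.

Definition lp_bounded : Prop :=
  exists M : R, forall x, primal_feasible x -> M <= dotv c x.

Definition lagrangian x y : R := dotv c x + dotv y (A *m x) - dotv b y.

(* Saddle points of min_(x >= 0) max_y lagrangian x y. *)
Definition pd_optimal z : Prop :=
  let xs := usubmx z in let ys := dsubmx z in
  [/\ nonneg xs,
      forall y, lagrangian xs y <= lagrangian xs ys &
      forall x, nonneg x -> lagrangian xs ys <= lagrangian x ys].

Definition pdhg (eta : R) z : 'cV[R]_(d + m) :=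
  let x := usubmx z in let y := dsubmx z in
  let x' := pospart (x - eta *: (A^T *m y) - eta *: c) in
  col_mx x' (y + eta *: (A *m (2%:R *: x' - x)) - eta *: b).

Definition Peta (eta : R) : 'M[R]_(d + m) :=
  block_mx (eta^-1)%:M (- A^T) (- A) (eta^-1)%:M.

Definition normP (eta : R) z : R := Num.sqrt (dotv z (Peta eta *m z)).

Definition residual (eta : R) z : R := normP eta (z - pdhg eta z).

(* [z n k] is the iterate z^{n,k}, and [len n] is the value of the inner counter
   at which outer loop n stops: [len n] is the restart length for n >= 1, whereas
   [tau0] is the threshold prescribed for n = 0. Only the iterates actually
   generated, those with k <= len n, are constrained. *)
Definition restart_cond (eta : R) (tau0 : nat)
    (z : nat -> nat -> 'cV[R]_(d + m)) (n k : nat) : Prop :=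
  if n is 0%N then (tau0 < k)%N
  else residual eta (z n k) <= (expR 1)^-1 * residual eta (z n 0%N).

Record adaptive_rHPDHG (eta : R) (z00 : 'cV[R]_(d + m)) (tau0 : nat)
    (z : nat -> nat -> 'cV[R]_(d + m)) (len : nat -> nat) : Prop := {
  rh_init : z 0%N 0%N = z00;
  rh_inner : forall n k, (k < len n)%N ->
    z n k.+1 = (k.+1%:R / k.+2%:R) *: pdhg eta (z n k) + k.+2%:R^-1 *: z n 0%N;
  rh_outer : forall n, z n.+1 0%N = pdhg eta (z n (len n));
  (* The condition is tested after each inner step, hence for k >= 1. *)
  rh_len_gt0 : forall n, (0 < len n)%N;
  rh_len_cond : forall n, restart_cond eta tau0 z n (len n);
  rh_len_first : forall n k, (0 < k < len n)%N -> ~ restart_cond eta tau0 z n k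
}.

Definition iterates_cvg (z : nat -> nat -> 'cV[R]_(d + m)) (len : nat -> nat)
    (zs : 'cV[R]_(d + m)) : Prop :=
  forall eps : R, 0 < eps ->
    \forall n \near \oo, forall k, (k <= len n)%N -> norm2 (z n k - zs) < eps.

Definition reduced_cost z : 'cV[R]_d := c + A^T *m dsubmx z.

Definition idxN z : {set 'I_d} := [set i | 0 < reduced_cost z i 0]%SET.

Definition idxB1 z : {set 'I_d} :=
  [set i | (reduced_cost z i 0 == 0) && (0 < usubmx z i 0)]%SET.

Definition idxB2 z : {set 'I_d} :=
  [set i | (reduced_cost z i 0 == 0) && (usubmx z i 0 == 0)]%SET.

Definition idxB z : {set 'I_d} := idxB1 z :|: idxB2 z.

(* The non-degeneracy metric delta is the minimum of this finite set, i.e. the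
   minimum of the two minima. When N and B1 are both empty (delta = +oo) the set
   is empty and no real number satisfies [is_minimum]. *)
Definition nondeg_values z : set R :=
  [set reduced_cost z i 0 / spectral_norm A | i in [set` idxN z]] `|`
  [set usubmx z i 0 | i in [set` idxB1 z]].

Definition Kcone (zs : 'cV[R]_(d + m)) (rho : R) : set 'cV[R]_(d + m) :=
  [set w | let u := usubmx w in let v := dsubmx w in
    [/\ nonneg ((colsubmx (idxB zs) A)^T *m v),
        A *m u = 0,
        nonneg (subvec (idxN zs :|: idxB2 zs)%SET u) &
        rho^-1 * (dotv c u + dotv b v) <= 0]].

Definition Kresidual (zs : 'cV[R]_(d + m)) (rho : R) w : R :=
  let u := usubmx w in let v := dsubmx w in
  norm2 (col_mx (pospart (- ((colsubmx (idxB zs) A)^T *m v)))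
        (col_mx (A *m u)
        (col_mx (pospart (- subvec (idxN zs :|: idxB2 zs)%SET u))
                (rho^-1 *: pospart (dotv c u + dotv b v)%:M)))).

Definition sharpness_constant (zs : 'cV[R]_(d + m)) (rho alpha : R) : Prop :=
  [/\ 0 < rho, 0 < alpha &
      forall w, alpha * dist2 w (Kcone zs rho) <= Kresidual zs rho w].

End LP.

Definition alpha_step (R : realType) (eta alpha : R) : R :=
  eta * alpha / (eta * alpha + 2%:R).

(* Main.v *)
Require Import Defs.
From mathcomp Require Import all_boot all_order all_algebra.
From mathcomp Require Import all_classical all_reals all_analysis.
From mathcomp Require Import ring lra.
Import Order.TTheory GRing.Theory Num.Theory.
Import numFieldNormedType.Exports.
Local Open Scope classical_set_scope.
Local Open Scope ring_scope.
Set Implicit Arguments.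
Unset Strict Implicit.
Unset Printing Implicit Defensive.

(* Everything follows from the local error bound
     ||z^{n,0} - z*|| <= ||z^{n,0} - T z^{n,0}|| / alpha_eta^{L2}   for n > nbar,
   since the Halpern residual after k steps is at most 2 ||z^{n,0} - z*|| / (k+1)
   and every loop divides the residual by e.

   Sharpness at the scale R first localises z^{n,0} in a small ball around z*:
   moving z* along a nearby element of the cone K gives a fixed point, and by Fejer
   monotonicity the limit z* is not farther from it than the iterates.

   Inside this ball, if T leaves some coordinate of N positive, the residual is of
   the order of a reduced cost and the bound is immediate, because alpha_{L2} is at
   most of order (reduced cost) / delta. Otherwise the coordinates of N vanish along
   the whole run, and the vector t = T z^{n,0} - z* has a residual system of norm at
   most that of P_eta (z - T z), except for the term c'u + b'v, whose sign is not
   controlled. It can be made nonpositive by replacing t with -t, which is harmless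
   once t is orthogonal to K in the metric P_eta and the coordinates of B2 vanish.

   This last point is a rigidity property. On the coordinates off N the run is a
   restarted Halpern orbit for the resolvent of a skew operator plus the normal cone
   of x_i >= 0, i in B2, and it converges to 0 geometrically. Summing the loops with
   weights growing like q^k, q > 1, skewness and complementarity bound the total
   activity sum_{i in B2} (t_i - g_i) of a tail of the run by its first anchor. After
   projecting away the part that the B2-coordinates cannot observe, the activity
   controls the anchors in turn, so the decay rate can be improved indefinitely; the
   projected anchors are then eventually 0, and going backwards through the loops,
   always 0. *)

(** * Euclidean and quadratic norms *)

Section DotProduct.
Variable R : realType.
Implicit Types n : nat.

Lemma dotvE n (u v : 'cV[R]_n) : dotv u v = \sum_i u i 0 * v i 0.
Proof. by rewrite /dotv mxE; apply: eq_bigr => i _; rewrite mxE. Qed.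

Lemma dotvC n (u v : 'cV[R]_n) : dotv u v = dotv v u.
Proof. by rewrite !dotvE; apply: eq_bigr => i _; rewrite mulrC. Qed.

Lemma dotvDl n (u v w : 'cV[R]_n) : dotv (u + v) w = dotv u w + dotv v w.
Proof. by rewrite /dotv linearD mulmxDl mxE. Qed.

Lemma dotvDr n (u v w : 'cV[R]_n) : dotv w (u + v) = dotv w u + dotv w v.
Proof. by rewrite /dotv mulmxDr mxE. Qed.

Lemma dotvNl n (u w : 'cV[R]_n) : dotv (- u) w = - dotv u w.
Proof. by rewrite /dotv linearN mulNmx mxE. Qed.

Lemma dotvNr n (u w : 'cV[R]_n) : dotv w (- u) = - dotv w u.
Proof. by rewrite /dotv mulmxN mxE. Qed.

Lemma dotvZl n a (u w : 'cV[R]_n) : dotv (a *: u) w = a * dotv u w.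
Proof. by rewrite /dotv linearZ /= -scalemxAl mxE. Qed.

Lemma dotvZr n a (u w : 'cV[R]_n) : dotv w (a *: u) = a * dotv w u.
Proof. by rewrite /dotv -scalemxAr mxE. Qed.

Lemma dotv0l n (u : 'cV[R]_n) : dotv 0 u = 0.
Proof. by rewrite /dotv trmx0 mul0mx mxE. Qed.

Lemma dotv0r n (u : 'cV[R]_n) : dotv u 0 = 0.
Proof. by rewrite dotvC dotv0l. Qed.

Definition dotv_lin := (dotvDl, dotvDr, dotvNl, dotvNr, dotvZl, dotvZr).

Lemma dotv_mulr m n (M : 'M[R]_(m, n)) u v : dotv u (M *m v) = dotv (M^T *m u) v.
Proof. by rewrite /dotv trmx_mul trmxK mulmxA. Qed.

Lemma dotv_ge0 n (u : 'cV[R]_n) : 0 <= dotv u u.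
Proof. by rewrite dotvE sumr_ge0 // => i _; rewrite -expr2 sqr_ge0. Qed.

Lemma dotv_eq0 n (u : 'cV[R]_n) : dotv u u = 0 -> u = 0.
Proof.
rewrite dotvE => /eqP; rewrite psumr_eq0; last by move=> i _; rewrite -expr2 sqr_ge0.
move=> /allP h; apply/matrixP => i j; rewrite (ord1 j) mxE; apply/eqP.
by have := h i; rewrite mem_index_enum => /(_ isT); rewrite /= mulf_eq0 orbb.
Qed.

Lemma dotv_col m n (u1 v1 : 'cV[R]_m) (u2 v2 : 'cV[R]_n) :
  dotv (col_mx u1 u2) (col_mx v1 v2) = dotv u1 v1 + dotv u2 v2.
Proof. by rewrite /dotv tr_col_mx mul_row_col mxE. Qed.

Lemma dotv_colE m n (u1 : 'cV[R]_m) (u2 : 'cV[R]_n) (z : 'cV[R]_(m + n)) :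
  dotv (col_mx u1 u2) z = dotv u1 (usubmx z) + dotv u2 (dsubmx z).
Proof. by rewrite -{1}(vsubmxK z) dotv_col. Qed.

Lemma dotv_skew n (M : 'M[R]_n) x : M^T = - M -> dotv x (M *m x) = 0.
Proof.
move=> MT; have : dotv x (M *m x) = - dotv x (M *m x).
  by rewrite {1}dotv_mulr MT mulNmx dotvNl dotvC.
by move=> h; lra.
Qed.

Lemma dotv_sym n (G : 'M[R]_n) x y : G^T = G -> dotv x (G *m y) = dotv y (G *m x).
Proof. by move=> GT; rewrite dotv_mulr GT dotvC. Qed.

End DotProduct.

Section QuadraticNorm.
Variables (R : realType) (n : nat) (G : 'M[R]_n).

Definition gnorm (x : 'cV[R]_n) : R := Num.sqrt (dotv x (G *m x)).

Hypotheses (Gsym : G^T = G) (Gpsd : forall x, 0 <= dotv x (G *m x)).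

Lemma gnorm_ge0 x : 0 <= gnorm x.
Proof. exact: sqrtr_ge0. Qed.

Lemma gnorm_sq x : gnorm x ^+ 2 = dotv x (G *m x).
Proof. by rewrite sqr_sqrtr. Qed.

Lemma gnormZ a x : gnorm (a *: x) = `|a| * gnorm x.
Proof.
by rewrite /gnorm -scalemxAr !dotv_lin mulrA -expr2 sqrtrM ?sqr_ge0 // sqrtr_sqr.
Qed.

Lemma gnormN x : gnorm (- x) = gnorm x.
Proof. by rewrite -scaleN1r gnormZ normrN1 mul1r. Qed.

(** The quadratic form at [s *: x + t *: y] is nonnegative, and s = -a, t = b is the discriminant
    argument. Since G is only semidefinite, b = 0 is treated apart. *)
Lemma gdot_CS_sq x y :
  dotv x (G *m y) ^+ 2 <= dotv x (G *m x) * dotv y (G *m y).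
Proof.
set a := dotv x _; set b := dotv x _; set c := dotv y _.
have b0 : 0 <= b by exact: Gpsd.
have c0 : 0 <= c by exact: Gpsd.
have key s t : 0 <= s ^+ 2 * b + 2 * s * t * a + t ^+ 2 * c.
  have := Gpsd (s *: x + t *: y).
  rewrite mulmxDr -!scalemxAr !dotv_lin (dotv_sym y x Gsym) -/a -/b -/c.
  by move=> h; apply: (le_trans h); rewrite le_eqVlt; apply/orP; left; apply/eqP; ring.
have [b0'|bp] := leP b 0.
  have be : b = 0 by apply/le_anti/andP.
  rewrite be mul0r; have [->|a0] := eqVneq a 0; first by rewrite expr0n.
  (* This choice turns the inequality into 0 <= -(c + 2) a^2. *)
  have := key (- (c + 1)) a; rewrite be mulr0 add0r.
  have : 0 < a ^+ 2 by rewrite exprn_even_gt0.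
  by nra.
have := key (- a) b; have : 0 < b by []. by nra.
Qed.

Lemma gdot_CS x y : dotv x (G *m y) <= gnorm x * gnorm y.
Proof.
apply: le_trans (ler_norm _) _; rewrite -[leLHS]sqrtr_sqr -sqrtrM // ler_wsqrtr //.
exact: gdot_CS_sq.
Qed.

Lemma gdot_CS_abs x y : `|dotv x (G *m y)| <= gnorm x * gnorm y.
Proof.
by rewrite ler_norml gdot_CS andbT lerNl -dotvNl -(gnormN x) gdot_CS.
Qed.

Lemma gnorm_triangle x y : gnorm (x + y) <= gnorm x + gnorm y.
Proof.
rewrite -(@ler_pXn2r _ 2) ?nnegrE ?addr_ge0 ?gnorm_ge0 // gnorm_sq.
rewrite mulmxDr !dotv_lin (dotv_sym y x Gsym) -!gnorm_sq.
have := gdot_CS x y; rewrite sqrrD mulr2n; lra.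
Qed.

Lemma gnorm_sub x y : gnorm x <= gnorm y + gnorm (x - y).
Proof. by apply: le_trans (gnorm_triangle _ _); rewrite addrC subrK. Qed.

Lemma gnorm_distC x y : gnorm (x - y) = gnorm (y - x).
Proof. by rewrite -gnormN opprB. Qed.

End QuadraticNorm.

Section EuclideanNorm.
Variable R : realType.
Implicit Types n : nat.

Lemma gnorm1 n (x : 'cV[R]_n) : gnorm 1%:M x = norm2 x.
Proof. by rewrite /gnorm mul1mx. Qed.

Let psd1 n (x : 'cV[R]_n) : 0 <= dotv x (1%:M *m x).
Proof. by rewrite mul1mx dotv_ge0. Qed.

Lemma norm2_ge0 n (x : 'cV[R]_n) : 0 <= norm2 x.
Proof. exact: sqrtr_ge0. Qed.

Lemma norm2_sq n (x : 'cV[R]_n) : norm2 x ^+ 2 = dotv x x.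
Proof. by rewrite sqr_sqrtr // dotv_ge0. Qed.

Lemma norm2Z n a (x : 'cV[R]_n) : norm2 (a *: x) = `|a| * norm2 x.
Proof. by rewrite -!gnorm1 gnormZ. Qed.

Lemma norm2N n (x : 'cV[R]_n) : norm2 (- x) = norm2 x.
Proof. by rewrite -!gnorm1 gnormN. Qed.

Lemma norm2_0 n : norm2 (0 : 'cV[R]_n) = 0.
Proof. by rewrite /norm2 dotv0l sqrtr0. Qed.

Lemma norm2_eq0 n (x : 'cV[R]_n) : norm2 x = 0 -> x = 0.
Proof. by move=> h; apply: dotv_eq0; rewrite -norm2_sq h expr0n. Qed.

Lemma dotv_CS n (x y : 'cV[R]_n) : dotv x y <= norm2 x * norm2 y.
Proof. by rewrite -!gnorm1 -{1}(mul1mx y); apply: gdot_CS; rewrite ?trmx1. Qed.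

Lemma dotv_CS_abs n (x y : 'cV[R]_n) : `|dotv x y| <= norm2 x * norm2 y.
Proof. by rewrite -!gnorm1 -{1}(mul1mx y); apply: gdot_CS_abs; rewrite ?trmx1. Qed.

Lemma norm2_triangle n (x y : 'cV[R]_n) : norm2 (x + y) <= norm2 x + norm2 y.
Proof. by rewrite -!gnorm1; apply: gnorm_triangle; rewrite ?trmx1. Qed.

Lemma norm2_sub n (x y : 'cV[R]_n) : norm2 x <= norm2 y + norm2 (x - y).
Proof. by rewrite -!gnorm1; apply: gnorm_sub; rewrite ?trmx1. Qed.

Lemma norm2_coord n (x : 'cV[R]_n) i : `|x i 0| <= norm2 x.
Proof.
rewrite -sqrtr_sqr ler_wsqrtr // dotvE (bigD1 i) //= -expr2 lerDl.
by apply: sumr_ge0 => j _; rewrite -expr2 sqr_ge0.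
Qed.

Lemma norm2_usub m n (x : 'cV[R]_(m + n)) : norm2 (usubmx x) <= norm2 x.
Proof.
by rewrite ler_wsqrtr // -{3 4}(vsubmxK x) dotv_col lerDl dotv_ge0.
Qed.

Lemma norm2_dsub m n (x : 'cV[R]_(m + n)) : norm2 (dsubmx x) <= norm2 x.
Proof.
by rewrite ler_wsqrtr // -{3 4}(vsubmxK x) dotv_col lerDr dotv_ge0.
Qed.

Lemma norm2_sum (I : Type) (r : seq I) n (F : I -> 'cV[R]_n) :
  norm2 (\sum_(i <- r) F i) <= \sum_(i <- r) norm2 (F i).
Proof.
elim/big_ind2: _ => [|x a y b|//]; first by rewrite norm2_0.
by move=> xa yb; apply: le_trans (norm2_triangle _ _) (lerD xa yb).
Qed.

Lemma norm2_mulmx_bound m n (M : 'M[R]_(m, n)) :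
  exists2 C : R, 0 <= C & forall x : 'cV_n, norm2 (M *m x) <= C * norm2 x.
Proof.
exists (\sum_j norm2 (col j M)); first by apply: sumr_ge0 => j _; exact: norm2_ge0.
move=> x; have -> : M *m x = \sum_j x j 0 *: col j M.
  by apply/matrixP => i k; rewrite summxE (ord1 k) mxE; apply: eq_bigr => j _; rewrite !mxE mulrC.
apply: le_trans (norm2_sum _ _) _; rewrite mulr_suml; apply: ler_sum => j _.
by rewrite norm2Z mulrC ler_wpM2l ?norm2_ge0 ?norm2_coord.
Qed.

Lemma spectral_norm_has_sup m n (M : 'M[R]_(m, n)) :
  has_sup [set norm2 (M *m u) | u in [set u : 'cV[R]_n | norm2 u <= 1]].
Proof.
have [C C0 hC] := norm2_mulmx_bound M; split.
  by exists (norm2 (M *m 0)), 0 => //=; rewrite norm2_0.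
exists C => _ [u /= u1 <-]; apply: le_trans (hC u) _.
by rewrite -[leRHS]mulr1 ler_wpM2l.
Qed.

Lemma spectral_normP m n (M : 'M[R]_(m, n)) u :
  norm2 (M *m u) <= spectral_norm M * norm2 u.
Proof.
have [u0|u0] := eqVneq (norm2 u) 0.
  by rewrite (norm2_eq0 u0) mulmx0 !norm2_0 mulr0.
have up : 0 < norm2 u by rewrite lt_def u0 norm2_ge0.
rewrite -ler_pdivrMr //; apply: ub_le_sup (spectral_norm_has_sup M).2 _ _.
exists ((norm2 u)^-1 *: u) => /=.
  by rewrite norm2Z ger0_norm ?invr_ge0 ?norm2_ge0 // mulVf.
by rewrite -scalemxAr norm2Z ger0_norm ?invr_ge0 ?norm2_ge0 // mulrC.
Qed.

Lemma spectral_norm_gt0 m n (M : 'M[R]_(m, n)) : M != 0 -> 0 < spectral_norm M.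
Proof.
move=> M0; have [j Mj] : exists j, col j M != 0.
  apply: contrapT => /forallNP h; move/negP: M0; apply; apply/eqP/matrixP => i j.
  have /negP := h j; rewrite negbK => /eqP /matrixP /(_ i 0); by rewrite !mxE.
have := spectral_normP M (delta_mx j 0); rewrite -colE.
have -> : norm2 (delta_mx j 0 : 'cV[R]_n) = 1.
  rewrite norm2E (bigD1 j) //= mxE !eqxx big1 ?addr0 ?expr1n ?sqrtr1 // => i ij.
  by rewrite mxE (negbTE ij) expr0n.
rewrite mulr1; apply: lt_le_trans; rewrite lt_def norm2_ge0 andbT.
by apply: contraNneq Mj => /norm2_eq0 ->.
Qed.

(** Cauchy-Schwarz in |M^T v|^2 = <v, M (M^T v)>; the bound for A thus serves for A^T too. *)
Lemma norm2_tr_mulmx m n (M : 'M[R]_(m, n)) L : 0 <= L ->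
  (forall u, norm2 (M *m u) <= L * norm2 u) ->
  forall v, norm2 (M^T *m v) <= L * norm2 v.
Proof.
move=> L0 hM v; set x := M^T *m v.
have [->|x0] := eqVneq (norm2 x) 0; first by rewrite mulr_ge0 ?norm2_ge0.
have xp : 0 < norm2 x by rewrite lt_def x0 norm2_ge0.
rewrite -(ler_pM2l xp) -expr2 norm2_sq {1}/x -dotv_mulr.
apply: le_trans (dotv_CS _ _) _; rewrite mulrC.
apply: le_trans (ler_wpM2r (norm2_ge0 v) (hM x)) _.
by rewrite le_eqVlt; apply/orP; left; apply/eqP; ring.
Qed.

End EuclideanNorm.

(** * Restarted Halpern orbits of skew operators *)

Section BilinearSums.
Variable R : realType.

Lemma dotv_sumr n (I : Type) (r : seq I) (Q : pred I) (F : I -> 'cV[R]_n) x :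
  dotv x (\sum_(i <- r | Q i) F i) = \sum_(i <- r | Q i) dotv x (F i).
Proof. by rewrite /dotv mulmx_sumr summxE. Qed.

Lemma dotv_suml n (I : Type) (r : seq I) (Q : pred I) (F : I -> 'cV[R]_n) x :
  dotv (\sum_(i <- r | Q i) F i) x = \sum_(i <- r | Q i) dotv (F i) x.
Proof. by rewrite dotvC dotv_sumr; apply: eq_bigr => i _; rewrite dotvC. Qed.

Lemma dotv_le0 n (x y : 'cV[R]_n) :
  (forall i, x i 0 * y i 0 <= 0) -> dotv x y <= 0.
Proof. by move=> h; rewrite dotvE; apply: sumr_le0 => i _; exact: h. Qed.

End BilinearSums.

Section SkewLoop.
Variables (R : realType) (D : nat) (P M : 'M[R]_D) (I : {set 'I_D}).
Local Notation V := 'cV[R]_D.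

(* The k-th Halpern iterate anchored at [w], where [t j] is the image under the
   resolvent of the j-th one. *)
Definition halpern_pt (w : V) (t : nat -> V) (k : nat) : V :=
  k.+1%:R^-1 *: (k%:R *: t k.-1 + w).

(* [t k] is the image of the k-th Halpern iterate under the resolvent, in the
   metric P, of the sum of the skew operator M and of the normal cone of
   [x_i >= 0] for i in I; [g k] is the normal vector. *)
Definition skew_loop (N : nat) (w : V) (t g : nat -> V) : Prop :=
  forall k, (k <= N)%N ->
    [/\ P *m (halpern_pt w t k - t k) = M *m t k + g k,
        forall i, i \in I -> [/\ g k i 0 <= 0, 0 <= t k i 0 & g k i 0 * t k i 0 = 0] &
        forall i, i \notin I -> g k i 0 = 0].

Lemma halpern_ptE w t k : k.+1%:R *: halpern_pt w t k = k%:R *: t k.-1 + w.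
Proof. by rewrite /halpern_pt scalerA mulfV ?scale1r // pnatr_eq0. Qed.

Lemma halpern_pt0 w t : halpern_pt w t 0 = w.
Proof. by rewrite /halpern_pt invr1 scale1r scale0r add0r. Qed.

Hypotheses (Psym : P^T = P) (Mskew : M^T = - M).
Variable lo : R.
Hypotheses (lo0 : 0 < lo) (Plo : forall x : V, lo * dotv x x <= dotv x (P *m x)).

Let Ppsd (x : V) : 0 <= dotv x (P *m x).
Proof. by apply: le_trans (Plo x); rewrite mulr_ge0 ?dotv_ge0 // ltW. Qed.

Lemma Pdef_eq0 (x : V) : dotv x (P *m x) <= 0 -> x = 0.
Proof.
move=> h; apply: dotv_eq0; have := Plo x; have := dotv_ge0 x; have := lo0.
by move=> *; nra.
Qed.

Lemma Pdef_unit : P \in unitmx.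
Proof.
rewrite -row_free_unit -kermx_eq0; apply/eqP/row_matrixP => i.
rewrite row0; set x := row i _; have hx : x *m P = 0.
  by rewrite -row_mul mulmx_ker row0.
apply: (can_inj (@trmxK _ _ _)); rewrite trmx0; apply: Pdef_eq0.
by rewrite dotv_mulr Psym -{1}Psym -trmx_mul hx trmx0 dotv0l.
Qed.

Section OneLoop.
Variables (N : nat) (w : V) (t g : nat -> V).
Hypothesis loop : skew_loop N w t g.

(** The skew part drops out of the pairing with [t k], and the normal vector is complementary to
    it. *)
Lemma skew_loop_orth k : (k <= N)%N -> dotv (t k) (P *m (halpern_pt w t k - t k)) = 0.
Proof.
move=> kN; have [-> sgn off] := loop kN.
rewrite dotvDr dotv_skew // add0r dotvE big1 // => i _.
have [/sgn[_ _ h]|/off ->] := boolP (i \in I); last by rewrite mulr0.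
by rewrite mulrC.
Qed.

(** For x_k = k t_{k-1}, orthogonality turns the sum of |x_k - x_{k+1}|_P^2 into 2 <sum x, w>_P -
    |x_{N+1}|_P^2. When t_N = 0 the last term vanishes and the summed inclusions give <sum x, w>_P
    <= 0, so every x_k equals x_0 = 0. *)
Lemma skew_loop_landing : t N = 0 -> forall k, (k <= N)%N -> t k = 0.
Proof.
move=> tN.
have [x xE] : exists x : nat -> V, forall k, x k = k%:R *: t k.-1 by eexists.
pose b (u v : V) := dotv u (P *m v).
have bDl (u v z : V) : b (u + v) z = b u z + b v z by rewrite /b dotvDl.
have bDr (u v z : V) : b z (u + v) = b z u + b z v by rewrite /b mulmxDr dotvDr.
have bNl (u v : V) : b (- u) v = - b u v by rewrite /b dotvNl.
have bNr (u v : V) : b u (- v) = - b u v by rewrite /b mulmxN dotvNr.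
have bZl (u v : V) (a : R) : b (a *: u) v = a * b u v by rewrite /b dotvZl.
have bZr (u v : V) (a : R) : b u (a *: v) = a * b u v by rewrite /b -scalemxAr dotvZr.
pose bE := (bDl, bDr, bNl, bNr, bZl, bZr).
have bC u v : b u v = b v u by exact: dotv_sym.
have orth k : (k <= N)%N -> b (x k.+1) (x k + w - x k.+1) = 0.
  move=> kN; rewrite !xE -halpern_ptE -scalerBr /b -scalemxAr /= dotvZl dotvZr.
  by rewrite skew_loop_orth // !mulr0.
have tel n : (n <= N.+1)%N ->
    \sum_(k < n) b (x k - x k.+1) (x k - x k.+1)
    = 2 * \sum_(k < n) b (x k.+1) w - b (x n) (x n).
  elim: n => [|n IH] nN.
    by rewrite !big_ord0 xE scale0r /b dotv0l mulr0 subr0.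
  rewrite !big_ord_recr /= IH ?(ltnW nN) //; have := orth n nN.
  rewrite !bE. rewrite (bC (x n.+1) (x n)); lra.
have sumP n : (n <= N.+1)%N ->
    P *m (\sum_(k < n) (x k + w - x k.+1))
    = M *m (\sum_(k < n) x k.+1) + \sum_(k < n) k.+1%:R *: g k.
  elim: n => [|n IH] nN; first by rewrite !big_ord0 !mulmx0 addr0.
  rewrite !big_ord_recr /= !mulmxDr -mulmxDr IH ?(ltnW nN) //.
  have [h _ _] := loop nN.
  have -> : P *m (x n + w) + P *m - x n.+1 = M *m x n.+1 + n.+1%:R *: g n.
    by rewrite -mulmxDr !xE -halpern_ptE -scalerBr -scalemxAr h scalerDr scalemxAr.
  by rewrite !addrA; congr (_ + _); rewrite addrAC.
have sumw : \sum_(k < N.+1) (x k + w - x k.+1) = N.+1%:R *: w.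
  have -> : \sum_(k < N.+1) (x k + w - x k.+1) = N.+1%:R *: w + x 0 - x N.+1.
    elim: (N.+1) => [|n IH]; first by rewrite big_ord0 scale0r add0r subrr.
    rewrite big_ord_recr /= IH -[in RHS]natr1.
    by apply/matrixP => i j; rewrite !mxE; ring.
  by rewrite !xE /= tN scaler0 scale0r subr0 addr0.
have := sumP N.+1 (leqnn _); rewrite sumw => /(congr1 (dotv (\sum_(k < N.+1) x k.+1))).
rewrite -/(b _ _) bE dotvDr dotv_skew // add0r => eqS.
(* Vectors g and t from different steps need not be complementary, but on I they keep opposite
   signs. *)
have Sle0 : dotv (\sum_(k < N.+1) x k.+1) (\sum_(k < N.+1) k.+1%:R *: g k) <= 0.
  apply: dotv_le0 => i; rewrite !summxE.
  have [iI|iI] := boolP (i \in I); last first.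
    rewrite [X in _ * X]big1 ?mulr0 // => k _; have [_ _ h] := loop (ltn_ord k : (k <= N)%N).
    by rewrite mxE h // mulr0.
  apply: mulr_ge0_le0; [apply: sumr_ge0|apply: sumr_le0] => k _;
    have [_ /(_ i iI)[h1 h2 _] _] := loop (ltn_ord k : (k <= N)%N); rewrite ?xE !mxE /=.
    by rewrite mulr_ge0.
  by rewrite mulr_ge0_le0.
have sum0 : \sum_(k < N.+1) b (x k - x k.+1) (x k - x k.+1) <= 0.
  rewrite tel // (xE N.+1) /= tN scaler0 {2}/b dotv0l subr0.
  have -> : \sum_(k < N.+1) b (x k.+1) w = b (\sum_(k < N.+1) x k.+1) w.
    by rewrite /b dotv_suml.
  have : 0 < N.+1%:R :> R by rewrite ltr0n.
  by move: eqS Sle0 => <-; nra.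
have step k : (k <= N)%N -> x k.+1 = x k.
  move=> kN; apply/esym/eqP; rewrite -subr_eq0; apply/eqP/Pdef_eq0.
  apply: le_trans sum0; rewrite (bigD1 (Ordinal (kN : (k < N.+1)%N))) //= lerDl.
  by apply: sumr_ge0 => j _; exact: Ppsd.
have x0 k : (k <= N.+1)%N -> x k = 0.
  elim: k => [|k IH] kN; first by rewrite xE scale0r.
  by rewrite step // IH // ltnW.
move=> k kN; have /eqP := x0 k.+1 kN.
by rewrite xE scaler_eq0 pnatr_eq0 /= => /eqP.
Qed.

(** The inclusions are summed with weights (k+1) q^k. Since k+1 times the k-th Halpern point is k
    t_{k-1} + w, Abel summation leaves q - 1 times the weighted sum of the t_k and one boundary
    term. *)
Lemma skew_loop_weighted (q : R) :
  P *m ((\sum_(k < N.+1) q ^+ k) *: w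
        + (q - 1) *: (\sum_(k < N.+1) (k.+1%:R * q ^+ k) *: t k)
        - (N.+1%:R * q ^+ N.+1) *: t N)
  = M *m (\sum_(k < N.+1) (k.+1%:R * q ^+ k) *: t k)
    + \sum_(k < N.+1) (k.+1%:R * q ^+ k) *: g k.
Proof.
suff H n : (n <= N)%N -> P *m ((\sum_(k < n.+1) q ^+ k) *: w
        + (q - 1) *: (\sum_(k < n.+1) (k.+1%:R * q ^+ k) *: t k)
        - (n.+1%:R * q ^+ n.+1) *: t n)
  = M *m (\sum_(k < n.+1) (k.+1%:R * q ^+ k) *: t k)
    + \sum_(k < n.+1) (k.+1%:R * q ^+ k) *: g k by exact: H.
elim: n => [|n IH] nN.
  rewrite !big_ord1 expr0 !mul1r expr1 !scale1r; have [] := loop (leq0n N).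
  rewrite halpern_pt0 => <- _ _; congr (_ *m _).
  by apply/matrixP => i j; rewrite !mxE; ring.
have [h _ _] := loop nN.
have e : (n.+2%:R * q ^+ n.+1) *: (halpern_pt w t n.+1 - t n.+1)
    = q ^+ n.+1 *: (n.+1%:R *: t n + w) - (n.+2%:R * q ^+ n.+1) *: t n.+1.
  by rewrite scalerBr [n.+2%:R * _]mulrC -[in LHS]scalerA halpern_ptE.
move: h => /(congr1 (fun v : V => (n.+2%:R * q ^+ n.+1) *: v)).
rewrite /= scalemxAr e [RHS]scalerDr scalemxAr => h.
rewrite !(big_ord_recr n.+1) /= [in RHS]mulmxDr [RHS]addrACA -(IH (ltnW nN)).
rewrite -h -mulmxDr; congr (_ *m _).
by apply/matrixP => i j; rewrite !mxE !exprS; ring.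
Qed.

End OneLoop.

End SkewLoop.

(** * Geometric weights for a sequence of loops *)

Section GeometricWeights.
Variable R : realType.
Implicit Types (q r : R) (N n : nat).

Definition geosum q N : R := \sum_(k < N.+1) q ^+ k.

Lemma geosum_ge q N : 1 <= q -> N.+1%:R <= geosum q N.
Proof.
move=> q1; have -> : N.+1%:R = \sum_(k < N.+1) 1 :> R by rewrite sumr_const card_ord.
by apply: ler_sum => k _; exact: exprn_ege1.
Qed.

Lemma geosum_gt0 q N : 1 <= q -> 0 < geosum q N.
Proof. by move=> q1; apply: lt_le_trans (geosum_ge N q1); rewrite ltr0n. Qed.

Lemma geosum_le q N : 1 <= q -> geosum q N <= N.+1%:R * q ^+ N.
Proof.
move=> q1; have -> : N.+1%:R * q ^+ N = \sum_(k < N.+1) q ^+ N.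
  by rewrite sumr_const card_ord mulr_natl.
by apply: ler_sum => k _; apply: ler_weXn2l => //; rewrite -ltnS.
Qed.

Lemma geosum_mono q r N : 1 <= q -> 1 <= r -> geosum q N <= geosum (q * r) N.
Proof.
move=> q1 r1; apply: ler_sum => k _; rewrite exprMn ler_peMr ?exprn_ege1 //.
by rewrite exprn_ge0 // (le_trans ler01).
Qed.

Variable N : nat -> nat.

(** In [skew_loop_weighted] the anchor has coefficient [geosum] and the last image (N+1) q^(N+1).
    The weight grows by their quotient, so that the end of a loop cancels against the anchor of the
    next. *)
Fixpoint loop_weight q n : R :=
  if n is j.+1 then loop_weight q j * ((N j).+1%:R * q ^+ (N j).+1 / geosum q (N j))
  else 1.

Lemma loop_weight_gt0 q n : 1 <= q -> 0 < loop_weight q n.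
Proof.
move=> q1; have q0 : 0 < q by exact: lt_le_trans ltr01 q1.
elim: n => //= n IH; rewrite mulr_gt0 // divr_gt0 ?geosum_gt0 //.
by rewrite mulr_gt0 ?ltr0n // exprn_gt0.
Qed.

Lemma loop_weight_step q n : 1 <= q -> q * loop_weight q n <= loop_weight q n.+1.
Proof.
move=> q1 /=; rewrite mulrC ler_pM2l ?loop_weight_gt0 //.
rewrite ler_pdivlMr ?geosum_gt0 // exprS mulrCA ler_pM2l ?geosum_le //.
exact: lt_le_trans ltr01 q1.
Qed.

Lemma loop_weight_exp q n : 1 <= q -> q ^+ n <= loop_weight q n.
Proof.
move=> q1; elim: n => [|n IH]; first by rewrite expr0.
by apply: le_trans (loop_weight_step n q1); rewrite exprS ler_pM2l ?(lt_le_trans ltr01 q1).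
Qed.

Lemma loop_weight_mono q n m : 1 <= q -> (n <= m)%N ->
  loop_weight q n <= loop_weight q m.
Proof.
move=> q1 /subnKC <-; elim: (m - n)%N => [|j IH]; first by rewrite addn0.
apply: le_trans IH _; rewrite addnS; apply: le_trans (loop_weight_step _ q1).
by rewrite ler_peMl // ltW // loop_weight_gt0.
Qed.

(** In each loop the numerator gains at most r^K and the denominator [geosum] only grows. *)
Lemma loop_weight_ratio q r K n : 1 <= q -> 1 <= r ->
  (forall j, (N j).+1 <= K)%N ->
  loop_weight (q * r) n <= loop_weight q n * r ^+ (K * n).
Proof.
move=> q1 r1 NK; have q0 : 0 < q by exact: lt_le_trans ltr01 q1.
have r0 : 0 < r by exact: lt_le_trans ltr01 r1.
have qr1 : 1 <= q * r by rewrite mulr_ege1.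
elim: n => [|n IH]; first by rewrite muln0 expr0 mulr1.
rewrite mulnS addnC exprD /= mulrACA.
apply: ler_pM => //.
- by rewrite ltW // loop_weight_gt0.
- by rewrite divr_ge0 ?ltW ?geosum_gt0 // mulr_gt0 ?ltr0n // exprn_gt0 // mulr_gt0.
rewrite exprMn -[leRHS]mulrAC mulrA; apply: ler_pM.
- by rewrite !mulr_ge0 ?exprn_ge0 ?ltW.
- by rewrite invr_ge0 ltW // geosum_gt0.
- rewrite ler_pM2l ?mulr_gt0 ?ltr0n ?exprn_gt0 //.
  exact: ler_weXn2l.
- by rewrite lef_pV2 ?posrE ?geosum_gt0 // geosum_mono.
Qed.

Lemma loop_weight_le q K n : 1 <= q -> (forall j, (N j).+1 <= K)%N ->
  loop_weight q n <= q ^+ (K * n).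
Proof.
move=> q1 NK; have := loop_weight_ratio n (lexx 1) q1 NK.
have -> : loop_weight 1 n = 1.
  elim: n => //= n ->; rewrite mul1r expr1n mulr1 /geosum.
  under eq_bigr do rewrite expr1n.
  by rewrite sumr_const card_ord divff // pnatr_eq0.
by rewrite !mul1r.
Qed.

End GeometricWeights.

(** * Weighted activity of a restarted orbit *)

Section RestartedOrbit.
Variables (R : realType) (D : nat) (P M : 'M[R]_D) (I : {set 'I_D}).
Local Notation V := 'cV[R]_D.
Hypotheses (Psym : P^T = P) (Mskew : M^T = - M).
Variable lo : R.
Hypotheses (lo0 : 0 < lo) (Plo : forall x : V, lo * dotv x x <= dotv x (P *m x)).

Variables (N : nat -> nat) (w : nat -> V) (t g : nat -> nat -> V).

Definition restarted_orbit : Prop :=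
  forall n, skew_loop P M I (N n) (w n) (t n) (g n) /\ w n.+1 = t n (N n).

Definition activity n k : R := \sum_(i in I) (t n k i 0 - g n k i 0).

Definition loop_activity n : R := \sum_(k < (N n).+1) activity n k.

Hypothesis orb : restarted_orbit.

Lemma activity_ge0 n k : (k <= N n)%N -> 0 <= activity n k.
Proof.
move=> kN; apply: sumr_ge0 => i iI; have [/(_ k kN)[_ /(_ i iI)[h1 h2 _] _] _] := orb n.
by lra.
Qed.

Local Notation be := (loop_weight N).

(* Normalised so that, in the weighted sum of z - t, the anchor terms telescope from
   one loop to the next. *)
Definition step_weight q n k : R := be q n / geosum q (N n) * (k.+1%:R * q ^+ k).

Lemma step_weight_ge0 q n k : 1 <= q -> 0 <= step_weight q n k.
Proof.
move=> q1; rewrite !mulr_ge0 ?invr_ge0 ?exprn_ge0 ?(le_trans ler01 q1) //.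
- by rewrite ltW // loop_weight_gt0.
- by rewrite ltW // geosum_gt0.
Qed.

Definition weighted_activity q n : R :=
  \sum_(k < (N n).+1) step_weight q n k * activity n k.

Lemma weighted_activity_ge0 q n : 1 <= q -> 0 <= weighted_activity q n.
Proof.
move=> q1; apply: sumr_ge0 => k _.
by rewrite mulr_ge0 ?step_weight_ge0 // activity_ge0 // -ltnS.
Qed.

Let S q n m : V := \sum_(n <= j < m) \sum_(k < (N j).+1) step_weight q j k *: t j k.
Let G q n m : V := \sum_(n <= j < m) \sum_(k < (N j).+1) step_weight q j k *: g j k.

Lemma orbit_weighted q n m : 1 <= q -> (n <= m)%N ->
  P *m (be q n *: w n + (q - 1) *: S q n m - be q m *: w m) = M *m S q n m + G q n m.
Proof.
move=> q1 /subnKC <-; elim: (m - n)%N => [|j IH].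
  by rewrite addn0 /S /G !big_geq // scaler0 addr0 subrr !mulmx0 addr0.
have [lp wj] := orb (n + j)%N.
have -> : w (n + j.+1)%N = t (n + j)%N (N (n + j)) by rewrite addnS.
have := skew_loop_weighted lp q; set c := be q (n + j) / geosum q (N (n + j)).
set s := \sum_(k < _) _ *: t _ _; set h := \sum_(k < _) _ *: g _ _.
move/(congr1 (fun v : V => c *: v)); rewrite scalerDr !scalemxAr.
have Ss : S q n (n + j.+1) = S q n (n + j) + c *: s.
  rewrite /S addnS big_nat_recr ?leq_addr //= /s scaler_sumr.
  by congr (_ + _); apply: eq_bigr => k _; rewrite scalerA.
have Gs : G q n (n + j.+1) = G q n (n + j) + c *: h.
  rewrite /G addnS big_nat_recr ?leq_addr //= /h scaler_sumr.
  by congr (_ + _); apply: eq_bigr => k _; rewrite scalerA.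
move=> e; rewrite Ss Gs [M *m (_ + _)]mulmxDr [RHS]addrACA -IH -e -mulmxDr; congr (_ *m _).
have gs0 : geosum q (N (n + j)) != 0 by rewrite gt_eqF // geosum_gt0.
have ew : c * (\sum_(k < (N (n + j)).+1) q ^+ k) = be q (n + j).
  by rewrite /c -/(geosum q (N (n + j))) divfK.
have et : c * ((N (n + j)).+1%:R * q ^+ (N (n + j)).+1) = be q (n + j.+1).
  by rewrite addnS /= /c mulrAC mulrA.
rewrite -et -ew; apply/matrixP => a b; rewrite !mxE; ring.
Qed.

Lemma weighted_activity_sum q n m :
  \sum_(n <= j < m) weighted_activity q j = \sum_(i in I) (S q n m i 0 - G q n m i 0).
Proof.
rewrite /weighted_activity /activity.
under eq_bigr do under eq_bigr do rewrite mulr_sumr.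
under eq_bigr do rewrite exchange_big /=.
rewrite exchange_big /=; apply: eq_bigr => i _.
rewrite /S /G !summxE -sumrB; apply: eq_bigr => j _.
by rewrite !summxE -sumrB; apply: eq_bigr => k _; rewrite !mxE mulrBr.
Qed.

(** Pairing [orbit_weighted] with S removes M by skewness and leaves <S, G> <= 0, so (q - 1) |S| is
    bounded by the two boundary terms. The identity then bounds G, and the activity is a sum of
    coordinates of S - G. *)
Lemma weighted_activity_bound : exists2 C : R, 0 <= C & forall q n m, 1 < q -> (n <= m)%N ->
  \sum_(n <= j < m) weighted_activity q j
  <= C * (1 + (q - 1)^-1) * (be q n * norm2 (w n) + be q m * norm2 (w m)).
Proof.
have [CP CP0 hP] := norm2_mulmx_bound P.
have [CM CM0 hM] := norm2_mulmx_bound M.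
have [c1 c10 c1E] : exists2 c1, 0 <= c1 & c1 = CP / lo.
  by exists (CP / lo) => //; rewrite divr_ge0 // ltW.
pose C := D%:R * (CP + CP * c1 + c1 + CM * c1).
have C0 : 0 <= C by rewrite /C mulr_ge0 ?ler0n // !addr_ge0 // mulr_ge0.
exists C => // q n m q1 nm; have q1' := ltW q1.
set b := _ + _ * norm2 _; have p0 : 0 < q - 1 by rewrite subr_gt0.
have bw j : norm2 (be q j *: w j) = be q j * norm2 (w j).
  by rewrite norm2Z ger0_norm // ltW // loop_weight_gt0.
pose d : V := be q n *: w n - be q m *: w m.
have db : norm2 d <= b.
  by apply: le_trans (norm2_triangle _ _) _; rewrite norm2N !bw.
have b0 : 0 <= b by apply: le_trans db; exact: norm2_ge0.
have Sg i : i \in I -> 0 <= S q n m i 0.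
  move=> iI; rewrite summxE; apply: sumr_ge0 => j _; rewrite summxE.
  apply: sumr_ge0 => k _; have [/(_ k (ltn_ord k : (k <= _)%N))[_ /(_ i iI)[_ h _] _] _] := orb j.
  by rewrite mxE mulr_ge0 // step_weight_ge0.
have Gg i : i \in I -> G q n m i 0 <= 0.
  move=> iI; rewrite summxE; apply: sumr_le0 => j _; rewrite summxE.
  apply: sumr_le0 => k _; have [/(_ k (ltn_ord k : (k <= _)%N))[_ /(_ i iI)[h _ _] _] _] := orb j.
  by rewrite mxE mulr_ge0_le0 // step_weight_ge0.
have G0 i : i \notin I -> G q n m i 0 = 0.
  move=> iI; rewrite summxE big1 // => j _; rewrite summxE big1 // => k _.
  have [/(_ k (ltn_ord k : (k <= _)%N))[_ _ h] _] := orb j.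
  by rewrite mxE h ?mulr0.
have SG : dotv (S q n m) (G q n m) <= 0.
  apply: dotv_le0 => i; have [iI|iI] := boolP (i \in I); last by rewrite G0 ?mulr0.
  by rewrite mulr_ge0_le0 ?Sg ?Gg.
have := orbit_weighted q1' nm; rewrite addrAC -/d mulmxDr => e.
set s := S q n m in e SG Sg *; set h := G q n m in e SG Gg G0 *.
have sb : (q - 1) * norm2 s <= c1 * b.
  have := congr1 (dotv s) e; rewrite -scalemxAr !dotv_lin dotv_skew // add0r => e'.
  have h1 : (q - 1) * (lo * norm2 s ^+ 2) <= norm2 s * (CP * b).
    rewrite norm2_sq; apply: le_trans (ler_wpM2l (ltW p0) (Plo s)) _.
    have : - dotv s (P *m d) <= norm2 s * norm2 (P *m d).
      by rewrite -dotvNl -(norm2N s) dotv_CS.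
    have := ler_wpM2l (norm2_ge0 s) (le_trans (hP d) (ler_wpM2l CP0 db)).
    by move: e' SG; lra.
  have [->|s0] := eqVneq (norm2 s) 0; first by rewrite mulr0 mulr_ge0.
  have sp : 0 < norm2 s by rewrite lt_def s0 norm2_ge0.
  rewrite c1E mulrAC ler_pdivlMr // -(ler_pM2l sp).
  by apply: le_trans h1; rewrite le_eqVlt; apply/orP; left; apply/eqP; ring.
have hb : norm2 h <= CP * b + CP * (c1 * b) + CM * norm2 s.
  have -> : h = P *m d + P *m ((q - 1) *: s) - M *m s by rewrite e addrAC subrr add0r.
  apply: le_trans (norm2_triangle _ _) _; rewrite norm2N; apply: lerD (hM s).
  apply: le_trans (norm2_triangle _ _) _; apply: lerD.
    by apply: le_trans (hP d) _; rewrite ler_wpM2l.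
  by apply: le_trans (hP _) _; rewrite ler_wpM2l // norm2Z ger0_norm // ltW.
have sb' : norm2 s <= c1 * b * (q - 1)^-1 by rewrite ler_pdivlMr // mulrC.
rewrite weighted_activity_sum -/s -/h.
apply: (@le_trans _ _ (D%:R * (norm2 s + norm2 h))).
  rewrite -[D in D%:R]card_ord -sumr_const mulr_suml big_mkcond /=; apply: ler_sum => i _.
  rewrite mul1r; case: ifP => _; last by rewrite addr_ge0 ?norm2_ge0.
  have := norm2_coord s i; have := norm2_coord h i; rewrite !ler_norml.
  by move=> /andP[a1 a2] /andP[a3 a4]; lra.
rewrite /C -!mulrA ler_wpM2l //.
have ip : 0 <= (q - 1)^-1 by rewrite invr_ge0 ltW.
set ii := (q - 1)^-1 in sb' ip *.
have : CM * norm2 s <= CM * (c1 * b * ii) by rewrite ler_wpM2l.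
have : 0 <= CP * b * ii by rewrite !mulr_ge0 //.
have : 0 <= CP * c1 * b * ii by rewrite !mulr_ge0 //.
have : 0 <= c1 * b by rewrite !mulr_ge0 //.
have : 0 <= CM * c1 * b by rewrite !mulr_ge0 //.
by move: hb sb'; lra.
Qed.

End RestartedOrbit.

Section GeometricSequences.
Variable R : realType.

Lemma bernoulli_le (x : R) n : 0 <= x <= 1 -> 1 - n%:R * x <= (1 - x) ^+ n.
Proof.
move=> /andP[x0 x1]; elim: n => [|n IH]; first by rewrite expr0 mul0r subr0.
rewrite exprS; have y0 : 0 <= 1 - x by lra.
apply: le_trans (ler_wpM2l y0 IH); rewrite -natr1.
have : 0 <= n%:R * (x * x) by rewrite !mulr_ge0.
lra.
Qed.

Lemma exists_expr_lt (theta : R) K : 0 <= theta -> theta < 1 ->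
  exists2 r : R, 1 < r & r ^+ K * theta < 1.
Proof.
(* By Bernoulli (1 - x)^K >= 1 - K x > theta for this x, so that r = 1 / (1 - x) works. *)
move=> t0 t1; pose x := (1 - theta) / (2 * K.+1%:R).
have K0 : 0 < K.+1%:R :> R by rewrite ltr0n.
have xE : 2 * (K.+1%:R * x) = 1 - theta by rewrite /x mulrA mulrC divfK // gt_eqF // mulr_gt0.
have x0 : 0 < x by rewrite divr_gt0 ?mulr_gt0 ?subr_gt0.
have Kx : K%:R * x + x = K.+1%:R * x by rewrite -natr1 mulrDl mul1r.
have Kx0 : 0 <= K%:R * x by rewrite mulr_ge0 // ltW.
have y0 : 0 < 1 - x by lra.
exists (1 - x)^-1; first by rewrite invf_gt1 //; lra.
rewrite exprVn mulrC ltr_pdivrMr ?exprn_gt0 // mul1r.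
have x1 : 0 <= x <= 1 by apply/andP; split; lra.
by have := bernoulli_le K x1; lra.
Qed.

Lemma geometric_small (C x e : R) : 0 <= C -> 0 <= x -> x < 1 -> 0 < e ->
  exists i0, forall i, (i0 <= i)%N -> C * x ^+ i < e.
Proof.
move=> C0 x0 x1 e0; have nx : `|x| < 1 by rewrite ger0_norm.
have e1 : 0 < e / (C + 1) by rewrite divr_gt0 // ltr_wpDl.
have := cvg_expr nx => /cvgr0Pnorm_lt /(_ _ e1) [i0 _ h].
exists i0 => i /h /=; rewrite normrX (ger0_norm x0) ltr_pdivlMr ?ltr_wpDl // => hi.
apply: le_lt_trans hi; rewrite mulrC ler_wpM2l ?exprn_ge0 //; lra.
Qed.

End GeometricSequences.

(** * Unlimited improvement of the decay rate of an observable orbit *)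

Section ObservableOrbit.
Variables (R : realType) (D : nat) (P M : 'M[R]_D) (I : {set 'I_D}).
Local Notation V := 'cV[R]_D.
Hypotheses (Psym : P^T = P) (Mskew : M^T = - M).
Variable lo : R.
Hypotheses (lo0 : 0 < lo) (Plo : forall x : V, lo * dotv x x <= dotv x (P *m x)).
Variables (N : nat -> nat) (w : nat -> V) (t g : nat -> nat -> V).
Hypothesis orb : restarted_orbit P M I N w t g.
Variables (K L : nat) (C2 C0 rho : R).
Hypotheses (NK : forall n, ((N n).+1 <= K)%N) (C20 : 0 <= C2).
Hypothesis observable :
  forall n, norm2 (w n) <= C2 * \sum_(n <= j < n + L.+1) loop_activity I N t g j.
Hypotheses (C00 : 0 <= C0) (rho0 : 0 <= rho) (rho1 : rho < 1).
Hypothesis decay : forall n, norm2 (w n) <= C0 * rho ^+ n.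

Local Notation be := (loop_weight N).
Local Notation W := (weighted_activity I N t g).
Let B q n : R := be q n * norm2 (w n).
(** A rate is good when the anchors decay fast enough to beat the weights, so that the boundary term
    at infinity disappears. *)
Let good q : Prop := forall e, 0 < e -> exists m0, forall m, (m0 <= m)%N -> B q m < e.
Let c3 q : R := C2 * (K%:R * q ^+ K).

Let B0 q n : 1 <= q -> 0 <= B q n.
Proof. by move=> q1; rewrite mulr_ge0 ?norm2_ge0 // ltW // loop_weight_gt0. Qed.

Let act0 n k : (k <= N n)%N -> 0 <= activity I t g n k.
Proof. exact: activity_ge0 orb _ _. Qed.

Let step_weight_lower (q : R) n k : 1 <= q -> (k <= N n)%N ->
  be q n <= K%:R * q ^+ K * step_weight N q n k.
Proof.
move=> q1 kN; have gs0 := geosum_gt0 (N n) q1.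
rewrite /step_weight; set b := be q n; set x := k.+1%:R * _; set kq := K%:R * _.
have -> : kq * (b / geosum q (N n) * x) = b * (kq / geosum q (N n) * x) by ring.
rewrite ler_peMr //; first by rewrite ltW // loop_weight_gt0.
apply: mulr_ege1; last by apply: mulr_ege1; [rewrite ler1n | exact: exprn_ege1].
rewrite ler_pdivlMr // mul1r; apply: le_trans (geosum_le (N n) q1) _.
apply: ler_pM => //; first by rewrite exprn_ge0 // (le_trans ler01 q1).
  by rewrite ler_nat.
by apply: ler_weXn2l => //; apply: ltnW; exact: NK.
Qed.

Let W0 q j : 1 <= q -> 0 <= W q j.
Proof. by move=> q1; apply: weighted_activity_ge0 orb _ _ q1. Qed.

Let c30 q : 1 <= q -> 0 <= c3 q.
Proof. by move=> q1; rewrite !mulr_ge0 // exprn_ge0 // (le_trans ler01 q1). Qed.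

Let B_window q n : 1 <= q -> B q n <= c3 q * \sum_(n <= j < n + L.+1) W q j.
Proof.
move=> q1; have b0 : 0 <= be q n by rewrite ltW // loop_weight_gt0.
apply: le_trans (ler_wpM2l b0 (observable n)) _.
rewrite mulrCA /c3 -mulrA; apply: ler_wpM2l => //.
rewrite !mulr_sumr; apply: ler_sum_nat => j /andP[nj _].
rewrite /loop_activity /weighted_activity !mulr_sumr; apply: ler_sum => k _.
rewrite mulrA; apply: ler_wpM2r; first by apply: act0; rewrite -ltnS.
apply: le_trans (loop_weight_mono N q1 nj) _.
by apply: step_weight_lower => //; rewrite -ltnS.
Qed.

Let tail q n x : Prop := forall m, (n <= m)%N -> \sum_(n <= j < m) W q j <= x.

Let sum_mono q n m m' : 1 <= q -> (n <= m)%N -> (m <= m')%N ->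
  \sum_(n <= j < m) W q j <= \sum_(n <= j < m') W q j.
Proof.
move=> q1 nm mm'; rewrite (big_cat_nat nm mm') /= lerDl.
by apply: sumr_ge0 => j _; exact: W0.
Qed.

(** The partial sums increase, so m may be pushed to infinity, where [B q m] vanishes. *)
Let tail_good C q n : 0 <= C -> 1 <= q ->
  (forall m, (n <= m)%N -> \sum_(n <= j < m) W q j <= C * (B q n + B q m)) ->
  good q -> tail q n (C * B q n).
Proof.
move=> C_0 q1 h gq m nm; apply/ler_addgt0Pr => e e0.
have e1 : 0 < e / (C + 1) by rewrite divr_gt0 // ltr_wpDl.
have [m0 hm0] := gq _ e1; pose m' := maxn m m0.
have mm' : (m <= m')%N by rewrite leq_maxl.
apply: le_trans (sum_mono q1 nm mm') _; apply: le_trans (h _ (leq_trans nm mm')) _.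
rewrite mulrDr lerD2l; have := hm0 _ (leq_maxr m m0); rewrite -/m' ltr_pdivlMr ?ltr_wpDl //.
by have := B0 m' q1; nra.
Qed.

(** Hole filling: if Y is what remains after the window, then Y <= a win; adding a Y to both sides
    gives (1 + a) Y <= a x. *)
Let tail_step a q n x : 0 <= a -> 1 <= q ->
  tail q n (a * \sum_(n <= j < n + L.+1) W q j) -> tail q n x ->
  tail q (n + L.+1) (a / (1 + a) * x).
Proof.
move=> a0 q1 h1 h2 m nm; set win := \sum_(n <= j < n + L.+1) _ in h1.
have e : \sum_(n <= j < m) W q j = win + \sum_(n + L.+1 <= j < m) W q j.
  by rewrite (big_cat_nat (leq_addr _ _) nm).
have nm' : (n <= m)%N by apply: leq_trans nm; rewrite leq_addr.
have w0 : 0 <= win by apply: sumr_ge0 => j _; exact: W0.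
have := h1 _ nm'; have := h2 _ nm'; rewrite e; set Y := \sum_(_ <= j < m) _ => k1 k2.
have p : 0 < 1 + a by lra.
rewrite mulrAC ler_pdivlMr //.
have : a * Y <= a * (x - win) by rewrite ler_wpM2l //; lra.
by lra.
Qed.

(** On [q0, Q] the constants are bounded by those at the end points, so at each good rate the tails
    shrink by the same ratio a / (1 + a) every L + 1 loops. This leaves room to raise the rate by a
    factor r that does not depend on q. *)
Let good_step C q0 Q : 0 <= C -> 1 < q0 -> q0 <= Q ->
  (forall q n m, 1 < q -> (n <= m)%N ->
    \sum_(n <= j < m) W q j <= C * (1 + (q - 1)^-1) * (B q n + B q m)) ->
  exists2 r, 1 < r & forall q s, q0 <= q -> q <= Q -> 1 <= s -> s <= r ->
    good q -> good (q * s).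
Proof.
move=> C_0 q01 q0Q hC.
pose ka := C * (1 + (q0 - 1)^-1); pose a := ka * c3 Q.
have Q1 : 1 <= Q by apply: le_trans q0Q; exact: ltW.
have i0 : 0 <= (q0 - 1)^-1 by rewrite invr_ge0; lra.
have ka0 : 0 <= ka by rewrite mulr_ge0 //; lra.
have a0 : 0 <= a by rewrite mulr_ge0 // c30.
have p : 0 < 1 + a by lra.
have th0 : 0 <= a / (1 + a) by rewrite divr_ge0 // ltW.
have th1 : a / (1 + a) < 1 by rewrite ltr_pdivrMr //; lra.
have [r r1 hr] := exists_expr_lt (K * L.+1) th0 th1.
exists r => // q s q0q qQ s1 sr gq; have q1 : 1 < q by exact: lt_le_trans q0q.
have q1' := ltW q1.
have kaq : C * (1 + (q - 1)^-1) <= ka.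
  rewrite ler_wpM2l // lerD2l lef_pV2 ?posrE; lra.
have T n : tail q n (ka * B q n).
  apply: tail_good => // m nm; apply: le_trans (hC q n m q1 nm) _.
  by rewrite ler_wpM2r // addr_ge0 // B0.
have c3q : c3 q <= c3 Q.
  rewrite /c3 !ler_wpM2l // lerXn2r ?nnegrE //; lra.
have T' n : tail q n (a * \sum_(n <= j < n + L.+1) W q j).
  move=> m nm; apply: le_trans (T n m nm) _; rewrite /a -mulrA ler_wpM2l //.
  apply: le_trans (B_window n q1') _; rewrite ler_wpM2r //.
  by apply: sumr_ge0 => j _; exact: W0.
pose X0 := ka * B q 0.
have X00 : 0 <= X0 by rewrite mulr_ge0 // B0.
have Ti i : tail q (i * L.+1) ((a / (1 + a)) ^+ i * X0).
  elim: i => [|i IH]; first by rewrite mul0n expr0 mul1r.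
  by rewrite mulSn addnC exprS -mulrA; apply: tail_step.
have Bi i n : (i * L.+1 <= n)%N -> B q n <= c3 Q * ((a / (1 + a)) ^+ i * X0).
  move=> ni; apply: le_trans (B_window n q1') _; apply: ler_pM => //.
  - exact: c30.
  - by apply: sumr_ge0 => j _; exact: W0.
  have nn : (n <= n + L.+1)%N by rewrite leq_addr.
  apply: le_trans (Ti i _ (leq_trans ni nn)).
  by rewrite (big_cat_nat ni nn) /= lerDr; apply: sumr_ge0 => j _; exact: W0.
move=> e e0; pose x := r ^+ (K * L.+1) * (a / (1 + a)).
have r0 : 0 <= r by lra.
have x0 : 0 <= x by rewrite mulr_ge0 ?exprn_ge0.
have Cx0 : 0 <= r ^+ (K * L.+1) * (c3 Q * X0).
  by rewrite mulr_ge0 ?exprn_ge0 // mulr_ge0 // c30.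
have [i0' hi] := geometric_small Cx0 x0 hr e0.
exists (i0' * L.+1)%N => m hm; pose i := (m %/ L.+1)%N.
have ii : (i0' <= i)%N by rewrite leq_divRL.
apply: le_lt_trans (hi _ ii).
(* Here m < (L+1)(i+1): raising the rate costs at most r^(K (L+1)) per block of L + 1 loops, the
   last one being incomplete. *)
have h1 : be (q * s) m <= be q m * r ^+ (K * L.+1 * i.+1).
  apply: le_trans (loop_weight_ratio m q1' s1 NK) _.
  rewrite ler_pM2l ?loop_weight_gt0 //; apply: (@le_trans _ _ (r ^+ (K * m))).
    by rewrite lerXn2r ?nnegrE //; lra.
  apply: ler_weXn2l; first exact: ltW.
  by rewrite -mulnA leq_mul2l [(L.+1 * _)%N]mulnC (ltnW (ltn_ceil _ _)) // orbT.
apply: le_trans (ler_wpM2r (norm2_ge0 _) h1) _.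
rewrite mulrAC -/(B q m).
have h2 : B q m <= c3 Q * ((a / (1 + a)) ^+ i * X0).
  by apply: Bi; rewrite leq_trunc_div.
apply: le_trans (ler_wpM2r (exprn_ge0 _ r0) h2) _.
have -> : x ^+ i = r ^+ (K * L.+1 * i) * (a / (1 + a)) ^+ i by rewrite exprMn -exprM.
rewrite mulnS exprD le_eqVlt; apply/orP; left; apply/eqP; ring.
Qed.

(** The assumed decay makes one q0 > 1 good, and finitely many applications of [good_step] reach any
    prescribed Q. *)
Let good_all : exists2 q0, 1 < q0 & forall q, q0 <= q -> good q.
Proof.
have [C C_0 hC] := weighted_activity_bound Mskew lo0 Plo orb.
have [q0 q01 hq0] := exists_expr_lt K rho0 rho1.
have q00 : 0 <= q0 by lra.
have gq0 : good q0.
  move=> e e0; have x0 : 0 <= q0 ^+ K * rho by rewrite mulr_ge0 ?exprn_ge0.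
  have [m0 hm0] := geometric_small C00 x0 hq0 e0.
  exists m0 => m /hm0; apply: le_lt_trans.
  apply: le_trans (ler_pM _ (norm2_ge0 _) (loop_weight_le m (ltW q01) NK) (decay m)) _.
    by rewrite ltW // loop_weight_gt0 // ltW.
  by rewrite exprMn exprM mulrCA.
exists q0 => // Q q0Q.
have [r r1 hr] := good_step C_0 q01 q0Q hC.
have r0 : 0 < r by lra.
have H i q : q0 <= q -> q <= Q -> q <= q0 * r ^+ i -> good q.
  elim: i q => [|i IH] q q0q qQ.
    by rewrite expr0 mulr1 => qq0; have -> : q = q0 by apply/le_anti/andP.
  rewrite exprS mulrCA => qr.
  (* One step back by the factor r, without falling below q0. *)
  pose q' := Num.max q0 (q / r).
  have q'q : q' <= q.
    by rewrite ge_max q0q ler_pdivrMr // ler_peMr //; lra.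
  have q'0 : q0 <= q' by rewrite le_max lexx.
  have q'p : 0 < q' by lra.
  have -> : q = q' * (q / q') by rewrite mulrCA divff ?mulr1 // gt_eqF.
  apply: hr => //.
  - exact: le_trans qQ.
  - by rewrite ler_pdivlMr // mul1r.
  - by rewrite ler_pdivrMr // -ler_pdivrMl // le_max mulrC lexx orbT.
  apply: IH => //; first exact: le_trans qQ.
  have h1 : q0 <= q0 * r ^+ i by rewrite ler_peMr // exprn_ege1 // ltW.
  by rewrite ge_max h1 ler_pdivrMr // mulrC.
have rv : 0 <= r^-1 by rewrite invr_ge0 ltW.
have rv1 : r^-1 < 1 by rewrite invf_lt1.
have Q0 : 0 <= Q by lra.
have [i hi] := geometric_small Q0 rv rv1 (ltr01 : 0 < 1 :> R).
apply: (H i) => //; have := hi i (leqnn i).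
rewrite exprVn ltr_pdivrMr ?exprn_gt0 // mul1r => h.
by apply: le_trans (ltW h) _; rewrite ler_peMl ?exprn_ge0 // ltW.
Qed.

(* From loop 0, the weighted estimate bounds the activity of loop j by a constant times
   q^(K - j), for all large q; let q tend to infinity. *)
Lemma observable_orbit_eventually0 n : (K < n)%N -> w n = 0.
Proof.
move=> Kn; apply: norm2_eq0; apply/le_anti; rewrite norm2_ge0 andbT.
suff H j : (K < j)%N -> loop_activity I N t g j = 0.
  apply: le_trans (observable n) _; rewrite big_nat_cond big1 ?mulr0 // => j.
  by move=> /andP[/andP[nj _] _]; apply: H; apply: leq_trans nj.
move=> Kj; have [C C_0 hC] := weighted_activity_bound Mskew lo0 Plo orb.
have [q0 q01 gq0] := good_all.
apply/le_anti; rewrite [X in _ && X]sumr_ge0 ?andbT; last first.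
  by move=> k _; apply: act0; rewrite -ltnS.
pose c := C * (1 + (q0 - 1)^-1) * norm2 (w 0).
have i0 : 0 <= (q0 - 1)^-1 by rewrite invr_ge0; lra.
have c0 : 0 <= c by rewrite !mulr_ge0 ?norm2_ge0 //; lra.
(* The tail bound gives activity times q^j at most K q^K c, with the same c for all q >= q0; as j >
   K, a factor q is left over. *)
have key q : q0 <= q -> loop_activity I N t g j * q <= K%:R * c.
  move=> q0q; have q1 : 1 < q by lra.
  have q1' := ltW q1; have qp : 0 < q by lra.
  have T : tail q 0 (c).
    have h : tail q 0 (C * (1 + (q - 1)^-1) * B q 0).
      apply: tail_good => //; last exact: gq0; last by move=> m; exact: hC.
      by rewrite mulr_ge0 // addr_ge0 // invr_ge0; lra.
    move=> m m0; apply: le_trans (h m m0) _; rewrite /B /= mul1r ler_wpM2r ?norm2_ge0 //.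
    by rewrite ler_wpM2l // lerD2l lef_pV2 ?posrE; lra.
  have Wj : W q j <= c.
    apply: le_trans (T j.+1 isT); rewrite big_nat_recr //= lerDr.
    by apply: sumr_ge0 => *; exact: W0.
  have h1 : loop_activity I N t g j * be q j <= K%:R * q ^+ K * W q j.
    rewrite /loop_activity /weighted_activity mulr_sumr mulr_suml; apply: ler_sum => k _.
    rewrite mulrC mulrA; apply: ler_wpM2r; first by apply: act0; rewrite -ltnS.
    by apply: step_weight_lower => //; rewrite -ltnS.
  have h2 : loop_activity I N t g j * q ^+ j <= K%:R * q ^+ K * c.
    apply: (@le_trans _ _ (loop_activity I N t g j * be q j)).
      apply: ler_wpM2l; last exact: loop_weight_exp.
      by apply: sumr_ge0 => k _; apply: act0; rewrite -ltnS.
    apply: le_trans h1 _; apply: ler_wpM2l => //.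
    by rewrite mulr_ge0 // exprn_ge0 // ltW.
  rewrite -(ler_pM2r (exprn_gt0 K qp)) -mulrA -exprS [leRHS]mulrAC.
  apply: le_trans h2; apply: ler_wpM2l; last exact: ler_weXn2l.
  by apply: sumr_ge0 => k _; apply: act0; rewrite -ltnS.
apply/ler_addgt0Pl => e e0; rewrite addr0.
pose q := Num.max q0 (K%:R * c / e).
have q0q : q0 <= q by rewrite le_max lexx.
have qp : 0 < q by lra.
rewrite -(ler_pM2r qp); apply: le_trans (key q q0q) _.
by rewrite -ler_pdivrMl // mulrC le_max lexx orbT.
Qed.

End ObservableOrbit.

(** * Rigidity of decaying orbits *)

Section KrylovProjection.
Variables (R : realType) (D : nat) (P M : 'M[R]_D) (I : {set 'I_D}).
Local Notation V := 'cV[R]_D.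
Hypotheses (Psym : P^T = P) (Mskew : M^T = - M).
Variable lo : R.
Hypotheses (lo0 : 0 < lo) (Plo : forall x : V, lo * dotv x x <= dotv x (P *m x)).

Definition coord_mask : 'M[R]_D := diag_mx (\row_i (i \in I)%:R).

Lemma coord_maskE (x : V) i : (coord_mask *m x) i 0 = (i \in I)%:R * x i 0.
Proof. by rewrite mul_diag_mx !mxE. Qed.

Lemma coord_mask_tr : coord_mask^T = coord_mask.
Proof. exact: tr_diag_mx. Qed.

Definition resolvent : 'M[R]_D := invmx (P + M) *m P.

(** The blocks of the observability matrix of the resolvent, observed through the coordinates in
    I. *)
Fixpoint krylov l : 'M[R]_D :=
  if l is j.+1 then krylov j *m resolvent else coord_mask.

Lemma unitmx_PM : P + M \in unitmx.
Proof.
rewrite -unitmx_tr -row_free_unit -kermx_eq0; apply/eqP/row_matrixP => i.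
rewrite row0; set x := row i _; have hx : x *m (P + M)^T = 0.
  by rewrite -row_mul mulmx_ker row0.
apply: (can_inj (@trmxK _ _ _)); rewrite trmx0; apply: (Pdef_eq0 lo0 Plo).
have := congr1 trmx hx; rewrite trmx_mul trmxK trmx0 mulmxDl.
move/(congr1 (dotv x^T)); rewrite dotvDr (dotv_skew _ Mskew) addr0 => ->.
by rewrite dotv0r.
Qed.

Lemma unitmx_resolvent : resolvent \in unitmx.
Proof. by rewrite unitmx_mul unitmx_inv unitmx_PM (Pdef_unit Psym lo0 Plo). Qed.

Let Pu := Pdef_unit Psym lo0 Plo.

Let invP_sym : (invmx P)^T = invmx P.
Proof. by rewrite trmx_inv Psym. Qed.

Let resolventK : resolvent *m (invmx P *m (P + M)) = 1%:M.
Proof. by rewrite /resolvent -mulmxA (mulKVmx Pu) mulVmx // unitmx_PM. Qed.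

Let invP_pos (y : V) : dotv y (invmx P *m y) <= 0 -> y = 0.
Proof.
move=> h; have h2 : invmx P *m y = 0.
  by apply: (Pdef_eq0 lo0 Plo); rewrite (mulKVmx Pu) dotvC.
by rewrite -[y](mulKVmx Pu) h2 mulmx0.
Qed.

(* P-orthogonal projection onto the orthogonal complement of the set of points x
   with [krylov l *m x = 0] for all l. *)
Lemma krylov_projection : exists Pi : 'M[R]_D, exists L, exists U : 'I_L -> 'M[R]_D,
  [/\ Pi^T *m P = P *m Pi, Pi^T *m M = M *m Pi, coord_mask *m Pi = coord_mask,
      Pi *m Pi = Pi &
      Pi = \sum_l U l *m krylov l.+1 /\ forall (x : V), Pi *m x = 0 -> forall l, krylov l *m x = 0].
Proof.
(* The span starts at [krylov 1]: activity controls the image of a Halpern point, so the mask of an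
   anchor is not observed in its own loop. *)
pose S L := (\sum_(l < L) <<krylov (l : nat).+1>>)%MS.
have Smono L : (S L <= S L.+1)%MS.
  apply/sumsmx_subP => l _; apply: (sumsmx_sup (widen_ord (leqnSn L) l)) => //; exact: submx_refl.
(* The ranks cannot increase strictly D + 1 times, so the span becomes stationary. *)
have [L rL] : exists L, (\rank (S L.+1) <= \rank (S L))%N.
  apply: contrapT => /forallNP h.
  have : (D.+1 <= \rank (S D.+1))%N.
    elim: (D.+1) => // j IH; apply: leq_ltn_trans IH _; rewrite ltnNge; exact/negP/h.
  by rewrite leqNgt ltnS rank_leq_row.
have SL : (S L.+1 <= S L)%MS by rewrite -(geq_leqif (mxrank_leqif_sup (Smono L))).
have SR : (S L *m resolvent <= S L)%MS.
  apply: submx_trans SL; rewrite /S sumsmxMr; apply/sumsmx_subP => l _.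
  apply: submx_trans (submxMr _ _) _; first by rewrite genmxE.
  apply: (sumsmx_sup (lift ord0 l)) => //; rewrite genmxE.
  by rewrite /= /bump /=.
have [r [B [BS Bfree]]] : exists r, exists B : 'M[R]_(r, D), (B :=: S L)%MS /\ row_free B.
  by exists (\rank (S L)), (row_base (S L)); split; [exact: eq_row_base | exact: row_base_free].
have SSR : (S L <= S L *m resolvent)%MS.
  rewrite -(geq_leqif (mxrank_leqif_sup SR)) mxrankMfree //.
  by rewrite row_free_unit unitmx_resolvent.
have BR : (B <= B *m resolvent)%MS.
  by rewrite (eqmxMr _ BS) BS.
(* [krylov 0] is not a summand, but the span is stable under the inverse of the resolvent. *)
have EB : (coord_mask <= B)%MS.
  rewrite BS -(submxMfree _ _ (C := resolvent)); last by rewrite row_free_unit unitmx_resolvent.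
  apply: submx_trans SSR; apply: submx_trans SL.
  apply: (sumsmx_sup ord0) => //; by rewrite genmxE.
have [X BX] := submxP BR.
pose K2 := X - 1%:M.
(* The inverse of the resolvent is 1 + P^-1 M, so the row space of B is stable under P^-1 M. *)
have BK2 : B *m invmx P *m M = K2 *m B.
  have : B *m (invmx P *m (P + M)) = X *m B.
    by rewrite {1}BX -[X *m _ *m _]mulmxA -[B *m _ *m _]mulmxA resolventK mulmx1.
  rewrite mulmxDr (mulVmx Pu) mulmxDr mulmx1 mulmxBl mul1mx => <-.
  by rewrite addrC addKr mulmxA.
have [Nm NmE] : exists Nm, Nm = B *m invmx P *m B^T by eexists.
have Nsym : Nm^T = Nm by rewrite NmE !trmx_mul trmxK invP_sym mulmxA.
have Nu : Nm \in unitmx.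
  rewrite -row_free_unit -kermx_eq0; apply/eqP/row_matrixP => i.
  rewrite row0; set x := row i _; have hx : x *m Nm = 0 by rewrite -row_mul mulmx_ker row0.
  have : B^T *m x^T = 0.
    apply: invP_pos; rewrite -dotv_mulr.
    rewrite (_ : _ *m (_ *m _) = Nm *m x^T) ?NmE ?mulmxA //.
    rewrite -NmE.
    by rewrite -{1}Nsym -trmx_mul hx trmx0 dotv0r.
  move/(congr1 trmx); rewrite trmx_mul !trmxK trmx0 => xB.
  by apply: (row_free_inj Bfree); rewrite xB mul0mx.
(* Skewness of M makes [K2 *m Nm] skew, [Nm] being the Gram matrix of B in the metric P^-1; hence
   [Pi^T *m M = M *m Pi] below. *)
have K2N : K2^T *m invmx Nm = - (invmx Nm *m K2).
  have h : K2 *m Nm = B *m invmx P *m M *m invmx P *m B^T by rewrite BK2 NmE !mulmxA.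
  have h2 : (K2 *m Nm)^T = - (K2 *m Nm).
    by rewrite h !trmx_mul !trmxK Mskew invP_sym !mulNmx !mulmxN !mulmxA.
  apply: (can_inj (mulmxK Nu)); rewrite mulmxKV // mulNmx.
  apply: (can_inj (mulKmx Nu)); rewrite mulmxN !mulmxA mulmxV // mul1mx.
  by rewrite -h2 trmx_mul Nsym.
(* Projection onto the range of P^-1 B^T, whose P-orthogonal complement is the kernel of B. *)
pose Pi := invmx P *m B^T *m invmx Nm *m B.
have iNsym : (invmx Nm)^T = invmx Nm by rewrite trmx_inv Nsym.
have BPi : B *m Pi = B by rewrite /Pi !mulmxA -NmE (mulmxV Nu) mul1mx.
have PiT : Pi^T = B^T *m invmx Nm *m B *m invmx P.
  by rewrite /Pi !trmx_mul trmxK iNsym invP_sym !mulmxA.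
have PiS : (Pi <= \sum_(l < L) <<krylov (l : nat).+1>>)%MS.
  by apply: submx_trans (submxMl _ _) _; rewrite BS.
have [u Piu] := sub_sumsmxP PiS.
have gen l : exists Y, (<<krylov (l : nat).+1>>)%MS = Y *m krylov l.+1.
  by apply/submxP; rewrite genmxE.
have [Y hY] := choice gen.
exists Pi, L, (fun l => u l *m Y l); split.
- by rewrite PiT mulmxKV // /Pi !mulmxA mulmxV // mul1mx.
- rewrite PiT -!mulmxA [B *m _]mulmxA BK2 /Pi !mulmxA.
  have -> : M *m invmx P *m B^T = - (K2 *m B)^T.
    by rewrite -BK2 !trmx_mul Mskew invP_sym mulNmx opprK mulmxA.
  by rewrite trmx_mul mulNmx mulNmx -!mulmxA [K2^T *m _]mulmxA K2N !mulNmx mulmxN opprK !mulmxA.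
- by have [Z ->] := submxP EB; rewrite -mulmxA BPi.
- by rewrite {1}/Pi -[_ *m B *m Pi]mulmxA BPi.
split.
  by rewrite {1}Piu; apply: eq_bigr => l _; rewrite hY mulmxA.
move=> x Px l; have Bx : B *m x = 0 by rewrite -BPi -mulmxA Px mulmx0.
have /submxP[Z ->] : (krylov l <= B)%MS; last by rewrite -mulmxA Bx mulmx0.
elim: l => // l IH /=; apply: submx_trans (submxMr _ IH) _.
by rewrite (eqmxMr _ BS) BS.
Qed.

End KrylovProjection.

(** * Observation of orbits by their activity, and rigidity *)

Section OrbitRigidity.
Variables (R : realType) (D : nat) (P M : 'M[R]_D) (I : {set 'I_D}).
Local Notation V := 'cV[R]_D.
Hypotheses (Psym : P^T = P) (Mskew : M^T = - M).
Variable lo : R.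
Hypotheses (lo0 : 0 < lo) (Plo : forall x : V, lo * dotv x x <= dotv x (P *m x)).
Variable N : nat -> nat.

Local Notation kry := (krylov P M I).

Section FixedOrbit.
Variables (w : nat -> V) (t g : nat -> nat -> V).
Hypothesis orb : restarted_orbit P M I N w t g.

Local Notation lact := (loop_activity I N t g).

Let lact0 j : 0 <= lact j.
Proof. by apply: sumr_ge0 => k _; apply: (activity_ge0 orb); rewrite -ltnS. Qed.

Let act_le n k : (k <= N n)%N -> activity I t g n k <= lact n.
Proof.
move=> kN; rewrite /loop_activity (bigD1 (Ordinal (kN : (k < (N n).+1)%N))) //= lerDl.
by apply: sumr_ge0 => j _; apply: (activity_ge0 orb); rewrite -ltnS.
Qed.

Let step_act n k : (k <= N n)%N ->
  norm2 (coord_mask R I *m t n k) <= lact n /\ norm2 (g n k) <= lact n.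
Proof.
move=> kN; have [/(_ k kN)[_ sgn off] _] := orb n.
have bound (x : V) : (forall i, i \in I -> `|x i 0| <= t n k i 0 - g n k i 0) ->
    (forall i, i \notin I -> x i 0 = 0) -> norm2 x <= lact n.
  move=> h1 h2; apply: le_trans (act_le kN).
  have -> : x = \sum_i x i 0 *: delta_mx i 0.
    by rewrite {1}(matrix_sum_delta x); apply: eq_bigr => i _; rewrite big_ord1.
  apply: le_trans (norm2_sum _ _) _; rewrite /activity [leRHS]big_mkcond /=.
  apply: ler_sum => i _; rewrite norm2Z.
  have -> : norm2 (delta_mx i 0 : V) = 1.
    rewrite norm2E (bigD1 i) //= mxE !eqxx big1 ?addr0 ?expr1n ?sqrtr1 // => j ij.
    by rewrite mxE (negbTE ij) expr0n.
  by rewrite mulr1; case: ifPn => [/h1|/h2 ->] //; rewrite normr0.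
split; apply: bound => i iI.
- by rewrite coord_maskE iI mul1r; have [h1 h2 _] := sgn i iI; rewrite ger0_norm //; lra.
- by rewrite coord_maskE (negbTE iI) mul0r.
- by have [h1 h2 _] := sgn i iI; rewrite ler0_norm //; lra.
exact: off.
Qed.

Let step_resolvent n k : (k <= N n)%N ->
  resolvent P M *m halpern_pt (w n) (t n) k = t n k + invmx (P + M) *m g n k.
Proof.
move=> kN; have [/(_ k kN)[e _ _] _] := orb n; have PMu := unitmx_PM Mskew lo0 Plo.
apply: (can_inj (mulKmx PMu)).
rewrite /resolvent !mulmxA mulmxV // mul1mx mulmxDr !mulmxA mulmxV // mul1mx mulmxDl.
by rewrite -addrA -e -mulmxDr addrC subrK.
Qed.

Let window_le n a b : (a <= b)%N -> \sum_(n <= j < n + a) lact j <= \sum_(n <= j < n + b) lact j.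
Proof.
move=> ab; have nab : (n + a <= n + b)%N by rewrite leq_add2l.
rewrite (big_cat_nat (leq_addr a n) nab) /= lerDl.
by apply: sumr_ge0 => *; exact: lact0.
Qed.

Let window0 n a : 0 <= \sum_(n <= j < n + a) lact j.
Proof. by apply: sumr_ge0 => *; exact: lact0. Qed.

Let lact_window n a : lact n <= \sum_(n <= j < n + a.+1) lact j.
Proof. by rewrite addnS big_ltn ?ltnS ?leq_addr // lerDl; apply: sumr_ge0 => *; exact: lact0. Qed.

(** By [step_resolvent], one resolvent applied to a Halpern point gives [t n k] up to a multiple of
    [g n k]. In turn [t n k] is a combination of two Halpern points of the same loop or, at the end
    of the loop, the next anchor; so each level lengthens the window by one loop. *)
Lemma krylov_observed l : exists2 C : R, 0 <= C & forall n k, (k <= N n)%N ->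
  norm2 (kry l.+1 *m halpern_pt (w n) (t n) k) <= C * \sum_(n <= j < n + l.+1) lact j.
Proof.
elim: l => [|l [C C0 hC]].
  have [C C0 hC] := norm2_mulmx_bound (coord_mask R I *m invmx (P + M)).
  exists (1 + C) => [|n k kN]; first by rewrite addr_ge0.
  rewrite /= -mulmxA step_resolvent // mulmxDr mulmxA.
  apply: le_trans (norm2_triangle _ _) _; have [h1 h2] := step_act kN.
  have h3 := lact_window n 0; rewrite mulrDl mul1r; apply: lerD; first exact: le_trans h3.
  apply: le_trans (hC _) _; apply: ler_wpM2l => //; exact: le_trans h3.
have [C' C'0 hC'] := norm2_mulmx_bound (kry l.+1 *m invmx (P + M)).
exists (3 * C + C') => [|n k kN]; first by rewrite addr_ge0 // mulr_ge0.
rewrite [kry l.+2]/(kry l.+1 *m resolvent P M) -mulmxA step_resolvent // mulmxDr mulmxA.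
apply: le_trans (norm2_triangle _ _) _; have [_ h2] := step_act kN.
rewrite mulrDl; apply: lerD; last first.
  apply: le_trans (hC' _) _; apply: ler_wpM2l => //; apply: le_trans h2 _.
  exact: lact_window.
move: kN; rewrite leq_eqVlt => /orP[/eqP ->|kN].
  have [_ <-] := orb n; rewrite -(halpern_pt0 (w n.+1) (t n.+1)).
  apply: le_trans (hC _ _ (leq0n _)) _.
  have h4 : \sum_(n.+1 <= j < n.+1 + l.+1) lact j <= \sum_(n <= j < n + l.+2) lact j.
    by rewrite addSnnS [leRHS]big_ltn ?lerDr // addnS ltnS leq_addr.
  apply: le_trans (ler_wpM2l C0 h4) _; apply: ler_wpM2r; first exact: window0.
  lra.
(* The Halpern formula solved for the image; the two coefficients are at most 2 and 1, whence the
   constant 3 C. *)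
have e : t n k = (k.+1%:R^-1 * k.+2%:R) *: halpern_pt (w n) (t n) k.+1
    - k.+1%:R^-1 *: halpern_pt (w n) (t n) 0.
  rewrite halpern_pt0 -scalerA halpern_ptE scalerDr scalerA mulVf ?pnatr_eq0 //.
  by rewrite scale1r addrK.
have h5 := hC n k.+1 kN; have h6 := hC n 0%N (leq0n _).
move: e h5 h6; move: (halpern_pt _ _ k.+1) (halpern_pt _ _ 0%N) => x y -> h5 h6.
rewrite mulmxBr -!scalemxAr; apply: le_trans (norm2_triangle _ _) _.
rewrite norm2N !norm2Z !ger0_norm ?mulr_ge0 ?invr_ge0 //.
have k1 : k.+1%:R^-1 <= 1 :> R by rewrite invf_le1 ?ltr0n // ler1n.
have k2 : k.+1%:R^-1 * k.+2%:R <= 2 :> R.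
  by rewrite ler_pdivrMl ?ltr0n // -natrM ler_nat muln2 -addnn addSn addnS !ltnS leq_addr.
have h7 : C * \sum_(n <= j < n + l.+1) lact j <= C * \sum_(n <= j < n + l.+2) lact j.
  by rewrite ler_wpM2l // window_le.
set X := \sum_(n <= j < n + l.+2) _ in h7 *.
have -> : 3 * C * X = 2 * (C * X) + 1 * (C * X) by ring.
apply: lerD; apply: ler_pM => //; rewrite ?norm2_ge0 ?mulr_ge0 ?invr_ge0 //.
  exact: le_trans h5 h7.
exact: le_trans h6 h7.
Qed.

Lemma orbit_observable L (U : 'I_L -> 'M[R]_D) :
  (forall n, w n = \sum_l U l *m (kry l.+1 *m w n)) ->
  exists2 C : R, 0 <= C & forall n, norm2 (w n) <= C * \sum_(n <= j < n + L.+1) lact j.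
Proof.
move=> hU; have /choice[c hc] (l : 'I_L) : exists C : R, 0 <= C /\ forall n,
    norm2 (U l *m (kry l.+1 *m w n)) <= C * \sum_(n <= j < n + L.+1) lact j.
  have [C C0 hC] := krylov_observed l; have [C' C'0 hC'] := norm2_mulmx_bound (U l).
  exists (C' * C); split => [|n]; first by rewrite mulr_ge0.
  apply: le_trans (hC' _) _; rewrite -mulrA; apply: ler_wpM2l => //.
  have := hC n 0%N (leq0n _); rewrite halpern_pt0 => h; apply: le_trans h _.
  by apply: ler_wpM2l => //; apply: window_le; rewrite ltnS ltnW.
exists (\sum_l c l) => [|n]; first by apply: sumr_ge0 => l _; have [] := hc l.
rewrite {1}hU; apply: le_trans (norm2_sum _ _) _; rewrite mulr_suml.
by apply: ler_sum => l _; have [_] := hc l.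
Qed.

(** Backward induction on loops. If the loop anchored at [w n.+1] lands at 0, its first image is 0
    and P w = g. On I one has g <= 0, while w >= 0 because w is an image of the previous loop; hence
    <w, P w> <= 0 and w = 0. *)
Lemma orbit_landing m : (forall n, (m <= n)%N -> w n = 0) ->
  forall n k, (k <= N n)%N -> t n k = 0.
Proof.
move=> wm; have back n : w n.+1 = 0 -> forall k, (k <= N n)%N -> t n k = 0.
  move=> wn; have [lp e] := orb n.
  by apply: (skew_loop_landing Psym Mskew lo0 Plo lp); rewrite -e.
suff H j n : (m <= n + j)%N -> w n.+1 = 0 by move=> n; apply: back; apply: (H m); exact: leq_addl.
elim: j n => [|j IH] n mn; first by apply: wm; rewrite addn0 in mn; exact: leqW.
have wn2 : w n.+2 = 0 by apply: IH; rewrite addSnnS.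
have [/(_ 0%N (leq0n _))[e sgn off] _] := orb n.+1.
have t0 := back _ wn2 _ (leq0n _); apply: (Pdef_eq0 lo0 Plo).
move: e; rewrite halpern_pt0 t0 subr0 mulmx0 add0r => ->.
apply: dotv_le0 => i; have [iI|/off ->] := boolP (i \in I); last by rewrite mulr0.
have [g0 _ _] := sgn i iI; rewrite mulr_ge0_le0 //.
have [/(_ (N n) (leqnn _))[_ sgn' _] ->] := orb n.
by have [] := sgn' i iI.
Qed.

End FixedOrbit.

Variables (w : nat -> V) (t g : nat -> nat -> V).
Hypothesis orb : restarted_orbit P M I N w t g.

Let proj_halpern (Pi : 'M[R]_D) n k :
  halpern_pt (Pi *m w n) (fun k => Pi *m t n k) k = Pi *m halpern_pt (w n) (t n) k.
Proof. by rewrite /halpern_pt -scalemxAr mulmxDr -scalemxAr. Qed.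

(** Pi is compatible with P and M and keeps the coordinates in I, so the projected points form an
    orbit with the same g. That orbit is observable, hence eventually 0, hence its images are always
    0, and the kernel of Pi is invisible to every [krylov l]. *)
Theorem orbit_rigidity (K : nat) (C0 rho : R) :
  (forall n, ((N n).+1 <= K)%N) -> 0 <= C0 -> 0 <= rho -> rho < 1 ->
  (forall n, norm2 (w n) <= C0 * rho ^+ n) ->
  forall n k, (k <= N n)%N -> forall l, kry l *m t n k = 0.
Proof.
move=> NK C00 rho0 rho1 decay.
have [Pi [L [U [PiP PiM EPi PiPi [PiU Pi0]]]]] := krylov_projection I Psym Mskew lo0 Plo.
have Picoord (x : V) i : i \in I -> (Pi *m x) i 0 = x i 0.
  move=> iI; have := congr1 (fun X => (X *m x) i 0) EPi.
  by rewrite -mulmxA !coord_maskE iI !mul1r.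
have gE n k : (k <= N n)%N -> g n k = coord_mask R I *m g n k.
  move=> kN; have [/(_ k kN)[_ _ off] _] := orb n.
  apply/matrixP => i j; rewrite (ord1 j) coord_maskE.
  by have [_|/off ->] := boolP (i \in I); rewrite ?mul1r ?mulr0.
have PiE : Pi^T *m coord_mask R I = coord_mask R I.
  by rewrite -{1}coord_mask_tr -trmx_mul EPi coord_mask_tr.
pose w' n := Pi *m w n; pose t' n k := Pi *m t n k.
have orb' : restarted_orbit P M I N w' t' g.
  move=> n; split; last by rewrite /w' /t'; have [_ ->] := orb n.
  move=> k kN; have [/(_ k kN)[e sgn off] _] := orb n; split=> // [|i iI].
    rewrite proj_halpern /t' -mulmxBr [P *m _]mulmxA -PiP -[Pi^T *m _ *m _]mulmxA e mulmxDr !mulmxA PiM.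
    by congr (_ + _); rewrite (gE n k kN) mulmxA PiE.
  by rewrite /t' Picoord //; exact: sgn.
have [C2 C20 obs] : exists2 C : R, 0 <= C &
    forall n, norm2 (w' n) <= C * \sum_(n <= j < n + L.+1) loop_activity I N t' g j.
  apply: (orbit_observable orb' (U := U)) => n.
  rewrite {1}/w' -PiPi -mulmxA -/(w' n) {1}PiU mulmx_suml.
  by apply: eq_bigr => l _; rewrite mulmxA.
have [CP CP0 hCP] := norm2_mulmx_bound Pi.
have CC : 0 <= CP * C0 by rewrite mulr_ge0.
have dec n : norm2 (w' n) <= CP * C0 * rho ^+ n.
  by apply: le_trans (hCP _) _; rewrite -mulrA; apply: ler_wpM2l.
have z n : (K.+1 <= n)%N -> w' n = 0.
  exact: (observable_orbit_eventually0 Mskew lo0 Plo orb' NK C20 obs CC rho0 rho1 dec).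
by move=> n k kN; apply: Pi0; exact: (orbit_landing orb' z).
Qed.

End OrbitRigidity.

(** * Halpern iteration and the PDHG operator *)

Section HalpernRate.
Variables (R : realType) (n : nat) (G : 'M[R]_n).
Local Notation V := 'cV[R]_n.
Hypotheses (Gsym : G^T = G) (Gpsd : forall x : V, 0 <= dotv x (G *m x)).
Variables (T : V -> V).
Hypothesis nonexp : forall x y, gnorm G (T x - T y) <= gnorm G (x - y).

Let b (x y : V) := dotv x (G *m y).
Let bDl x y z : b (x + y) z = b x z + b y z. Proof. exact: dotvDl. Qed.
Let bDr x y z : b z (x + y) = b z x + b z y. Proof. by rewrite /b mulmxDr dotvDr. Qed.
Let bNl x y : b (- x) y = - b x y. Proof. exact: dotvNl. Qed.
Let bNr x y : b x (- y) = - b x y. Proof. by rewrite /b mulmxN dotvNr. Qed.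
Let bZl a x y : b (a *: x) y = a * b x y. Proof. exact: dotvZl. Qed.
Let bZr a x y : b x (a *: y) = a * b x y. Proof. by rewrite /b -scalemxAr dotvZr. Qed.
Let bC x y : b x y = b y x. Proof. exact: dotv_sym. Qed.
Let bE := (bDl, bDr, bNl, bNr, bZl, bZr).

Lemma half_cocoercive x y (r := x - T x) (s := y - T y) :
  b (r - s) (r - s) <= 2 * b (r - s) (x - y).
Proof.
have : gnorm G (T x - T y) ^+ 2 <= gnorm G (x - y) ^+ 2.
  by rewrite lerXn2r ?nnegrE ?gnorm_ge0.
rewrite !gnorm_sq // -/(b _ _) -/(b _ _).
have -> : T x - T y = (x - y) - (r - s).
  by rewrite /r /s; apply/matrixP => i j; rewrite !mxE; ring.
by move: (x - y) (r - s) => u v; rewrite !bE (bC u v); lra.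
Qed.

Variables (z : nat -> V) (N : nat).
Hypothesis zS : forall k, (k < N)%N ->
  z k.+1 = (k.+1%:R / k.+2%:R) *: T (z k) + k.+2%:R^-1 *: z 0%N.

(** The Lyapunov function of Halpern iteration. Multiplied by k + 1 it does not increase, by
    half-cocoercivity between consecutive iterates. *)
Let potential k : (k <= N)%N -> let r := z k - T (z k) in
  k%:R * b r r <= 2 * b r (z 0%N - z k).
Proof.
move=> kN /=; suff : k.+1%:R * (k%:R * b (z k - T (z k)) (z k - T (z k)))
    <= k.+1%:R * (2 * b (z k - T (z k)) (z 0%N - z k)).
  by rewrite ler_pM2l ?ltr0n.
elim: k kN => [|k IH] kN; first by rewrite subrr mul0r mulr0 /b mulmx0 dotv0r !mulr0.
have := IH (ltnW kN); have /= := half_cocoercive (z k.+1) (z k).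
set r' := z k.+1 - T (z k.+1); set r := z k - T (z k).
set e := z 0%N - z k; set e' := z 0%N - z k.+1.
have ee : k.+2%:R *: e' = k.+1%:R *: (e + r).
  rewrite /e' /e /r zS // scalerBr scalerDr !scalerA mulfV ?pnatr_eq0 // scale1r.
  rewrite mulrCA mulfV ?pnatr_eq0 // mulr1 -(natr1 k.+1).
  by apply/matrixP => i j; rewrite !mxE; ring.
have -> : z k.+1 - z k = e - e'.
  by rewrite /e /e'; apply/matrixP => i j; rewrite !mxE; ring.
have E1 := congr1 (b r') ee; have E2 := congr1 (b r) ee.
move: E1 E2; clearbody r r' e e'; rewrite !bE (bC r r') -!(natr1 k.+1).
have : 0 < k.+1%:R :> R by rewrite ltr0n.
have -> : k%:R = k.+1%:R - 1 :> R by rewrite -natr1 addrK.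
move: (k.+1%:R) => K K0 E1 E2 h1 h2.
have K1 : 0 < K * (K + 1) by nra.
have h3 := ler_wpM2l (ltW K1) h1.
have E3 := congr1 (fun x => (K + 1) * x) E1; have E4 := congr1 (fun x => K * x) E2.
move: E1 E2 E3 E4 h2 h3 => /=.
move: (b r' e') (b r' e) (b r' r) (b r e') (b r e) (b r r) (b r' r').
move=> a' u v w s m m' *; lra.
Qed.

(** Adding half-cocoercivity at p to the potential replaces z_0 - z_k by z_0 - p and k by k + 1;
    Cauchy-Schwarz then cancels one factor |r|. *)
Lemma halpern_residual_rate p k : T p = p -> (k <= N)%N ->
  k.+1%:R * gnorm G (z k - T (z k)) <= 2 * gnorm G (z 0%N - p).
Proof.
move=> Tp kN; have /= := potential kN; have /= := half_cocoercive (z k) p.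
rewrite Tp subrr subr0; set r := z k - _ => h1 h2.
have h3 : k.+1%:R * gnorm G r ^+ 2 <= gnorm G r * (2 * gnorm G (z 0%N - p)).
  have h4 : b r (z 0%N - p) <= gnorm G r * gnorm G (z 0%N - p) by exact: gdot_CS.
  have h5 : b r (z 0%N - p) = b r (z 0%N - z k) + b r (z k - p).
    by rewrite -bDr addrA subrK.
  rewrite gnorm_sq // -/(b r r) -natr1; lra.
have [r0|r0] := eqVneq (gnorm G r) 0; first by rewrite r0 mulr0 mulr_ge0 ?gnorm_ge0.
have rp : 0 < gnorm G r by rewrite lt_def r0 gnorm_ge0.
by rewrite -(ler_pM2l rp) mulrCA -expr2.
Qed.

Lemma halpern_dist p k : T p = p -> (k <= N)%N ->
  gnorm G (z k - p) <= gnorm G (z 0%N - p).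
Proof.
move=> Tp; elim: k => // k IH kN; rewrite zS //.
have -> : (k.+1%:R / k.+2%:R) *: T (z k) + k.+2%:R^-1 *: z 0%N - p
    = (k.+1%:R / k.+2%:R) *: (T (z k) - p) + k.+2%:R^-1 *: (z 0%N - p).
  have e : k.+1%:R / k.+2%:R = 1 - k.+2%:R^-1 :> R.
    by rewrite -[k.+1%:R](addrK 1) natr1 mulrBl mulfV ?pnatr_eq0 // mul1r.
  by rewrite e; apply/matrixP => i j; rewrite !mxE; ring.
apply: le_trans (gnorm_triangle Gsym Gpsd _ _) _; rewrite !gnormZ !ger0_norm ?divr_ge0 //.
have h : gnorm G (T (z k) - p) <= gnorm G (z 0%N - p).
  by rewrite -{1}Tp; apply: le_trans (nonexp _ _) (IH (ltnW kN)).
rewrite [leRHS](_ : _ = k.+1%:R / k.+2%:R * gnorm G (z 0%N - p)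
    + k.+2%:R^-1 * gnorm G (z 0%N - p)); last first.
  have e : k.+1%:R / k.+2%:R + k.+2%:R^-1 = 1 :> R.
    by rewrite -[X in _ + X]mul1r -mulrDl natr1 mulfV ?pnatr_eq0.
  by rewrite -mulrDl e mul1r.
by rewrite lerD2r ler_wpM2l // divr_ge0.
Qed.

End HalpernRate.

(** * PDHG as a proximal step in the metric P_eta *)

Section PDHG.
Variables (R : realType) (m d : nat).
Variables (A : 'M[R]_(m, d)) (eta L : R).
Hypotheses (eta0 : 0 < eta) (AL : forall u, norm2 (A *m u) <= L * norm2 u).
Hypotheses (L0 : 0 <= L) (etaL : eta * L <= 2^-1).
Local Notation P := (Peta A eta).

Lemma Peta_sym : P^T = P.
Proof. by rewrite /Peta tr_block_mx !tr_scalar_mx !linearN /= trmxK. Qed.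

Lemma Peta_mul (u : 'cV[R]_d) (v : 'cV[R]_m) :
  P *m col_mx u v = col_mx (eta^-1 *: u - A^T *m v) (eta^-1 *: v - A *m u).
Proof. by rewrite /Peta mul_block_col !mul_scalar_mx !mulNmx [X in col_mx _ X]addrC. Qed.

Lemma Peta_quad (u : 'cV[R]_d) (v : 'cV[R]_m) : dotv (col_mx u v) (P *m col_mx u v)
  = eta^-1 * (dotv u u + dotv v v) - 2 * dotv v (A *m u).
Proof.
rewrite Peta_mul dotv_col !dotv_lin dotv_mulr trmxK [dotv (A *m u) v]dotvC; ring.
Qed.

(** The step-size condition keeps the off-diagonal part below half of the diagonal one, so P_eta
    lies between 1 / (2 eta) and 3 / (2 eta). *)
Let cross (u : 'cV[R]_d) (v : 'cV[R]_m) : `|2 * dotv v (A *m u)| <= (2 * eta)^-1 * (dotv u u + dotv v v).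
Proof.
rewrite normrM ger0_norm //; have h1 := dotv_CS_abs v (A *m u).
have h2 := ler_wpM2l (norm2_ge0 v) (AL u).
rewrite -!norm2_sq; have e1 : L <= (2 * eta)^-1.
  rewrite -[leRHS]mul1r ler_pdivlMr ?mulr_gt0 //; have := etaL; lra.
have h3 := ler_wpM2r (addr_ge0 (sqr_ge0 (norm2 u)) (sqr_ge0 (norm2 v))) e1.
apply: le_trans h3; have := ler_wpM2l L0 (sqr_ge0 (norm2 u - norm2 v)).
rewrite mulr0 sqrrB; lra.
Qed.

Lemma Peta_lo (z : 'cV[R]_(d + m)) : (2 * eta)^-1 * dotv z z <= dotv z (P *m z).
Proof.
rewrite -(vsubmxK z) Peta_quad dotv_col; move: (usubmx z) (dsubmx z) => u v.
have := cross u v; rewrite ler_norml => /andP[_].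
have -> : (2 * eta)^-1 = eta^-1 / 2 by rewrite invfM mulrC.
lra.
Qed.

Lemma Peta_hi (z : 'cV[R]_(d + m)) : dotv z (P *m z) <= 3 / (2 * eta) * dotv z z.
Proof.
rewrite -(vsubmxK z) Peta_quad dotv_col; move: (usubmx z) (dsubmx z) => u v.
have := cross u v; rewrite ler_norml => /andP[+ _].
have -> : (2 * eta)^-1 = eta^-1 / 2 by rewrite invfM mulrC.
lra.
Qed.

Lemma Peta_psd (z : 'cV[R]_(d + m)) : 0 <= dotv z (P *m z).
Proof. by apply: le_trans (Peta_lo z); rewrite mulr_ge0 ?dotv_ge0 // invr_ge0 mulr_ge0 // ltW. Qed.

Lemma normP_sq (z : 'cV[R]_(d + m)) : normP A eta z ^+ 2 = dotv z (P *m z).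
Proof. exact: gnorm_sq Peta_psd _. Qed.

Lemma normP_ge0 (z : 'cV[R]_(d + m)) : 0 <= normP A eta z.
Proof. exact: sqrtr_ge0. Qed.

Lemma norm2_le_normP (z : 'cV[R]_(d + m)) : norm2 z <= Num.sqrt (2 * eta) * normP A eta z.
Proof.
have e2 : 0 < 2 * eta by rewrite mulr_gt0.
have e2' := ltW e2; rewrite /norm2 /normP -sqrtrM // ler_wsqrtr // -ler_pdivrMl //; exact: Peta_lo.
Qed.

Lemma normP_le_norm2 (z : 'cV[R]_(d + m)) : normP A eta z <= Num.sqrt (3 / (2 * eta)) * norm2 z.
Proof.
rewrite /norm2 /normP -sqrtrM; first by rewrite ler_wsqrtr // Peta_hi.
by rewrite divr_ge0 // mulr_ge0 // ltW.
Qed.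

(** Cauchy-Schwarz in the metric P for the pair P z, z, with the upper bound of P applied at P z. *)
Lemma norm2_Peta (z : 'cV[R]_(d + m)) : norm2 (P *m z) <= Num.sqrt (3 / (2 * eta)) * normP A eta z.
Proof.
have h := gdot_CS_sq Peta_sym Peta_psd (P *m z) z.
have h2 := Peta_hi (P *m z).
set a := dotv (P *m z) (P *m z) in h h2; have a0 : 0 <= a by exact: dotv_ge0.
rewrite /norm2 /normP -/a -sqrtrM; last by rewrite divr_ge0 // mulr_ge0 // ltW.
rewrite ler_wsqrtr //.
have c0 := Peta_psd z; set q := dotv z _ in h c0 *.
have [->|an] := eqVneq a 0.
  by rewrite mulr_ge0 // divr_ge0 // mulr_ge0 // ltW.
have ap : 0 < a by rewrite lt_def an.
rewrite -(ler_pM2l ap) -expr2; apply: le_trans h _.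
by rewrite mulrA [a * _]mulrC; apply: ler_wpM2r.
Qed.

Variables (b : 'cV[R]_m) (c : 'cV[R]_d).
Local Notation T := (pdhg A b c eta).
Implicit Types z : 'cV[R]_(d + m).

Lemma pdhg_primal_ge0 z i : 0 <= usubmx (T z) i 0.
Proof. by rewrite /pdhg col_mxKu mxE le_max lexx. Qed.

Lemma pdhg_primal z i : usubmx (T z) i 0
  = Num.max 0 (usubmx z i 0 - eta * (c + A^T *m dsubmx z) i 0).
Proof. by rewrite /pdhg col_mxKu !mxE; congr Num.max; ring. Qed.

(** T is the resolvent, in the metric P_eta, of the saddle operator plus the normal cone of x >= 0;
    g is the normal vector, the negative part of the projected point divided by eta. *)
Lemma pdhg_inclusion z : exists g : 'cV[R]_d,
  P *m (z - T z) = col_mx (c + A^T *m dsubmx (T z) + g) (b - A *m usubmx (T z))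
  /\ forall i, [/\ g i 0 <= 0, g i 0 * usubmx (T z) i 0 = 0 &
      0 < usubmx (T z) i 0 -> g i 0 = 0].
Proof.
set x := usubmx z; set y := dsubmx z.
have [a aE] : exists a, a = x - eta *: (A^T *m y) - eta *: c by eexists.
have xT : usubmx (T z) = pospart a by rewrite /pdhg col_mxKu aE.
have yT : dsubmx (T z) = y + eta *: (A *m (2%:R *: usubmx (T z) - x)) - eta *: b.
  by rewrite /pdhg col_mxKd col_mxKu.
exists (eta^-1 *: (a - usubmx (T z))); split; last first.
  move=> i; rewrite xT !mxE; case: (leP 0 (a i 0)) => ai.
    by rewrite subrr mulr0 mul0r.
  have i0 : 0 <= eta^-1 by rewrite invr_ge0 ltW.
  by rewrite subr0 mulr0 ltxx; split => //; rewrite mulr_ge0_le0 // ltW.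
have {1}-> : z - T z = col_mx (x - usubmx (T z)) (y - dsubmx (T z)).
  by rewrite -{1}(vsubmxK z) -{1}(vsubmxK (T z)) opp_col_mx add_col_mx.
rewrite Peta_mul; congr col_mx.
  rewrite mulmxBr aE; move: (A^T *m y) (A^T *m _) => p q.
  by apply/matrixP => i j; rewrite !mxE; field; rewrite gt_eqF.
rewrite {1}yT !mulmxBr -scalemxAr; move: (A *m _) (A *m _) => p q.
by apply/matrixP => i j; rewrite !mxE; field; rewrite gt_eqF.
Qed.

(** In the difference of two inclusions the skew part cancels and the normal cone is monotone, so T
    is firmly nonexpansive; Cauchy-Schwarz concludes. *)
Lemma pdhg_nonexp z1 z2 : normP A eta (T z1 - T z2) <= normP A eta (z1 - z2).
Proof.
have [g1 [e1 s1]] := pdhg_inclusion z1; have [g2 [e2 s2]] := pdhg_inclusion z2.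
move: e1 s1 e2 s2 (pdhg_primal_ge0 z1) (pdhg_primal_ge0 z2).
move: (T z1) (T z2) => t1 t2 e1 s1 e2 s2 x1 x2.
have h : dotv (t1 - t2) (P *m (t1 - t2)) <= dotv (t1 - t2) (P *m (z1 - z2)).
  have -> : z1 - z2 = (t1 - t2) + ((z1 - t1) - (z2 - t2)).
    by apply/matrixP => i j; rewrite !mxE; ring.
  rewrite (mulmxDr P (t1 - t2)) dotvDr lerDl (mulmxBr P (z1 - t1)) e1 e2.
  rewrite opp_col_mx add_col_mx -[t1 - t2]vsubmxK dotv_col.
  rewrite [usubmx (t1 - t2)]linearB [dsubmx (t1 - t2)]linearB /=.
  set u := usubmx t1 - _; set v := dsubmx t1 - _.
  have -> : c + A^T *m dsubmx t1 + g1 - (c + A^T *m dsubmx t2 + g2) = A^T *m v + (g1 - g2).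
    by rewrite mulmxBr; apply/matrixP => i j; rewrite !mxE; ring.
  have -> : b - A *m usubmx t1 - (b - A *m usubmx t2) = - (A *m u).
    by rewrite mulmxBr; apply/matrixP => i j; rewrite !mxE; ring.
  have key (p : 'cV[R]_d) (q : 'cV[R]_m) h : dotv p (A^T *m q + h) + dotv q (- (A *m p)) = dotv p h.
    by rewrite !dotv_lin dotv_mulr trmxK [dotv q _]dotvC addrAC subrr add0r.
  rewrite key dotvE; apply: sumr_ge0 => i _; rewrite !mxE.
  have [a1 a2 _] := s1 i; have [b1 b2 _] := s2 i.
  have c1 := x1 i; have c2 := x2 i.
  have d1 : usubmx t1 i 0 * g2 i 0 <= 0 by rewrite mulr_ge0_le0.
  have d2 : usubmx t2 i 0 * g1 i 0 <= 0 by rewrite mulr_ge0_le0.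
  move: d1 d2 a2 b2; rewrite !mxE; lra.
have h2 := gdot_CS Peta_sym Peta_psd (t1 - t2) (z1 - z2).
have n1 := normP_ge0 (t1 - t2); rewrite -/(normP _ _ _) -/(normP _ _ _) in h2.
move: h; rewrite -normP_sq => h; have [->|tn] := eqVneq (normP A eta (t1 - t2)) 0.
  exact: normP_ge0.
have tp : 0 < normP A eta (t1 - t2) by rewrite lt_def tn.
by rewrite -(ler_pM2l tp) -expr2; exact: le_trans h h2.
Qed.

Lemma pdhg_fixed z :
  nonneg (usubmx z) -> A *m usubmx z = b ->
  (forall i, 0 <= (c + A^T *m dsubmx z) i 0) ->
  (forall i, usubmx z i 0 = 0 \/ (c + A^T *m dsubmx z) i 0 = 0) -> T z = z.
Proof.
move=> x0 Ax rc0 cs; have xT : usubmx (T z) = usubmx z.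
  apply/matrixP => i j; rewrite (ord1 j) pdhg_primal.
  case: (cs i) => ->; last by rewrite mulr0 subr0; apply/max_idPr.
  by rewrite sub0r; apply/max_idPl; rewrite oppr_le0 mulr_ge0 // ltW.
rewrite -[RHS]vsubmxK -[LHS]vsubmxK xT; congr col_mx.
rewrite /pdhg col_mxKd -[pospart _](col_mxKu _ (dsubmx (T z))).
have -> : col_mx (pospart (usubmx z - eta *: (A^T *m dsubmx z) - eta *: c)) (dsubmx (T z)) = T z.
  by rewrite -[RHS]vsubmxK; congr col_mx; rewrite /pdhg col_mxKu.
by rewrite xT scaler_nat mulr2n addrK Ax addrK.
Qed.

Lemma residual_nonexp z : residual A b c eta (T z) <= residual A b c eta z.
Proof. exact: pdhg_nonexp. Qed.

End PDHG.

(** * The optimal point and its cone *)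

Section OptimalPoint.
Variables (R : realType) (m d : nat).
Variables (A : 'M[R]_(m, d)) (b : 'cV[R]_m) (c : 'cV[R]_d) (zs : 'cV[R]_(d + m)).
Local Notation xs := (usubmx zs).
Local Notation ys := (dsubmx zs).
Local Notation rc := (reduced_cost A c zs).

Lemma dotv_delta n (v : 'cV[R]_n) i : dotv v (delta_mx i 0) = v i 0.
Proof.
rewrite dotvE (bigD1 i) //= mxE !eqxx mulr1 big1 ?addr0 // => j ji.
by rewrite mxE (negbTE ji) mulr0.
Qed.

Lemma lagrangianE x y : lagrangian A b c x y = dotv (c + A^T *m y) x - dotv b y.
Proof.
by rewrite /lagrangian dotvDl [dotv (_ *m _) _]dotvC [dotv x _]dotv_mulr trmxK [dotv y _]dotvC.
Qed.

Hypothesis hopt : pd_optimal A b c zs.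

Lemma opt_primal_ge0 i : 0 <= xs i 0.
Proof. by case: hopt. Qed.

Lemma opt_feasible : A *m xs = b.
Proof.
(* Moving the multiplier along the primal defect would increase the Lagrangian by the squared norm
   of that defect. *)
case: hopt => _ h _; have := h (ys + (A *m xs - b)); rewrite /lagrangian.
move=> h1; apply/eqP; rewrite -subr_eq0; apply/eqP/dotv_eq0.
set e := A *m xs - b in h1 *; apply/le_anti; rewrite dotv_ge0 andbT.
have -> : dotv e e = dotv e (A *m xs) - dotv b e.
  by rewrite {2}/e dotvDr dotvNr (dotvC e b).
by move: h1; rewrite dotvDl dotvDr; lra.
Qed.

Let opt_min x : nonneg x -> dotv rc xs <= dotv rc x.
Proof. by move=> x0; case: hopt => _ _ /(_ x x0); rewrite !lagrangianE lerD2r. Qed.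

Lemma opt_reduced_cost_ge0 i : 0 <= rc i 0.
Proof.
have h : nonneg (xs + delta_mx i 0).
  by move=> j; rewrite mxE addr_ge0 ?opt_primal_ge0 // mxE ler0n.
by have := opt_min h; rewrite dotvDr lerDl dotv_delta.
Qed.

Lemma opt_compl i : rc i 0 * xs i 0 = 0.
Proof.
have h0 : nonneg (0 : 'cV[R]_d) by move=> j; rewrite mxE.
have := opt_min h0; rewrite dotv0r dotvE => h.
have h2 : \sum_j rc j 0 * xs j 0 = 0.
  apply/le_anti; rewrite h sumr_ge0 // => j _.
  by rewrite mulr_ge0 ?opt_reduced_cost_ge0 ?opt_primal_ge0.
move/eqP: h2; rewrite psumr_eq0; last first.
  by move=> j _; rewrite mulr_ge0 ?opt_reduced_cost_ge0 ?opt_primal_ge0.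
by move=> /allP /(_ i); rewrite mem_index_enum => /(_ isT)/eqP.
Qed.

Variant index_spec i : bool -> bool -> bool -> Type :=
| IndexN of 0 < rc i 0 & xs i 0 = 0 : index_spec i true false false
| IndexB1 of rc i 0 = 0 & 0 < xs i 0 : index_spec i false true false
| IndexB2 of rc i 0 = 0 & xs i 0 = 0 : index_spec i false false true.

Lemma indexP i : index_spec i (i \in idxN A c zs) (i \in idxB1 A c zs) (i \in idxB2 A c zs).
Proof.
rewrite !inE; have h := opt_compl i; have [r0|r0|r0] := ltgtP 0 (rc i 0).
- by move/eqP: h; rewrite mulf_eq0 gt_eqF //= => /eqP x0; exact: IndexN.
- by have := opt_reduced_cost_ge0 i; rewrite leNgt r0.
rewrite /=; have [x0|x0|x0] := ltgtP 0 (xs i 0).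
- exact: IndexB1.
- by have := opt_primal_ge0 i; rewrite leNgt x0.
exact: IndexB2.
Qed.

Lemma gapE (u : 'cV[R]_d) (v : 'cV[R]_m) :
  dotv c u + dotv b v = dotv rc u - dotv ys (A *m u) + dotv xs (A^T *m v).
Proof.
rewrite -opt_feasible /reduced_cost dotvDl [dotv ys _]dotv_mulr addrK.
by rewrite [dotv xs _]dotv_mulr trmxK.
Qed.

Lemma gap_opt : dotv c xs + dotv b ys = 0.
Proof.
rewrite gapE opt_feasible -opt_feasible [dotv xs _]dotv_mulr trmxK [dotv ys _]dotvC subrK.
by rewrite dotvE big1 // => i _; exact: opt_compl.
Qed.

Lemma nonneg_subvec (S : {set 'I_d}) (u : 'cV[R]_d) :
  nonneg (subvec S u) <-> forall i, i \in S -> 0 <= u i 0.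
Proof.
split=> h => [i iS|k].
  by have := h (enum_rank_in iS i); rewrite /subvec mxE enum_rankK_in.
by rewrite /subvec mxE h // enum_valP.
Qed.

Lemma colsubmx_mul (S : {set 'I_d}) (v : 'cV[R]_m) :
  (colsubmx S A)^T *m v = subvec S (A^T *m v).
Proof.
by apply/matrixP => k j; rewrite !mxE; apply: eq_bigr => l _; rewrite !mxE.
Qed.

(** By [gapE] the gap is a sum of nonnegative terms on the cone, so its nonpositivity makes each of
    them vanish; A u = 0 then gives complementarity on B2. The cone is therefore the same for all
    rho > 0. *)
Lemma KconeP rho w : 0 < rho ->
  Kcone A b c zs rho w <->
  [/\ forall i, i \in idxN A c zs -> usubmx w i 0 = 0,
      forall i, i \in idxB1 A c zs -> (A^T *m dsubmx w) i 0 = 0,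
      forall i, i \in idxB2 A c zs ->
        [/\ 0 <= usubmx w i 0, 0 <= (A^T *m dsubmx w) i 0 &
            usubmx w i 0 * (A^T *m dsubmx w) i 0 = 0] &
      A *m usubmx w = 0].
Proof.
move=> rho0; set u := usubmx w; set v := dsubmx w; split; last first.
  move=> [hN hB1 hB2 Au]; split=> /=.
  - rewrite colsubmx_mul; apply/nonneg_subvec => i; rewrite inE.
    by case/orP => [/hB1 ->|/hB2[]].
  - exact: Au.
  - by apply/nonneg_subvec => i; rewrite inE => /orP[/hN ->|/hB2[]].
  rewrite -/u -/v gapE Au dotv0r subr0 [dotv rc u]dotvE [dotv xs _]dotvE.
  rewrite !big1 ?addr0 ?mulr0 // => i _.
    by case: (indexP i) (hB1 i) => [_ ->|_ _ ->|_ ->] //; rewrite ?mul0r ?mulr0.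
  by case: (indexP i) (hN i) => [_ _ ->|-> _|-> _] //; rewrite ?mul0r ?mulr0.
case; rewrite -/u -/v /= => + Au.
rewrite colsubmx_mul => /nonneg_subvec hB /nonneg_subvec hNB gap.
have hN i : i \in idxN A c zs -> 0 <= u i 0 by move=> h; apply: hNB; rewrite inE h.
have hB2 i : i \in idxB2 A c zs -> 0 <= u i 0 by move=> h; apply: hNB; rewrite inE h orbT.
have hB1' i : i \in idxB1 A c zs -> 0 <= (A^T *m v) i 0 by move=> h; apply: hB; rewrite inE h.
have hB2' i : i \in idxB2 A c zs -> 0 <= (A^T *m v) i 0 by move=> h; apply: hB; rewrite inE h orbT.
have t1 i : 0 <= rc i 0 * u i 0.
  by case: (indexP i) (hN i) => [r _ /(_ isT) h|-> _ _|-> _ _]; rewrite ?mul0r // mulr_ge0 // ltW.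
have t2 i : 0 <= xs i 0 * (A^T *m v) i 0.
  by case: (indexP i) (hB1' i) => [_ -> _|_ x /(_ isT) h|_ -> _]; rewrite ?mul0r // mulr_ge0 // ltW.
move: gap; rewrite pmulr_rle0 ?invr_gt0 // gapE Au dotv0r subr0 [dotv rc u]dotvE [dotv xs _]dotvE => gap.
have z1 i : rc i 0 * u i 0 = 0.
  apply/le_anti; rewrite t1 andbT; apply: le_trans gap.
  rewrite (bigD1 i) //= -addrA lerDl addr_ge0 // sumr_ge0 // => *; exact: t2.
have z2 i : xs i 0 * (A^T *m v) i 0 = 0.
  apply/le_anti; rewrite t2 andbT; apply: le_trans gap.
  rewrite [X in _ + X](bigD1 i) //= addrCA lerDl addr_ge0 // sumr_ge0 // => *; exact: t2.
have uN i : i \in idxN A c zs -> u i 0 = 0.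
  case: (indexP i) (z1 i) => // r _ /eqP; rewrite mulf_eq0 gt_eqF //= => /eqP ->; done.
have vB1 i : i \in idxB1 A c zs -> (A^T *m v) i 0 = 0.
  case: (indexP i) (z2 i) => // _ x /eqP; rewrite mulf_eq0 gt_eqF //= => /eqP ->; done.
have uv : \sum_i u i 0 * (A^T *m v) i 0 = 0 by rewrite -dotvE dotv_mulr trmxK Au dotv0l.
have uv0 i : 0 <= u i 0 * (A^T *m v) i 0.
  case: (indexP i) (uN i) (vB1 i) (hB2 i) (hB2' i) => [_ _ -> //|_ _ _ -> //|_ _ _ _ h1 h2].
  - by rewrite mul0r.
  - by rewrite mulr0.
  by rewrite mulr_ge0 ?h1 ?h2.
split=> // i iB; split; [exact: hB2 | exact: hB2' |].
by move/eqP: uv; rewrite psumr_eq0 // => /allP /(_ i); rewrite mem_index_enum => /(_ isT)/eqP.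
Qed.

Lemma Kcone0 rho : 0 < rho -> Kcone A b c zs rho 0.
Proof.
move=> rho0; apply/(KconeP _ rho0); rewrite !linear0; split=> // i _; rewrite mxE //.
by split; rewrite ?mxE // mul0r.
Qed.

(** Along a cone direction all optimality conditions persist except the signs of x on B1 and of the
    reduced costs on N, which are the last two hypotheses. *)
Lemma Kcone_fixed eta rho w s : 0 < eta -> 0 < rho -> 0 <= s -> Kcone A b c zs rho w ->
  (forall i, i \in idxB1 A c zs -> 0 <= xs i 0 + s * usubmx w i 0) ->
  (forall i, i \in idxN A c zs -> 0 <= rc i 0 + s * (A^T *m dsubmx w) i 0) ->
  pdhg A b c eta (zs + s *: w) = zs + s *: w.
Proof.
move=> eta0 rho0 s0 /(KconeP _ rho0)[hN hB1 hB2 Au] h1 h2.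
have uE : usubmx (zs + s *: w) = xs + s *: usubmx w by rewrite !linearD /= linearZ.
have rE : c + A^T *m dsubmx (zs + s *: w) = rc + s *: (A^T *m dsubmx w).
  by rewrite linearD /= linearZ /= mulmxDr addrA -scalemxAr.
apply: pdhg_fixed => //.
- move=> i; rewrite uE !mxE; case: (indexP i) (h1 i) (hN i) (hB2 i) => [_ xi _ hu _|_ _ h _ _|_ xi _ _ hu].
  + by have := hu isT; rewrite mxE => ->; rewrite mulr0 addr0; have := xi; rewrite mxE => ->.
  + by have := h isT; rewrite !mxE.
  + by have [] := hu isT; have := xi; rewrite !mxE => -> a _ _; rewrite add0r mulr_ge0.
- by rewrite uE mulmxDr -scalemxAr Au scaler0 addr0 opt_feasible.
- move=> i; rewrite rE [(rc + _) i 0]mxE [(s *: (_ *m _)) i 0]mxE.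
  case: (indexP i) (h2 i) (hB1 i) (hB2 i) => [_ _ h _ _|r _ _ hv _|r _ _ _ hv].
  + exact: h.
  + by rewrite hv // r mulr0 addr0.
  + by have [_ a _] := hv isT; rewrite r add0r mulr_ge0.
move=> i; rewrite rE uE [(rc + _) i 0]mxE [(s *: (_ *m _)) i 0]mxE [(xs + _) i 0]mxE [(s *: usubmx w) i 0]mxE.
case: (indexP i) (hN i) (hB1 i) (hB2 i) => [_ -> h _ _|-> _ _ h _|-> -> _ _ h].
- by left; rewrite h // mulr0 addr0.
- by right; rewrite h // mulr0 addr0.
have [_ _ /eqP] := h isT; rewrite mulf_eq0 => /orP[/eqP ->|/eqP ->]; rewrite mulr0 addr0; by [left|right].
Qed.

Lemma Kresidual_sq rho w : Kresidual A b c zs rho w ^+ 2 =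
  \sum_(i in idxB A c zs) Num.max 0 (- (A^T *m dsubmx w) i 0) ^+ 2
  + dotv (A *m usubmx w) (A *m usubmx w)
  + \sum_(i in idxN A c zs :|: idxB2 A c zs) Num.max 0 (- usubmx w i 0) ^+ 2
  + (rho^-1 * Num.max 0 (dotv c (usubmx w) + dotv b (dsubmx w))) ^+ 2.
Proof.
rewrite /Kresidual norm2_sq !dotv_col -!addrA; congr (_ + _); last congr (_ + (_ + _)).
- rewrite colsubmx_mul dotvE [RHS]big_enum_val /=; apply: eq_bigr => k _.
  by rewrite !mxE -expr2.
- by rewrite dotvE [RHS]big_enum_val /=; apply: eq_bigr => k _; rewrite !mxE -expr2.
by rewrite dotvE big_ord1 !mxE -expr2 mulr1n.
Qed.

Lemma Kresidual_ge0 rho w : 0 <= Kresidual A b c zs rho w.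
Proof. exact: norm2_ge0. Qed.

Lemma sharpness_near rho alpha w e : sharpness_constant A b c zs rho alpha -> 0 < e ->
  exists2 k, Kcone A b c zs rho k & norm2 (w - k) < Kresidual A b c zs rho w / alpha + e.
Proof.
move=> [rho0 a0 h] e0.
have hi : has_inf [set norm2 (w - k) | k in Kcone A b c zs rho].
  split; first by exists (norm2 (w - 0)), 0 => //; exact: Kcone0.
  by exists 0 => _ [k _ <-]; exact: norm2_ge0.
have [_ [k Kk <-] hk] := inf_adherent e0 hi.
exists k => //; apply: lt_le_trans hk _; rewrite lerD2r ler_pdivlMr // mulrC.
exact: h.
Qed.

(** Sharpness is tested on the unit vector e_j: cone elements vanish on N, so its distance to the
    cone is at least 1, and only the blocks A e_j and the gap contribute to the residual. *)
Lemma sharpness_upper rho alpha j L : sharpness_constant A b c zs rho alpha ->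
  (forall u, norm2 (A *m u) <= L * norm2 u) -> j \in idxN A c zs ->
  alpha <= L + (rc j 0 + L * norm2 ys) / rho.
Proof.
move=> [rho0 a0 h] AL jN; pose w : 'cV[R]_(d + m) := col_mx (delta_mx j 0) 0.
have d1 : 1 <= dist2 w (Kcone A b c zs rho).
  apply: lb_le_inf; first by exists (norm2 (w - 0)), 0 => //; exact: Kcone0.
  move=> _ [k /(KconeP _ rho0)[hN _ _ _] <-].
  apply: le_trans (norm2_usub _); apply: le_trans (norm2_coord _ j).
  have -> : usubmx (w - k) j 0 = 1.
    have -> : usubmx (w - k) j 0 = usubmx w j 0 - usubmx k j 0 by rewrite !mxE.
    by rewrite hN // subr0 col_mxKu mxE !eqxx.
  by rewrite normr1.
have n1 : norm2 (delta_mx j 0 : 'cV[R]_d) = 1.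
  by rewrite /norm2 dotv_delta mxE !eqxx sqrtr1.
have Aj : norm2 (A *m delta_mx j 0) <= L by have := AL (delta_mx j 0); rewrite n1 mulr1.
have L0 : 0 <= L by apply: le_trans Aj; exact: norm2_ge0.
have cj : `|dotv c (delta_mx j 0)| <= rc j 0 + L * norm2 ys.
  have -> : dotv c (delta_mx j 0) = rc j 0 - dotv ys (A *m delta_mx j 0).
    by rewrite -(dotv_delta rc) /reduced_cost dotvDl [dotv ys _]dotv_mulr addrK.
  apply: le_trans (ler_normB _ _) _; rewrite ger0_norm ?opt_reduced_cost_ge0 // lerD2l.
  apply: le_trans (dotv_CS_abs _ _) _; rewrite mulrC.
  by apply: ler_wpM2r => //; exact: norm2_ge0.
set q := (_ + _ * norm2 ys) in cj *; have q0 : 0 <= q by apply: le_trans cj.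
have qr : 0 <= q / rho by rewrite divr_ge0 // ltW.
suff Kle : Kresidual A b c zs rho w <= L + q / rho.
  apply: le_trans Kle; apply: le_trans (h w); rewrite -[leLHS]mulr1.
  by rewrite ler_wpM2l // ltW.
rewrite -(@ler_pXn2r _ 2) ?nnegrE ?Kresidual_ge0 ?addr_ge0 // Kresidual_sq.
rewrite /w col_mxKu col_mxKd mulmx0 dotv0r addr0 !big1.
- rewrite add0r addr0 sqrrD -norm2_sq; apply: lerD.
    have h1 : norm2 (A *m delta_mx j 0) ^+ 2 <= L ^+ 2.
      by rewrite lerXn2r ?nnegrE ?norm2_ge0.
    by apply: le_trans h1 _; rewrite lerDl mulrn_wge0 // mulr_ge0.
  rewrite lerXn2r ?nnegrE ?mulr_ge0 ?invr_ge0 ?le_max ?lexx ?(ltW rho0) //.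
  rewrite mulrC ler_wpM2r ?invr_ge0 ?(ltW rho0) // ge_max q0 /=.
  by apply: le_trans cj; exact: ler_norm.
- move=> i _; have /max_idPl -> : - (delta_mx j 0 : 'cV[R]_d) i 0 <= 0.
    by rewrite oppr_le0 mxE ler0n.
  by rewrite expr0n.
by move=> i _; rewrite mxE oppr0 maxxx expr0n.
Qed.

End OptimalPoint.

Section LocalResidual.
Variables (R : realType) (m d : nat).
Variables (A : 'M[R]_(m, d)) (b : 'cV[R]_m) (c : 'cV[R]_d) (zs : 'cV[R]_(d + m)) (eta : R).
Hypotheses (hopt : pd_optimal A b c zs) (eta0 : 0 < eta).
Local Notation T := (pdhg A b c eta).
Local Notation rc := (reduced_cost A c zs).
Implicit Types z : 'cV[R]_(d + m).

Lemma opt_fixed : T zs = zs.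
Proof.
have := Kcone_fixed hopt eta0 ltr01 (lexx 0) (Kcone0 hopt ltr01).
rewrite scaler0 addr0; apply=> i _; rewrite mul0r addr0.
  exact: opt_primal_ge0 hopt i.
exact: opt_reduced_cost_ge0 hopt i.
Qed.

Lemma shifted_inclusion z : exists g : 'cV[R]_d,
  Peta A eta *m (z - T z)
    = col_mx (rc + A^T *m dsubmx (T z - zs) + g) (- (A *m usubmx (T z - zs)))
  /\ forall i, [/\ g i 0 <= 0, g i 0 * usubmx (T z) i 0 = 0 &
      0 < usubmx (T z) i 0 -> g i 0 = 0].
Proof.
have [g [e s]] := pdhg_inclusion A eta0 b c z; exists g; split=> //; rewrite e; congr col_mx.
  rewrite /reduced_cost linearB /= mulmxBr; move: (A^T *m _) (A^T *m _) => p q.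
  by apply/matrixP => i j; rewrite !mxE; ring.
by rewrite linearB /= mulmxBr (opt_feasible hopt) opprB.
Qed.

(** The feasibility blocks are read off from r, since g <= 0 only enlarges a negative entry. The gap
    equals <r, T z>, because g is complementary to the primal part of T z and zs has zero gap. *)
Lemma Kresidual_pdhg rho z (r := Peta A eta *m (z - T z)) : 0 < rho ->
  Kresidual A b c zs rho (T z - zs) ^+ 2
    <= norm2 r ^+ 2 + (rho^-1 * (norm2 r * norm2 (T z))) ^+ 2.
Proof.
move=> rho0; have [g [e sg]] := shifted_inclusion z; have [g' [e' _]] := pdhg_inclusion A eta0 b c z.
have gg : g' = g.
  have [+ _] := eq_col_mx (etrans (esym e') e).
  rewrite /reduced_cost linearB /= mulmxBr; move: (A^T *m _) (A^T *m _) => p q h.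
  apply: (addrI (c + q)); rewrite h.
  by apply/matrixP => i j; rewrite !mxE; ring.
have [rE rE'] : r = col_mx (rc + A^T *m dsubmx (T z - zs) + g) (- (A *m usubmx (T z - zs)))
   /\ r = col_mx (c + A^T *m dsubmx (T z) + g) (b - A *m usubmx (T z)) by rewrite -gg in e *.
have x0 i : 0 <= usubmx (T z) i 0 by exact: pdhg_primal_ge0.
rewrite Kresidual_sq; apply: lerD; last first.
  rewrite lerXn2r ?nnegrE ?mulr_ge0 ?invr_ge0 ?norm2_ge0 ?le_max ?lexx ?(ltW rho0) //.
  rewrite ler_wpM2l ?invr_ge0 ?(ltW rho0) // ge_max mulr_ge0 ?norm2_ge0 //=.
  have -> : dotv c (usubmx (T z - zs)) + dotv b (dsubmx (T z - zs)) = dotv r (T z).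
    have := gap_opt hopt; rewrite !linearB /= !dotvDr !dotvNr => g0.
    rewrite rE' dotv_colE !dotvDl dotvNl.
    have -> : dotv g (usubmx (T z)) = 0.
      by rewrite dotvE big1 // => i _; have [_ -> _] := sg i.
    rewrite [dotv (_ *m _) (usubmx _)]dotvC [dotv (usubmx _) (_ *m _)]dotv_mulr trmxK; lra.
  exact: dotv_CS.
rewrite [X in _ + _ + X]big1 ?addr0; last first.
  move=> i; rewrite inE => iN; have /max_idPl -> : - usubmx (T z - zs) i 0 <= 0.
    have -> : usubmx (T z - zs) i 0 = usubmx (T z) i 0 - usubmx zs i 0 by rewrite !mxE.
    by case: (indexP hopt i) iN => [_ ->|//|_ ->] _; rewrite subr0 oppr_le0.
  by rewrite expr0n.
rewrite norm2_sq rE dotv_col dotvNl dotvNr opprK lerD2r dotvE big_mkcond /=.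
apply: ler_sum => i _; rewrite -expr2.
case: ifP => [|_]; last exact: sqr_ge0.
rewrite inE => iB; have r0 : rc i 0 = 0 by case: (indexP hopt i) iB.
have [gi _ _] := sg i.
have -> : (rc + A^T *m dsubmx (T z - zs) + g) i 0 = (A^T *m dsubmx (T z - zs)) i 0 + g i 0.
  by rewrite [(rc + _ + _) i 0]mxE [(rc + _) i 0]mxE r0 add0r.
set a := (A^T *m _) i 0; case: (leP 0 (- a)) => ha; last by rewrite expr0n sqr_ge0.
nra.
Qed.

End LocalResidual.

(** * The adaptive run *)

(** The inner step before the stop still has residual above r / e, while the Halpern rate bounds it
    by 2 D / t. *)
Lemma stopping_length (F : realFieldType) (E q r D rk t : F) :
  0 < E -> 0 < q -> 0 < t -> 0 <= r -> E^-1 * r < rk -> t * rk <= 2 * D -> D <= r / q ->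
  t <= 2 * E / q.
Proof.
move=> E0 q0 t0 r0 hrk htk hD.
have h3 : t * (E^-1 * r) < 2 * (r / q).
  by apply: lt_le_trans (_ : t * rk <= _); rewrite ?ltr_pM2l //; lra.
have rp : 0 < r.
  by rewrite lt_def r0 andbT; apply: contraTneq h3 => ->; rewrite mulr0 mul0r !mulr0 ltxx.
have Er : 0 < E^-1 * r by rewrite mulr_gt0 ?invr_gt0.
rewrite -(ler_pM2r Er); apply: le_trans (ltW h3) _.
by rewrite le_eqVlt; apply/orP; left; apply/eqP; field; rewrite !gt_eqF.
Qed.

Section AdaptiveRun.
Variables (R : realType) (m d : nat).
Variables (A : 'M[R]_(m, d)) (b : 'cV[R]_m) (c : 'cV[R]_d) (eta : R).
Variables (z00 : 'cV[R]_(d + m)) (tau0 : nat).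
Variables (z : nat -> nat -> 'cV[R]_(d + m)) (tau : nat -> nat).
Variables (zs : 'cV[R]_(d + m)).
Hypotheses (hA : A != 0) (eta0 : 0 < eta) (heta : eta <= (2%:R * spectral_norm A)^-1).
Hypotheses (hrun : adaptive_rHPDHG A b c eta z00 tau0 z tau).
Hypotheses (hopt : pd_optimal A b c zs) (hcvg : iterates_cvg z tau zs).

Local Notation L := (spectral_norm A).
Local Notation T := (pdhg A b c eta).
Local Notation rc := (reduced_cost A c zs).
Local Notation nP := (normP A eta).
Local Notation res n := (residual A b c eta (z n 0%N)).
Local Notation s2 := (Num.sqrt (2 * eta)).
Local Notation s3 := (Num.sqrt (3 / (2 * eta))).

Lemma spectral_gt0 : 0 < L. Proof. exact: spectral_norm_gt0. Qed.

Lemma step_spectral : eta * L <= 2^-1.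
Proof.
have L0 := spectral_gt0; move: heta; rewrite invfM => h.
rewrite -ler_pdivlMr //.
Qed.

Local Notation L0 := (ltW spectral_gt0).
Local Notation AL := (@spectral_normP R m d A).
Local Notation etaL := step_spectral.

Lemma nP_ge0 x : 0 <= nP x. Proof. exact: sqrtr_ge0. Qed.

Lemma nP_triangle x y : nP (x + y) <= nP x + nP y.
Proof. exact: gnorm_triangle (Peta_sym A eta) (Peta_psd eta0 AL L0 etaL) x y. Qed.

Lemma nP_distC x y : nP (x - y) = nP (y - x).
Proof. exact: gnorm_distC. Qed.

Lemma nP_scale a x : nP (a *: x) = `|a| * nP x.
Proof. exact: gnormZ. Qed.

Lemma norm2_nP x : norm2 x <= s2 * nP x.
Proof. exact: norm2_le_normP eta0 AL L0 etaL x. Qed.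

Lemma nP_norm2 x : nP x <= s3 * norm2 x.
Proof. exact: normP_le_norm2 eta0 AL L0 etaL x. Qed.

Lemma norm2_P x : norm2 (Peta A eta *m x) <= s3 * nP x.
Proof. exact: norm2_Peta eta0 AL L0 etaL x. Qed.

Lemma T_nonexp x y : nP (T x - T y) <= nP (x - y).
Proof. exact: pdhg_nonexp eta0 AL L0 etaL b c x y. Qed.

Lemma inner_residual p n k : T p = p -> (k <= tau n)%N ->
  k.+1%:R * residual A b c eta (z n k) <= 2 * nP (z n 0%N - p).
Proof.
move=> Tp kn.
exact: (halpern_residual_rate (Peta_sym A eta) (Peta_psd eta0 AL L0 etaL) T_nonexp
  (fun k => @rh_inner _ _ _ _ _ _ _ _ _ _ _ hrun n k) Tp kn).
Qed.

Lemma inner_dist p n k : T p = p -> (k <= tau n)%N -> nP (z n k - p) <= nP (z n 0%N - p).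
Proof.
move=> Tp kn.
exact: (halpern_dist (Peta_sym A eta) (Peta_psd eta0 AL L0 etaL) T_nonexp
  (fun k => @rh_inner _ _ _ _ _ _ _ _ _ _ _ hrun n k) Tp kn).
Qed.

Lemma outer_dist p n j : T p = p -> nP (z (n + j)%N 0%N - p) <= nP (z n 0%N - p).
Proof.
move=> Tp; elim: j => [|j IH]; first by rewrite addn0.
apply: le_trans IH; rewrite addnS (rh_outer hrun).
have := T_nonexp (z (n + j)%N (tau (n + j)%N)) p; rewrite Tp => h.
by apply: le_trans h _; exact: inner_dist.
Qed.

Lemma start_dist n : nP (z n 0%N - zs) <= s3 * norm2 (z00 - zs).
Proof.
apply: le_trans (nP_norm2 _); rewrite -(rh_init hrun).
exact: (outer_dist 0 n (opt_fixed hopt eta0)).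
Qed.

(* Fejer monotonicity with respect to p, passed to the limit zs. *)
Lemma limit_dist p n : T p = p -> nP (p - zs) <= nP (z n 0%N - p).
Proof.
move=> Tp; apply/ler_addgt0Pr => e e0; have s30 : 0 <= s3 by exact: sqrtr_ge0.
have e1 : 0 < e / (s3 + 1) by rewrite divr_gt0 // ltr_wpDl.
have [n0 _ hn0] := hcvg e1; pose j := (maxn n n0 - n)%N.
have nj : (n + j)%N = maxn n n0 by rewrite subnKC // leq_maxl.
have h := hn0 (n + j)%N _ 0%N (leq0n _); have {}h := h ltac:(by rewrite /= nj leq_maxr).
have h1 := nP_triangle (p - z (n + j)%N 0%N) (z (n + j)%N 0%N - zs).
rewrite addrA subrK (nP_distC p (z _ _)) in h1.
have h2 := outer_dist n j Tp; have h3 := nP_norm2 (z (n + j)%N 0%N - zs).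
have h4 : s3 * norm2 (z (n + j)%N 0%N - zs) <= e.
  apply: (@le_trans _ _ ((s3 + 1) * (e / (s3 + 1)))).
    by apply: ler_pM; rewrite ?norm2_ge0 // ?lerDl // ltW.
  by rewrite mulrC divfK // gt_eqF // ltr_wpDl.
by apply: le_trans h1 _; lra.
Qed.

(** Loops n >= 1 stop on the residual, and the extra application of T does not increase it. *)
Lemma residual_outer n : (0 < n)%N -> res n.+1 <= (expR 1)^-1 * res n.
Proof.
case: n => // n _; rewrite (rh_outer hrun n.+1).
apply: le_trans (residual_nonexp eta0 AL L0 etaL b c _) _.
exact: (rh_len_cond hrun n.+1).
Qed.

Lemma residual_decay n j : (0 < n)%N -> res (n + j)%N <= (expR 1)^-1 ^+ j * res n.
Proof.
move=> n0; elim: j => [|j IH]; first by rewrite addn0 expr0 mul1r.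
rewrite addnS exprS -mulrA; apply: le_trans (residual_outer _) _; first by rewrite addn_gt0 n0.
by rewrite ler_wpM2l // invr_ge0 expR_ge0.
Qed.

(** The product is the square root of 3; 7/4 is a rational upper bound for linear arithmetic. *)
Lemma sqrt_prod : s2 * s3 <= 7 / 4 /\ 1 <= s2 * s3.
Proof.
have e2 : 0 <= 2 * eta by rewrite mulr_ge0 // ltW.
rewrite -sqrtrM // mulrCA mulfV ?mulr1; last by rewrite gt_eqF // mulr_gt0.
split; last by rewrite -{1}sqrtr1 ler_wsqrtr // ler1n.
rewrite -(@ler_pXn2r _ 2) ?nnegrE ?sqrtr_ge0 ?divr_ge0 // sqr_sqrtr //; lra.
Qed.

Lemma s2_gt0 : 0 < s2. Proof. by rewrite sqrtr_gt0 mulr_gt0. Qed.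

Lemma s3_gt0 : 0 < s3. Proof. by rewrite sqrtr_gt0 divr_gt0 // mulr_gt0. Qed.

Lemma s3_sq : s3 * s3 = 3 / (2 * eta).
Proof. by rewrite -expr2 sqr_sqrtr // divr_ge0 // mulr_ge0 // ltW. Qed.

Lemma s2_sq : s2 * s2 = 2 * eta.
Proof. by rewrite -expr2 sqr_sqrtr // mulr_ge0 // ltW. Qed.

Lemma alpha_step_gt0 a : 0 < a -> 0 < alpha_step eta a.
Proof. by move=> a0; rewrite /alpha_step divr_gt0 ?addr_gt0 ?mulr_gt0. Qed.

Lemma alpha_step_lt1 a : 0 < a -> alpha_step eta a < 1.
Proof.
move=> a0; have h : 0 < eta * a by exact: mulr_gt0.
by rewrite /alpha_step ltr_pdivrMr; lra.
Qed.

Lemma alpha_step_inv a : 0 < a -> (alpha_step eta a)^-1 = 1 + 2 / (eta * a).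
Proof.
move=> a0; have h : 0 < eta * a by exact: mulr_gt0.
by rewrite /alpha_step; field; rewrite !gt_eqF //; lra.
Qed.

Lemma alpha_step_le a : 0 < a -> alpha_step eta a <= eta * a / 2.
Proof.
move=> a0; have h : 0 < eta * a by exact: mulr_gt0.
rewrite /alpha_step; apply: ler_wpM2l; first exact: ltW.
by rewrite lef_pV2 ?posrE; lra.
Qed.

Lemma sharpness_near_nP rho alpha w q : sharpness_constant A b c zs rho alpha ->
  s3 * Kresidual A b c zs rho w / alpha < q ->
  exists2 k, Kcone A b c zs rho k & nP (w - k) <= q.
Proof.
move=> sh hq; have [_ a0 _] := sh; have s30 := s3_gt0.
have e0 : 0 < (q - s3 * Kresidual A b c zs rho w / alpha) / s3 by rewrite divr_gt0 // subr_gt0.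
have [k Kk hk] := sharpness_near hopt w sh e0.
exists k => //; apply: le_trans (nP_norm2 _) _; rewrite mulrC -ler_pdivlMr //.
apply: le_trans (ltW hk) _; rewrite le_eqVlt; apply/orP; left; apply/eqP.
by field; rewrite !gt_eqF.
Qed.

(** * Localisation near zs by sharpness at the scale [rho1] *)

Variables (delta alpha1 : R).
Local Notation rho1 := (2%:R * (norm2 (z00 - zs) + norm2 zs)).
Local Notation ae1 := (alpha_step eta alpha1).
Hypotheses (delta0 : 0 < delta) (hdelta : is_minimum (nondeg_values A c zs) delta).
Hypothesis hL1 : sharpness_constant A b c zs rho1 alpha1.

Lemma delta_B1 i : i \in idxB1 A c zs -> delta <= usubmx zs i 0.
Proof. by move=> iB; apply: hdelta.2; right; exists i. Qed.

Lemma delta_N i : i \in idxN A c zs -> delta * L <= rc i 0.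
Proof.
by move=> iN; rewrite -ler_pdivlMr ?spectral_gt0 //; apply: hdelta.2; left; exists i.
Qed.

Lemma coord_dual_le (v : 'cV[R]_m) i : `|(A^T *m v) i 0| <= L * norm2 v.
Proof. by apply: le_trans (norm2_coord _ _) _; exact: norm2_tr_mulmx L0 AL v. Qed.

Lemma rho1_gt0 : 0 < rho1. Proof. by case: hL1. Qed.

Lemma alpha1_gt0 : 0 < alpha1. Proof. by case: hL1. Qed.

(** Keeps the gap block of the residual at scale [rho1] below 7/8 of |r|. *)
Lemma image_norm n : norm2 (T (z n 0%N)) <= 7 / 8 * rho1.
Proof.
have h := norm2_sub (T (z n 0%N)) zs; have h1 := norm2_nP (T (z n 0%N) - zs).
have h2 := T_nonexp (z n 0%N) zs; rewrite (opt_fixed hopt eta0) in h2.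
have h3 := le_trans h2 (start_dist n).
have h4 : s2 * nP (T (z n 0%N) - zs) <= s2 * (s3 * norm2 (z00 - zs)).
  by rewrite ler_wpM2l // ltW // s2_gt0.
have [h5 _] := sqrt_prod; have h6 := ler_wpM2r (norm2_ge0 (z00 - zs)) h5.
have := norm2_ge0 zs; lra.
Qed.

Lemma near_cone n q : res n / ae1 < q ->
  exists k, [/\ Kcone A b c zs rho1 k, nP (T (z n 0%N) - zs - k) <= q - res n &
                nP (z n 0%N - zs - k) <= q].
Proof.
move=> hq; have a0 := alpha1_gt0; have r0 : 0 <= res n by exact: nP_ge0.
set r := Peta A eta *m (z n 0%N - T (z n 0%N)).
have hr : norm2 r <= s3 * res n by exact: norm2_P.
have hK := Kresidual_pdhg hopt eta0 (z n 0%N) rho1_gt0; rewrite -/r in hK.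
have hT : rho1^-1 * (norm2 r * norm2 (T (z n 0%N))) <= 7 / 8 * norm2 r.
  rewrite ler_pdivrMl ?rho1_gt0 // mulrA [rho1 * _]mulrC -mulrA [_ * norm2 r]mulrC.
  by rewrite mulrCA; apply: ler_wpM2l; [exact: norm2_ge0 | exact: image_norm].
have hT0 : 0 <= rho1^-1 * (norm2 r * norm2 (T (z n 0%N))).
  by rewrite mulr_ge0 ?mulr_ge0 ?norm2_ge0 // invr_ge0 ltW // rho1_gt0.
have Kle : s3 * Kresidual A b c zs rho1 (T (z n 0%N) - zs) <= 2 * eta^-1 * res n.
  have i0 : 0 < eta^-1 by rewrite invr_gt0.
  have s30 := ltW s3_gt0.
  rewrite -(@ler_pXn2r _ 2) ?nnegrE ?mulr_ge0 ?(ltW i0) ?Kresidual_ge0 //.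
  (* 113/64 = 1 + (7/8)^2. Multiplied by s3^4 = (9/4) / eta^2 it stays below (2 / eta)^2, and 2 /
     eta is the numerator needed by [alpha_step_inv]. *)
  have K2 : Kresidual A b c zs rho1 (T (z n 0%N) - zs) ^+ 2 <= 113 / 64 * (s3 * res n) ^+ 2.
    apply: le_trans hK _.
    have e1 : norm2 r ^+ 2 <= (s3 * res n) ^+ 2.
      by rewrite lerXn2r ?nnegrE ?norm2_ge0 ?mulr_ge0.
    have e2 : (rho1^-1 * (norm2 r * norm2 (T (z n 0%N)))) ^+ 2 <= (7 / 8 * norm2 r) ^+ 2.
      have h78 : 0 <= 7 / 8 * norm2 r by have := norm2_ge0 r; lra.
      by rewrite lerXn2r ?nnegrE.
    lra.
  rewrite exprMn; have := ler_wpM2l (sqr_ge0 s3) K2.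
  have e3 : s3 ^+ 2 = 3 / 2 * eta^-1 by rewrite expr2 s3_sq invfM mulrA.
  rewrite exprMn e3 => h; apply: le_trans h _.
  have : 0 <= eta^-1 ^+ 2 * res n ^+ 2 by rewrite mulr_ge0 ?sqr_ge0.
  lra.
have aq : s3 * Kresidual A b c zs rho1 (T (z n 0%N) - zs) / alpha1 < q - res n.
  rewrite ltrBrDr; apply: le_lt_trans hq; rewrite (alpha_step_inv a0) [res n * _]mulrDr mulr1 addrC lerD2l.
  rewrite ler_pdivrMr //; apply: le_trans Kle _; rewrite le_eqVlt; apply/orP; left; apply/eqP.
  by field; rewrite !gt_eqF.
have [k Kk hk] := sharpness_near_nP hL1 aq.
exists k; split=> //; have := nP_triangle (z n 0%N - T (z n 0%N)) (T (z n 0%N) - zs - k).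
by rewrite addrA addrA subrK; have : nP (z n 0%N - T (z n 0%N)) = res n by []; lra.
Qed.

(* Here rho1 bounds the distance of zs to the start, so that either rho1 dominates
   delta and alpha1 is of the order of the reduced cost, or the whole run stays in
   the neighbourhood of zs where the cone describes the optimal set. *)
Lemma localisation n : res n < ae1 * delta / (18 * s2) ->
  nP (z n 0%N - zs) <= 2 * (res n / ae1).
Proof.
move=> hn; have a0 := alpha1_gt0; have ae0 := alpha_step_gt0 a0.
have s20 := s2_gt0; have s30 := s3_gt0; have Lp := spectral_gt0; have rp := rho1_gt0.
have hq0 : res n / ae1 < delta / (18 * s2) by rewrite ltr_pdivrMr // mulrAC [delta * _]mulrC.
(* The distance to the cone is an infimum, so the claim is proved for every q slightly above the
   target. *)
suff H q : res n / ae1 < q -> q < delta / (18 * s2) -> nP (z n 0%N - zs) <= 2 * q.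
  rewrite leNgt; apply/negP => hlt.
  pose q := Num.min ((res n / ae1 + delta / (18 * s2)) / 2) ((res n / ae1 + nP (z n 0%N - zs) / 2) / 2).
  have q1 : res n / ae1 < q by rewrite lt_min; apply/andP; split; lra.
  have q2 : q <= (res n / ae1 + delta / (18 * s2)) / 2 by rewrite ge_min lexx.
  have q3 : q <= (res n / ae1 + nP (z n 0%N - zs) / 2) / 2 by rewrite ge_min lexx orbT.
  have := H q q1; have q4 : q < delta / (18 * s2) by lra.
  by move=> /(_ q4); lra.
move=> q1 q2; have [k [Kk hk1 hk2]] := near_cone q1.
have [kN kB1 kB2 Ak] := (KconeP hopt k rho1_gt0).1 Kk.
set t := T (z n 0%N) - zs in hk1; set w := z n 0%N - zs in hk2 *.
have r0 : 0 <= res n by exact: nP_ge0.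
have qd : s2 * q <= delta / 18.
  have := ltW q2; rewrite ler_pdivlMr ?mulr_gt0 // => h; rewrite ler_pdivlMr //; lra.
have tk : norm2 (t - k) <= delta / 18.
  apply: le_trans (norm2_nP _) _; apply: le_trans qd; rewrite ler_wpM2l ?(ltW s20) //; lra.
have fin q' : nP k <= q' -> nP w <= q + q'.
  by move=> h; have := nP_triangle (w - k) k; rewrite subrK; lra.
have [g [e sg]] := shifted_inclusion hopt eta0 (z n 0%N).
have hr : norm2 (Peta A eta *m (z n 0%N - T (z n 0%N))) <= s3 * res n by exact: norm2_P.
have ys_le : norm2 (dsubmx zs) <= rho1 / 2.
  by have := norm2_dsub zs; have := norm2_ge0 (z00 - zs); lra.
have kB1' i : i \in idxB1 A c zs -> - (delta / 18) - usubmx zs i 0 <= usubmx k i 0.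
  move=> iB; have h1 := le_trans (norm2_coord _ i) (le_trans (norm2_usub _) tk).
  have h2 : 0 <= usubmx (T (z n 0%N)) i 0 by exact: pdhg_primal_ge0.
  have h3 : usubmx (t - k) i 0 = usubmx (T (z n 0%N)) i 0 - usubmx zs i 0 - usubmx k i 0.
    by rewrite !mxE.
  by move: h1; rewrite h3 ler_norml => /andP[_]; lra.
(* Along k a reduced cost may lose up to 3/2 of its value, whence the step length 2/3 below. *)
have kN' j : j \in idxN A c zs -> - (3 / 2 * rc j 0) <= (A^T *m dsubmx k) j 0.
  move=> jN; have dj := delta_N jN.
  have rcp : 0 < rc j 0 by apply: lt_le_trans dj; exact: mulr_gt0.
  have htk : `|(A^T *m dsubmx (t - k)) j 0| <= rc j 0 / 18.
    apply: le_trans (coord_dual_le _ _) _.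
    have := ler_wpM2l (ltW Lp) (le_trans (norm2_dsub _) tk); lra.
  have tkE : (A^T *m dsubmx (t - k)) j 0 = (A^T *m dsubmx t) j 0 - (A^T *m dsubmx k) j 0.
    by rewrite linearB /= mulmxBr [LHS]mxE [(- (_ *m _)) j 0]mxE.
  (* In the first case alpha1 delta is at most 35/2 = 3/2 + 16 reduced costs, which bounds s3 times
     the residual by less than half of one. In the second case the images stay within 7/128 delta of
     zs. *)
  have [dR|dR] := leP delta (16 * rho1).
    have rj : - norm2 (Peta A eta *m (z n 0%N - T (z n 0%N))) <= rc j 0 + (A^T *m dsubmx t) j 0 + g j 0.
      have := norm2_coord (usubmx (Peta A eta *m (z n 0%N - T (z n 0%N)))) j.
      have := norm2_usub (Peta A eta *m (z n 0%N - T (z n 0%N))).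
      rewrite {3}e col_mxKu -/t [(rc + _ + _) j 0]mxE [(rc + _) j 0]mxE ler_norml.
      by move=> h1 /andP[h2 _]; lra.
    have [gj _ _] := sg j.
    have aU := sharpness_upper hopt hL1 AL jN.
    have aU' : alpha1 * delta <= 35 / 2 * rc j 0.
      have h1 : alpha1 * delta <= (L + (rc j 0 + L * (rho1 / 2)) / rho1) * delta.
        rewrite ler_pM2r //; apply: le_trans aU _; rewrite lerD2l ler_pM2r ?invr_gt0 //.
        by rewrite lerD2l ler_pM2l.
      have h2 : (L + (rc j 0 + L * (rho1 / 2)) / rho1) * delta
          = 3 / 2 * (delta * L) + rc j 0 * (delta / rho1).
        by move: rp; move: rho1 => x xp; field; rewrite gt_eqF.
      have h3 : rc j 0 * (delta / rho1) <= rc j 0 * 16.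
        by rewrite ler_pM2l // ler_pdivrMr.
      lra.
    have hr' : s3 * res n <= 7 / 288 * (alpha1 * delta).
      have h1 : res n * (18 * s2) <= eta * alpha1 / 2 * delta.
        apply: (@le_trans _ _ (ae1 * delta)); last by rewrite ler_pM2r ?alpha_step_le.
        by move: (ltW hn); rewrite ler_pdivlMr // mulr_gt0.
      have [h2 _] := sqrt_prod.
      have h3 := ler_wpM2l (ltW (mulr_gt0 s20 s30)) h1.
      have h4 : s2 * s3 * (eta * alpha1 / 2 * delta) <= 7 / 4 * (eta * alpha1 / 2 * delta).
        by rewrite ler_wpM2r // ltW // !mulr_gt0.
      have h5 : s2 * s3 * (res n * (18 * s2)) = 36 * (s3 * res n) * eta.
        have -> : s2 * s3 * (res n * (18 * s2)) = 18 * (s3 * res n) * (s2 * s2) by ring.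
        by rewrite s2_sq; ring.
      rewrite -(ler_pM2r eta0); lra.
    move: htk; rewrite tkE ler_norml => /andP[h1 h2]; lra.
  have tn : norm2 t <= 7 / 128 * delta.
    have h1 := norm2_nP t; have h2 := T_nonexp (z n 0%N) zs.
    rewrite (opt_fixed hopt eta0) -/t in h2; have h3 := le_trans h2 (start_dist n).
    have h4 : s2 * nP t <= s2 * (s3 * norm2 (z00 - zs)) by rewrite ler_pM2l.
    have [h5 _] := sqrt_prod; have h6 := ler_wpM2r (norm2_ge0 (z00 - zs)) h5.
    have := norm2_ge0 zs; lra.
  have ht : `|(A^T *m dsubmx t) j 0| <= 7 / 128 * rc j 0.
    apply: le_trans (coord_dual_le _ _) _.
    have := ler_wpM2l (ltW Lp) (le_trans (norm2_dsub _) tn); lra.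
  move: htk ht; rewrite tkE !ler_norml => /andP[h1 h2] /andP[h3 h4]; lra.
have s23 : 0 <= (2 / 3 : R) by lra.
have fix1 : T (zs + (2 / 3) *: k) = zs + (2 / 3) *: k.
  apply: (Kcone_fixed hopt eta0 rho1_gt0 s23 Kk) => i iI.
    by have := delta_B1 iI; have := kB1' i iI; have := delta0; lra.
  have := kN' i iI; have := opt_reduced_cost_ge0 hopt i; lra.
have nk0 := nP_ge0 k.
(* Fejer monotonicity gives (2/3) |k| <= |w - k| + |k| / 3. *)
have k3 : nP k <= 3 * q.
  have h := limit_dist n fix1; move: h.
  have -> : zs + (2 / 3) *: k - zs = (2 / 3) *: k by rewrite addrC addKr.
  have -> : z n 0%N - (zs + (2 / 3) *: k) = (w - k) + (1 / 3) *: k.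
    by rewrite /w; apply/matrixP => i j; rewrite !mxE; field.
  move=> h; have := le_trans h (nP_triangle _ _).
  rewrite !nP_scale !ger0_norm; [|lra|lra]; lra.
have nk2 : norm2 k <= delta / 6.
  apply: le_trans (norm2_nP _) _; have : s2 * nP k <= s2 * (3 * q) by rewrite ler_pM2l.
  lra.
(* Now k is known to be short enough for the full step, which improves the bound to |k| <= |w -
   k|. *)
have fix2 : T (zs + 1 *: k) = zs + 1 *: k.
  apply: (Kcone_fixed hopt eta0 rho1_gt0 ler01 Kk) => i iI.
    have := delta_B1 iI; have := le_trans (norm2_coord _ i) (le_trans (norm2_usub _) nk2).
    by rewrite ler_norml => /andP[h _]; have := delta0; lra.
  have := delta_N iI; have := le_trans (coord_dual_le _ i) (ler_wpM2l (ltW Lp) (le_trans (norm2_dsub _) nk2)).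
  have := opt_reduced_cost_ge0 hopt i.
  by rewrite ler_norml => h0 /andP[h _]; lra.
have kq : nP k <= q.
  have h := limit_dist n fix2; move: h; rewrite scale1r.
  have -> : zs + k - zs = k by rewrite addrC addKr.
  have -> : z n 0%N - (zs + k) = w - k by rewrite /w opprD addrA.
  by move=> h; exact: le_trans h hk2.
by have := fin q kq; lra.
Qed.

(** * The run inside the small ball around zs *)

Variables (alpha2 : R) (n : nat).
Local Notation ae2 := (alpha_step eta alpha2).
Hypothesis hL2 : sharpness_constant A b c zs delta alpha2.
Hypotheses (n0 : (0 < n)%N)
  (small : forall j, res (n + j)%N < ae1 * delta / (18 * s2)).
Local Notation zn j k := (z (n + j)%N k).
Local Notation setN := (idxN A c zs).
Local Notation setB1 := (idxB1 A c zs).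
Local Notation setB2 := (idxB2 A c zs).

Lemma alpha2_gt0 : 0 < alpha2. Proof. by case: hL2. Qed.

Lemma local_dist j : nP (zn j 0%N - zs) <= delta / (9 * s2).
Proof.
have a0 := alpha1_gt0; have ae0 := alpha_step_gt0 a0; have s20 := s2_gt0.
apply: le_trans (localisation (small j)) _.
have h : res (n + j)%N / ae1 < delta / (18 * s2).
  by rewrite ltr_pdivrMr // mulrAC [delta * _]mulrC; exact: small.
have -> : delta / (9 * s2) = 2 * (delta / (18 * s2)) by field; rewrite gt_eqF.
by rewrite ler_pM2l // ltW.
Qed.

Lemma local_norm2 j x : nP x <= nP (zn j 0%N - zs) -> norm2 x <= delta / 9.
Proof.
move=> h; have s20 := s2_gt0; apply: le_trans (norm2_nP x) _.
have h2 := ler_wpM2l (ltW s20) (le_trans h (local_dist j)).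
apply: le_trans h2 _; rewrite le_eqVlt; apply/orP; left; apply/eqP.
by field; rewrite gt_eqF.
Qed.

Lemma local_iterate j k : (k <= tau (n + j))%N -> norm2 (zn j k - zs) <= delta / 9.
Proof.
by move=> kj; apply: (@local_norm2 j); apply: inner_dist => //; exact: opt_fixed.
Qed.

Lemma local_image j k : (k <= tau (n + j))%N -> norm2 (T (zn j k) - zs) <= delta / 9.
Proof.
move=> kj; apply: (@local_norm2 j).
have := T_nonexp (zn j k) zs; rewrite (opt_fixed hopt eta0) => h.
by apply: le_trans h _; apply: inner_dist => //; exact: opt_fixed.
Qed.

Lemma reduced_cost_shift (x : 'cV[R]_(d + m)) i :
  (c + A^T *m dsubmx x) i 0 = rc i 0 + (A^T *m dsubmx (x - zs)) i 0.
Proof.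
rewrite /reduced_cost linearB /= mulmxBr; move: (A^T *m _) (A^T *m _) => p q.
by rewrite !mxE; ring.
Qed.

Lemma reduced_cost_near (x : 'cV[R]_(d + m)) i : norm2 (x - zs) <= delta / 9 ->
  i \in setN ->
  8 / 9 * rc i 0 <= (c + A^T *m dsubmx x) i 0 /\ (c + A^T *m dsubmx x) i 0 <= 10 / 9 * rc i 0.
Proof.
move=> h iN; rewrite reduced_cost_shift; have dj := delta_N iN.
have := le_trans (coord_dual_le (dsubmx (x - zs)) i)
  (ler_wpM2l L0 (le_trans (norm2_dsub _) h)).
rewrite ler_norml => /andP[h1 h2]; split; lra.
Qed.

(* A coordinate of N left positive by T has moved by about eta times its reduced cost,
   while testing the sharpness on that coordinate bounds alpha2 above. *)
Lemma bound_moving_N j : j \in setN -> 0 < usubmx (T (z n 0%N)) j 0 ->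
  nP (z n 0%N - zs) <= res n / ae2.
Proof.
move=> jN xj; have s20 := s2_gt0; have Lp := spectral_gt0; have rp := rho1_gt0.
have a10 := alpha1_gt0; have a20 := alpha2_gt0; have dp := delta0; have ep := eta0.
have hw := local_dist 0; have hn := small 0; rewrite !addn0 in hw hn.
have nw : norm2 (z n 0%N - zs) <= delta / 9 by have := @local_iterate 0%N 0%N (leq0n _); rewrite addn0.
have [rcl _] := reduced_cost_near nw jN; have dj := delta_N jN.
have rcp : 0 < rc j 0 by apply: lt_le_trans dj; exact: mulr_gt0.
have step : eta * (8 / 9 * rc j 0) <= s2 * res n.
  have xE : usubmx (T (z n 0%N)) j 0
      = usubmx (z n 0%N) j 0 - eta * (c + A^T *m dsubmx (z n 0%N)) j 0.
    by move: xj; rewrite pdhg_primal lt_max ltxx /= => /ltW /max_idPr.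
  have h1 := norm2_coord (usubmx (z n 0%N - T (z n 0%N))) j.
  have h2 : usubmx (z n 0%N - T (z n 0%N)) j 0
      = usubmx (z n 0%N) j 0 - usubmx (T (z n 0%N)) j 0 by rewrite !mxE.
  have h3 := norm2_usub (z n 0%N - T (z n 0%N)); have h4 := norm2_nP (z n 0%N - T (z n 0%N)).
  have h5 := ler_wpM2l (ltW ep) rcl; rewrite -/(residual A b c eta (z n 0%N)) in h4.
  move: h1; rewrite h2 xE ler_norml => /andP[_ h1]; lra.
have hs : s2 * res n <= eta * alpha1 * delta / 36.
  have h1 : res n * (18 * s2) <= ae1 * delta.
    by move: (ltW hn); rewrite ler_pdivlMr // mulr_gt0.
  have h2 := ler_wpM2r (ltW dp) (alpha_step_le a10); lra.
have r32 : 32 * rc j 0 <= alpha1 * delta by rewrite -(ler_pM2l ep); lra.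
have ys_le : norm2 (dsubmx zs) <= rho1 / 2.
  by have := norm2_dsub zs; have := norm2_ge0 (z00 - zs); lra.
(* The lower bound 32 rc_j on alpha1 delta, against the upper bound (3/2 + delta / rho1) rc_j,
   forces delta to dominate rho1; hence |ys| <= delta / 60 below. *)
have dR : 30 * rho1 <= delta.
  have aU := sharpness_upper hopt hL1 AL jN.
  have h1 : alpha1 * delta <= (L + (rc j 0 + L * (rho1 / 2)) / rho1) * delta.
    rewrite ler_pM2r //; apply: le_trans aU _; rewrite lerD2l ler_pM2r ?invr_gt0 //.
    by rewrite lerD2l ler_pM2l.
  have h2 : (L + (rc j 0 + L * (rho1 / 2)) / rho1) * delta
      = 3 / 2 * (delta * L) + rc j 0 * (delta / rho1).
    by move: rp; move: rho1 => x xp; field; rewrite gt_eqF.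
  rewrite -ler_pdivlMr // -(ler_pM2l rcp); lra.
have a2le : alpha2 * delta <= 3 * rc j 0.
  have aU := sharpness_upper hopt hL2 AL jN.
  have h1 : alpha2 * delta <= (L + (rc j 0 + L * (delta / 60)) / delta) * delta.
    rewrite ler_pM2r //; apply: le_trans aU _; rewrite lerD2l ler_pM2r ?invr_gt0 //.
    rewrite lerD2l ler_pM2l //; lra.
  have h2 : (L + (rc j 0 + L * (delta / 60)) / delta) * delta
      = (1 + 1 / 60) * (delta * L) + rc j 0 by field; rewrite gt_eqF.
  lra.
apply: le_trans hw _; rewrite (alpha_step_inv a20) mulrDr mulr1.
have r0 : 0 <= res n by exact: nP_ge0.
apply: (@le_trans _ _ (res n * (2 / (eta * alpha2)))); last by rewrite lerDr.
have ea : 0 < eta * alpha2 by exact: mulr_gt0.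
rewrite mulrA ler_pdivlMr // mulrAC ler_pdivrMr ?mulr_gt0 //.
have h := ler_wpM2l (ltW ep) a2le; have := mulr_gt0 ep rcp; lra.
Qed.

Hypothesis still : forall i, i \in setN -> usubmx (T (z n 0%N)) i 0 = 0.

Lemma zn_succ j k : (k < tau (n + j))%N ->
  zn j k.+1 = (k.+1%:R / k.+2%:R) *: T (zn j k) + k.+2%:R^-1 *: zn j 0%N.
Proof. by move=> kj; rewrite (rh_inner hrun kj). Qed.

Lemma zn_outer j : zn j.+1 0%N = T (zn j (tau (n + j))).
Proof. by rewrite addnS (rh_outer hrun). Qed.

Lemma usub_comb a a' (x y : 'cV[R]_(d + m)) i :
  usubmx (a *: x + a' *: y) i 0 = a * usubmx x i 0 + a' * usubmx y i 0.
Proof. by rewrite !mxE. Qed.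

(** T sends to 0 any coordinate in N that is at most 8/9 of eta times its reduced cost. Later
    iterates of a loop keep only a fraction of the anchor, and later anchors, being images, vanish
    on N. *)
Lemma nonbasic_vanish j k : (k <= tau (n + j))%N ->
  forall i, i \in setN -> usubmx (T (zn j k)) i 0 = 0.
Proof.
have ep := eta0.
have clamp x i : norm2 (x - zs) <= delta / 9 -> i \in setN ->
    usubmx x i 0 <= eta * (8 / 9 * rc i 0) -> usubmx (T x) i 0 = 0.
  move=> nx iN xi; rewrite pdhg_primal; apply/max_idPl.
  have [h _] := reduced_cost_near nx iN; have := ler_wpM2l (ltW ep) h; lra.
elim: j k => [|j IH] k; elim: k => [|k IHk] kj i iN.
- by rewrite addn0; exact: still.
- apply: clamp => //; first exact: local_iterate.
  rewrite zn_succ // usub_comb (IHk (ltnW kj)) // mulr0 add0r.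
  have x0 : 0 <= usubmx (zn 0%N 0%N) i 0.
    by rewrite addn0; case: n n0 => // n' _; rewrite (rh_outer hrun); exact: pdhg_primal_ge0.
  have nx : norm2 (zn 0%N 0%N - zs) <= delta / 9 by exact: local_iterate.
  have [_ hu] := reduced_cost_near nx iN.
  have xi : usubmx (zn 0%N 0%N) i 0 <= eta * (c + A^T *m dsubmx (zn 0%N 0%N)) i 0.
    have := still iN; rewrite -[n in z n _](addn0 n) pdhg_primal => /max_idPl; lra.
  have hv := ler_wpM2l (ltW ep) hu.
  (* The first anchor may be positive on N, but weighs at most 1/2, and 10/9 times 1/2 is below
     8/9. *)
  have k2 : k.+2%:R^-1 <= 2^-1 :> R by rewrite lef_pV2 ?posrE ?ltr0n // ler_nat.
  apply: le_trans (ler_wpM2r x0 k2) _; have := le_trans xi hv.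
  have := mulr_ge0 (ltW ep) (opt_reduced_cost_ge0 hopt i); lra.
- apply: clamp => //; first exact: local_iterate.
  by rewrite zn_outer IH //; apply: mulr_ge0; [exact: ltW | have := opt_reduced_cost_ge0 hopt i; lra].
apply: clamp => //; first exact: local_iterate.
rewrite zn_succ // usub_comb (IHk (ltnW kj)) // mulr0 add0r zn_outer IH // mulr0.
by apply: mulr_ge0; [exact: ltW | have := opt_reduced_cost_ge0 hopt i; lra].
Qed.

Definition normal_part (x : 'cV[R]_(d + m)) : 'cV[R]_d :=
  usubmx (Peta A eta *m (x - T x)) - rc - A^T *m dsubmx (T x - zs).

Lemma normal_partE x : Peta A eta *m (x - T x)
  = col_mx (rc + A^T *m dsubmx (T x - zs) + normal_part x) (- (A *m usubmx (T x - zs))).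
Proof.
have [g [e _]] := shifted_inclusion hopt eta0 x; rewrite /normal_part e col_mxKu.
congr col_mx; move: (A^T *m _) => p; apply/matrixP => i j; rewrite !mxE; ring.
Qed.

Lemma normal_part_sign x i : [/\ normal_part x i 0 <= 0,
  normal_part x i 0 * usubmx (T x) i 0 = 0 & 0 < usubmx (T x) i 0 -> normal_part x i 0 = 0].
Proof.
have [g [e sg]] := shifted_inclusion hopt eta0 x.
have -> : normal_part x = g; last exact: sg.
rewrite /normal_part e col_mxKu; move: (A^T *m _) => p.
by apply/matrixP => i' j; rewrite !mxE; ring.
Qed.

Lemma shift_usub (x : 'cV[R]_(d + m)) i : usubmx (x - zs) i 0 = usubmx x i 0 - usubmx zs i 0.
Proof. by rewrite !mxE. Qed.

Lemma shifted_nonbasic j k i : (k <= tau (n + j))%N -> i \in setN ->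
  usubmx (T (zn j k) - zs) i 0 = 0.
Proof.
move=> kj iN; rewrite shift_usub nonbasic_vanish //.
by case: (indexP hopt i) iN => // _ ->; rewrite subrr.
Qed.

Lemma normal_part_B1 j k i : (k <= tau (n + j))%N -> i \in setB1 ->
  normal_part (zn j k) i 0 = 0.
Proof.
move=> kj iB; have [_ _] := normal_part_sign (zn j k) i; apply.
have h := le_trans (norm2_coord (usubmx (T (zn j k) - zs)) i)
  (le_trans (norm2_usub _) (local_image kj)).
move: h; rewrite shift_usub ler_norml => /andP[h _].
have := delta_B1 iB; have := delta0; lra.
Qed.

(** * The run on the coordinates off N *)

Local Notation Db := (coord_mask R (~: setN)).
Local Notation Ab := (A *m Db).
Local Notation Pb := (Peta Ab eta).

(** The columns of A in N are zeroed rather than removed, so the space is unchanged and [Pb] keeps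
    the lower bound of P_eta. *)
Definition basic_mask : 'M[R]_(d + m) := block_mx Db 0 0 1%:M.

Definition basic_skew : 'M[R]_(d + m) := block_mx 0 Ab^T (- Ab) 0.

Definition basic_index : {set 'I_(d + m)} := [set lshift m i | i in setB2]%SET.

Lemma basic_mask_col (u : 'cV[R]_d) (v : 'cV[R]_m) :
  basic_mask *m col_mx u v = col_mx (Db *m u) v.
Proof. by rewrite mul_block_col !mul0mx mul1mx addr0 add0r. Qed.

Lemma basic_skew_col (u : 'cV[R]_d) (v : 'cV[R]_m) :
  basic_skew *m col_mx u v = col_mx (Ab^T *m v) (- (Ab *m u)).
Proof. by rewrite mul_block_col !mul0mx mulNmx addr0 add0r. Qed.

Lemma basic_skew_tr : basic_skew^T = - basic_skew.
Proof. by rewrite /basic_skew tr_block_mx opp_block_mx !trmx0 !oppr0 linearN /= trmxK opprK. Qed.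

Lemma Ab_bound (u : 'cV[R]_d) : norm2 (Ab *m u) <= L * norm2 u.
Proof.
rewrite -mulmxA; apply: le_trans (AL _) _; rewrite ler_pM2l ?spectral_gt0 //.
rewrite !norm2E ler_wsqrtr //; apply: ler_sum => i _; rewrite coord_maskE.
by case: (i \in _); rewrite ?mul1r // mul0r expr0n sqr_ge0.
Qed.

Local Notation Pb_lo := (@Peta_lo R m d Ab eta L eta0 Ab_bound L0 etaL).

Lemma basic_mask_id (u : 'cV[R]_d) : (forall i, i \in setN -> u i 0 = 0) -> Db *m u = u.
Proof.
move=> h; apply/matrixP => i j; rewrite (ord1 j) coord_maskE inE.
by case: (boolP (i \in setN)) => [/h ->|_]; rewrite ?mul0r ?mul1r.
Qed.

Lemma Pb_basic (x : 'cV[R]_(d + m)) : (forall i, i \in setN -> usubmx x i 0 = 0) ->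
  Pb *m x = basic_mask *m (Peta A eta *m x).
Proof.
rewrite -(vsubmxK x) col_mxKu; move: (usubmx x) (dsubmx x) => u v h.
rewrite !Peta_mul basic_mask_col; congr col_mx.
  by rewrite mulmxBr -scalemxAr basic_mask_id // trmx_mul coord_mask_tr mulmxA.
by rewrite -mulmxA basic_mask_id.
Qed.

Let lo := (2 * eta)^-1.

Let lo0 : 0 < lo. Proof. by rewrite invr_gt0 mulr_gt0. Qed.

Let Pbu : Pb \in unitmx := Pdef_unit (Peta_sym Ab eta) lo0 Pb_lo.

(* Chosen so that [Pb] maps it to the part of [Peta A eta *m (z - zs)] off N: the first
   anchor itself need not vanish on N. *)
Definition basic_start j : 'cV[R]_(d + m) :=
  invmx Pb *m (basic_mask *m (Peta A eta *m (zn j 0%N - zs))).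

Definition basic_normal j k : 'cV[R]_(d + m) :=
  col_mx (\col_i ((i \in setB2)%:R * normal_part (zn j k) i 0)) 0.

Lemma shifted_halpern j k : (k <= tau (n + j))%N ->
  zn j k - zs = halpern_pt (zn j 0%N - zs) (fun k => T (zn j k) - zs) k.
Proof.
case: k => [|k] kj; first by rewrite halpern_pt0.
apply: (@scalerI _ _ k.+2%:R); first by rewrite pnatr_eq0.
rewrite halpern_ptE /= scalerBr zn_succ // scalerDr !scalerA mulrCA mulfV ?pnatr_eq0 // mulr1.
by rewrite scale1r -(natr1 k.+1); apply/matrixP => a e; rewrite !mxE; ring.
Qed.

(** Off N the reduced costs of zs vanish, and on B1 the normal part vanishes because these
    coordinates stay positive; only the skew part and the normals on B2 remain. *)
Lemma basic_orbit : restarted_orbit Pb basic_skew basic_index (fun j => tau (n + j))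
  basic_start (fun j k => T (zn j k) - zs) basic_normal.
Proof.
move=> j; split; last first.
  rewrite /basic_start zn_outer -Pb_basic ?(mulKmx Pbu) // => i iN.
  exact: shifted_nonbasic.
move=> k kj; set t := T (zn j k) - zs; have tN i := shifted_nonbasic (i := i) kj.
have tD : Db *m usubmx t = usubmx t by apply: basic_mask_id => i; exact: tN.
split=> [|i iI|i iI].
- have -> : Pb *m (halpern_pt (basic_start j) (fun k => T (zn j k) - zs) k - t)
      = basic_mask *m (Peta A eta *m (zn j k - T (zn j k))).
    rewrite mulmxBr (Pb_basic tN) -[zn j k - T _](subrKA zs) -/t.
    have -> : zs - T (zn j k) = - t by rewrite opprB.
    rewrite (mulmxDr _ (zn j k - zs)) mulmxN (mulmxDr basic_mask) mulmxN; congr (_ - _).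
    rewrite (shifted_halpern kj) /halpern_pt -!scalemxAr !mulmxDr -!scalemxAr.
    congr (_ *: (_ + _)); last by rewrite /basic_start (mulKVmx Pbu) -!mulmxDr.
    case: k kj {t tN tD} => [|k] kj; first by rewrite !scale0r.
    by rewrite /= (Pb_basic (fun i => shifted_nonbasic (i := i) (ltnW kj))).
  rewrite normal_partE basic_mask_col -[in RHS](vsubmxK t) basic_skew_col add_col_mx addr0.
  rewrite -/t; congr col_mx; last by rewrite -mulmxA tD.
  rewrite (mulmxDr Db (rc + _)) (mulmxDr Db rc) -[LHS]addrA trmx_mul coord_mask_tr -mulmxA.
  have -> : Db *m rc = 0.
    apply/matrixP => i e; rewrite (ord1 e) coord_maskE inE [RHS]mxE.
    by case: (indexP hopt i) => [_ _|-> _|-> _]; rewrite ?mul0r ?mulr0.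
  rewrite add0r; congr (_ + _); apply/matrixP => i e; rewrite (ord1 e) coord_maskE [RHS]mxE inE.
  by case: (indexP hopt i) (normal_part_B1 (i := i) kj) => [_ _ _|_ _ ->|_ _ _] //; rewrite ?mul0r ?mulr0.
- have [i0 iB ->] := imsetP iI; have [h1 h2 _] := normal_part_sign (zn j k) i0.
  have gE : basic_normal j k (lshift m i0) 0 = normal_part (zn j k) i0 0.
    have -> : basic_normal j k (lshift m i0) 0 = usubmx (basic_normal j k) i0 0 by rewrite [RHS]mxE.
    by rewrite /basic_normal col_mxKu mxE iB mul1r.
  have tE : t (lshift m i0) 0 = usubmx (T (zn j k)) i0 0.
    have -> : t (lshift m i0) 0 = usubmx t i0 0 by rewrite [RHS]mxE.
    by rewrite shift_usub; case: (indexP hopt i0) iB => // _ -> _; rewrite subr0.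
  by rewrite gE tE; split=> //; exact: pdhg_primal_ge0.
case: (split_ordP i) iI => i0 -> iI.
  have -> : basic_normal j k (lshift m i0) 0 = usubmx (basic_normal j k) i0 0 by rewrite [RHS]mxE.
  rewrite /basic_normal col_mxKu mxE; case: (boolP (i0 \in setB2)) => [h|_]; last by rewrite mul0r.
  by move: iI; rewrite imset_f.
have -> : basic_normal j k (rshift d i0) 0 = dsubmx (basic_normal j k) i0 0 by rewrite [RHS]mxE.
by rewrite /basic_normal col_mxKd mxE.
Qed.

Lemma expR1_inv : 0 < (expR 1)^-1 :> R /\ (expR 1)^-1 < 1 :> R.
Proof. by split; rewrite ?invf_lt1 ?invr_gt0 ?expR_gt0 // expR_gt1. Qed.

Lemma residual_ratio q j : 0 < q -> res (n + j)%N / q <= res n / q * (expR 1)^-1 ^+ j.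
Proof.
move=> q0; rewrite [leRHS]mulrAC; apply: ler_wpM2r; first by rewrite invr_ge0 ltW.
by rewrite mulrC; exact: residual_decay j n0.
Qed.

(** The Halpern rate is used at the last failed test, one step before the stop. There is no test at
    k = 0, so lengths at most 1 are treated apart, where e >= 1 >= q suffices. *)
Lemma length_le_of_bound q j : 0 < q -> q <= 1 -> nP (zn j 0%N - zs) <= res (n + j)%N / q ->
  (tau (n + j))%:R <= 2 * expR 1 / q.
Proof.
move=> q0 q1 hq; have ep := expR_gt0 (1 : R).
have [t1|t1] := leqP (tau (n + j)) 1.
  have e1 : 1 <= expR 1 :> R by rewrite -[leLHS]expR0 ler_expR.
  apply: (@le_trans _ _ 1%:R); first by rewrite ler_nat.
  by rewrite ler_pdivlMr //; lra.
have := rh_len_first hrun (n := (n + j)%N) (k := (tau (n + j)).-1).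
have -> : (0 < (tau (n + j)).-1 < tau (n + j))%N by case: (tau _) t1 => [|[|k]] //=; rewrite ltnSn.
move=> /(_ isT); have nj : (0 < n + j)%N by rewrite addn_gt0 n0.
case: (n + j)%N nj hq t1 => // n' _ hq t1 /= /negP; rewrite -ltNge => h.
have kj : ((tau n'.+1).-1 <= tau n'.+1)%N by exact: leq_pred.
have h2 := inner_residual (opt_fixed hopt eta0) kj.
rewrite prednK in h2; last exact: ltnW.
have T0 : 0 < (tau n'.+1)%:R :> R by rewrite ltr0n ltnW.
exact: (stopping_length ep q0 T0 (nP_ge0 _) h h2 hq).
Qed.

Lemma localisation_ratio j : nP (zn j 0%N - zs) <= res (n + j)%N / (ae1 / 2).
Proof.
apply: le_trans (localisation (small j)) _; rewrite le_eqVlt; apply/orP; left; apply/eqP.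
by have := alpha_step_gt0 alpha1_gt0; move: ae1 => a a0; field; rewrite gt_eqF.
Qed.

(** The cruder constant [ae1 / 2] already bounds the loop lengths and turns the decay of the
    residuals into geometric decay of the anchors, as [orbit_rigidity] requires. *)
Lemma basic_unobservable j k l : (k <= tau (n + j))%N ->
  krylov Pb basic_skew basic_index l *m (T (zn j k) - zs) = 0.
Proof.
have a0 := alpha_step_gt0 alpha1_gt0; have a1 := alpha_step_lt1 alpha1_gt0.
have h2 : 0 < ae1 / 2 by rewrite divr_gt0.
have h2' : ae1 / 2 <= 1 by lra.
pose K := Num.bound (2 * expR 1 / (ae1 / 2) : R).
have NK i : ((tau (n + i)).+1 <= K.+1)%N.
  have e0 : 0 <= 2 * expR 1 / (ae1 / 2) by rewrite divr_ge0 ?(ltW h2) // mulr_ge0 // expR_ge0.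
  have := le_lt_trans (length_le_of_bound h2 h2' (localisation_ratio i)) (archi_boundP e0).
  by rewrite ltr_nat => h; rewrite ltnS ltnW.
have [CI CI0 hCI] := norm2_mulmx_bound (invmx Pb *m (basic_mask *m Peta A eta)).
have [e0 e1] := expR1_inv.
pose C0 := CI * (s2 * (res n / (ae1 / 2))).
have r0 : 0 <= res n by exact: nP_ge0.
have C00 : 0 <= C0.
  by rewrite mulr_ge0 // mulr_ge0 ?(ltW s2_gt0) // divr_ge0 // ltW.
have dec i : norm2 (basic_start i) <= C0 * (expR 1)^-1 ^+ i.
  have -> : basic_start i = invmx Pb *m (basic_mask *m Peta A eta) *m (zn i 0%N - zs).
    by rewrite /basic_start !mulmxA.
  apply: le_trans (hCI _) _.
  rewrite /C0 -mulrA ler_wpM2l //; apply: le_trans (norm2_nP _) _.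
  rewrite -mulrA ler_wpM2l ?(ltW s2_gt0) //; apply: le_trans (localisation_ratio i) _.
  exact: residual_ratio.
move=> kj; exact: (orbit_rigidity (Peta_sym Ab eta) basic_skew_tr lo0 Pb_lo basic_orbit NK C00 (ltW e0) e1 dec kj l).
Qed.

(** Level 0 gives t_i = 0 and level 1 gives s_i = 0 for s the resolvent of t. In row i of (Pb + M) s
    = Pb t the dual part of s cancels, which leaves (A^T v)_i = 0 for v the dual part of t. *)
Lemma degenerate_vanish j k i : (k <= tau (n + j))%N -> i \in setB2 ->
  usubmx (T (zn j k) - zs) i 0 = 0 /\ (A^T *m dsubmx (T (zn j k) - zs)) i 0 = 0.
Proof.
move=> kj iB; have iI : lshift m i \in basic_index by apply: imset_f.
have k0 := basic_unobservable 0 kj; have k1 := basic_unobservable 1 kj.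
move: (T _ - zs) k0 k1 => t /= k0 k1; rewrite -mulmxA in k1.
have coord (x : 'cV[R]_(d + m)) : coord_mask R basic_index *m x = 0 -> usubmx x i 0 = 0.
  by move=> /matrixP /(_ (lshift m i) 0); rewrite coord_maskE iI mul1r [usubmx x i 0]mxE => ->; rewrite mxE.
have ti := coord _ k0; split=> //; have := coord _ k1; set s := resolvent _ _ *m t => si.
have PMu := unitmx_PM basic_skew_tr lo0 Pb_lo.
have es : (Pb + basic_skew) *m s = Pb *m t by rewrite /s /resolvent !mulmxA mulmxV // mul1mx.
have := congr1 usubmx es; clearbody s; clear es k0 k1.
rewrite -{1}(vsubmxK s) -{1}(vsubmxK t) mulmxDl basic_skew_col !Peta_mul add_col_mx !col_mxKu subrK.
rewrite trmx_mul coord_mask_tr -mulmxA => /matrixP /(_ i 0).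
have colB (u v : 'cV[R]_d) : (u - v) i 0 = u i 0 - v i 0 by rewrite !mxE.
have colZ a (u : 'cV[R]_d) : (a *: u) i 0 = a * u i 0 by rewrite !mxE.
rewrite colB coord_maskE inE; have -> : (i \in setN) = false by case: (indexP hopt i) iB.
by rewrite !colZ si ti !mulr0 mul1r => h; lra.
Qed.

(** * Orthogonality of the run to the cone *)

Section ConeDirection.
Variable k0 : 'cV[R]_(d + m).
Hypothesis Kk : Kcone A b c zs delta k0.

(* The B2-coordinates of [k0] are dropped, which makes the pairing with z - T z vanish
   exactly; the run does not see them. *)
Let q : 'cV[R]_(d + m) := col_mx (coord_mask R setB1 *m usubmx k0) (dsubmx k0).
Let Phi (x : 'cV[R]_(d + m)) := dotv q (Peta A eta *m x).

Let PhiD a a' x y : Phi (a *: x + a' *: y) = a * Phi x + a' * Phi y.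
Proof. by rewrite /Phi mulmxDr -!scalemxAr dotvDr !dotvZr. Qed.

(** The pairing of q with P_eta (z - T z) vanishes. Each term of <A^T v, u> for v dual in [k0] and u
    primal in the image has a zero factor, and the remaining block is completed to the full pairing
    with the primal part of [k0], which A annihilates. *)
Let Phi_image j k : (k <= tau (n + j))%N -> Phi (T (zn j k) - zs) = Phi (zn j k - zs).
Proof.
move=> kj; have [kN kB1 kB2 Ak] := (KconeP hopt k0 delta0).1 Kk.
apply/eqP; rewrite eq_sym -subr_eq0 /Phi -dotvNr -dotvDr -mulmxN -mulmxDr.
have -> : zn j k - zs - (T (zn j k) - zs) = zn j k - T (zn j k).
  by apply/matrixP => a e; rewrite !mxE; ring.
rewrite normal_partE /q dotv_col dotvNr; set t := T _ - zs.
have tN i := shifted_nonbasic (i := i) kj; have tB i := degenerate_vanish (i := i) kj.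
have h1 : dotv (dsubmx k0) (A *m usubmx t) = 0.
  rewrite dotv_mulr dotvE big1 // => i _.
  case: (indexP hopt i) (tN i) (tB i) (kB1 i) => [_ _ h _ _|_ _ _ _ h|_ _ _ h _].
  - by rewrite h // mulr0.
  - by rewrite h // mul0r.
  by rewrite (h isT).1 mulr0.
have h2 : dotv (usubmx k0) (A^T *m dsubmx t) = 0 by rewrite dotv_mulr trmxK Ak dotv0l.
rewrite h1 oppr0 addr0 -h2 !dotvE; apply/eqP/eq_bigr => i _.
rewrite coord_maskE [(rc + _ + _) i 0]mxE [(rc + _) i 0]mxE.
case: (indexP hopt i) (kN i) (tB i) (normal_part_B1 (i := i) kj) => [_ _ h _ _|-> _ _ _ h|_ _ _ h _].
- by rewrite h // !mul0r.
- by rewrite h // mul1r add0r addr0.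
by rewrite (h isT).2 !mul0r mulr0.
Qed.

Let Phi_inner j k : (k <= tau (n + j))%N -> Phi (zn j k - zs) = Phi (zn j 0%N - zs).
Proof.
elim: k => // k IH kj.
have -> : zn j k.+1 - zs = (k.+1%:R / k.+2%:R) *: (T (zn j k) - zs) + k.+2%:R^-1 *: (zn j 0%N - zs).
  rewrite zn_succ //; have e : k.+1%:R / k.+2%:R = 1 - k.+2%:R^-1 :> R.
    by rewrite -[k.+1%:R](addrK 1) natr1 mulrBl mulfV ?pnatr_eq0 // mul1r.
  by rewrite e; apply/matrixP => a e'; rewrite !mxE; ring.
rewrite PhiD Phi_image ?(ltnW kj) // IH ?(ltnW kj) // -mulrDl.
have -> : k.+1%:R / k.+2%:R + k.+2%:R^-1 = 1 :> R.
  by rewrite -[X in _ + X]mul1r -mulrDl natr1 mulfV ?pnatr_eq0.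
by rewrite mul1r.
Qed.

Let Phi_outer j : Phi (zn j 0%N - zs) = Phi (zn 0%N 0%N - zs).
Proof. by elim: j => // j <-; rewrite zn_outer Phi_image // Phi_inner. Qed.

(** [Phi] is constant along the run, whose anchors tend to zs, where it is 0. *)
Lemma image_orthogonal : dotv k0 (Peta A eta *m (T (z n 0%N) - zs)) = 0.
Proof.
have -> : dotv k0 (Peta A eta *m (T (z n 0%N) - zs)) = Phi (T (zn 0%N 0%N) - zs).
  rewrite addn0 /Phi; have [kN _ _ _] := (KconeP hopt k0 delta0).1 Kk.
  have tB i := @degenerate_vanish 0%N 0%N i (leq0n _); rewrite addn0 in tB.
  move: (T _ - zs) tB => t tB; rewrite -{1}(vsubmxK k0) -(vsubmxK t) Peta_mul !dotv_col.
  congr (_ + _); rewrite !dotvE; apply: eq_bigr => i _.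
  rewrite coord_maskE; case: (indexP hopt i) (kN i) (tB i) => [_ _ h _|_ _ _ _|_ _ _ h].
  - by rewrite h // mulr0.
  - by rewrite mul1r.
  have [h1 h2] := h isT.
  have -> : (eta^-1 *: usubmx t - A^T *m dsubmx t) i 0
      = eta^-1 * usubmx t i 0 - (A^T *m dsubmx t) i 0 by rewrite !mxE.
  by rewrite h1 h2 mulr0 subr0 !mulr0.
rewrite Phi_image //; apply/eqP; rewrite -normr_le0; apply/ler_addgt0Pl => e e0; rewrite addr0.
have [C C_0 hC] := norm2_mulmx_bound (Peta A eta).
have [i0 i1] := expR1_inv.
pose C' := norm2 q * (C * (s2 * (res n / (ae1 / 2)))).
have r0 : 0 <= res n by exact: nP_ge0.
have a0 := alpha_step_gt0 alpha1_gt0.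
have h2 : 0 < ae1 / 2 by rewrite divr_gt0.
have C'0 : 0 <= C'.
  by rewrite !mulr_ge0 ?norm2_ge0 ?(ltW s2_gt0) // invr_ge0 ltW.
have [j0 hj] := geometric_small C'0 (ltW i0) i1 e0.
rewrite -(Phi_outer j0); apply: le_trans (ltW (hj j0 (leqnn _))).
apply: le_trans (dotv_CS_abs _ _) _; rewrite /C' -mulrA ler_wpM2l ?norm2_ge0 //.
apply: le_trans (hC _) _; rewrite -mulrA ler_wpM2l //.
apply: le_trans (norm2_nP _) _; rewrite -mulrA ler_wpM2l ?(ltW s2_gt0) //.
apply: le_trans (localisation_ratio j0) _.
exact: residual_ratio.
Qed.

End ConeDirection.

(* Sharpness is applied to t or -t, whichever has nonpositive gap; orthogonality to
   the cone bounds ||t|| by the distance from t to it. *)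
Lemma bound_still : nP (z n 0%N - zs) <= res n / ae2.
Proof.
have a20 := alpha2_gt0; have r0 : 0 <= res n by exact: nP_ge0.
set t := T (z n 0%N) - zs.
have tN i := @shifted_nonbasic 0%N 0%N i (leq0n _).
have tB i := @degenerate_vanish 0%N 0%N i (leq0n _).
have gB i := @normal_part_B1 0%N 0%N i (leq0n _).
rewrite addn0 -/t in tN tB gB.
have rE := normal_partE (z n 0%N); rewrite -/t in rE.
set r := Peta A eta *m (z n 0%N - T (z n 0%N)) in rE.
have hr : norm2 r <= s3 * res n by exact: norm2_P.
have [s [s1 gap]] : exists s : R, s ^+ 2 = 1 /\
    dotv c (usubmx (s *: t)) + dotv b (dsubmx (s *: t)) <= 0.
  have [h|h] := leP (dotv c (usubmx t) + dotv b (dsubmx t)) 0.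
    by exists 1; rewrite expr1n scale1r.
  exists (-1); rewrite sqrrN expr1n !linearZ /= !dotvZr; split=> //; lra.
have sabs : `|s| = 1 by apply/eqP; rewrite -sqrp_eq1 // -normrX s1 normr1.
have Kle : Kresidual A b c zs delta (s *: t) <= norm2 r.
  rewrite -(@ler_pXn2r _ 2) ?nnegrE ?norm2_ge0 // Kresidual_sq.
  have -> : Num.max 0 (dotv c (usubmx (s *: t)) + dotv b (dsubmx (s *: t))) = 0.
    exact/max_idPl.
  rewrite mulr0 expr0n addr0 [X in _ + _ + X]big1 ?addr0; last first.
    move=> i; rewrite inE => iN.
    have -> : usubmx (s *: t) i 0 = s * usubmx t i 0 by rewrite !mxE.
    have -> : usubmx t i 0 = 0.
      by case: (indexP hopt i) iN (tN i) (tB i) => [_ _ _ h _|//|_ _ _ _ h]; [exact: h | exact: (h isT).1].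
    by rewrite mulr0 oppr0 maxxx expr0n.
  have uE : usubmx (s *: t) = s *: usubmx t by exact: linearZ.
  have dE : dsubmx (s *: t) = s *: dsubmx t by exact: linearZ.
  rewrite norm2_sq rE dotv_col dotvNl dotvNr opprK uE dE -!scalemxAr dotvZl dotvZr mulrA -expr2 s1 mul1r.
  rewrite lerD2r dotvE big_mkcond /=; apply: ler_sum => i _; rewrite -expr2.
  case: ifP => [|_]; last exact: sqr_ge0.
  have -> : (s *: (A^T *m dsubmx t)) i 0 = s * (A^T *m dsubmx t) i 0 by rewrite mxE.
  rewrite [X in _ -> _ <= X ^+ 2]mxE [(rc + _) i 0]mxE inE => iB.
  have v2 : Num.max 0 (- (s * (A^T *m dsubmx t) i 0)) ^+ 2 <= ((A^T *m dsubmx t) i 0) ^+ 2.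
    set v := (A^T *m _) i 0; have -> : v ^+ 2 = (- (s * v)) ^+ 2.
      by rewrite sqrrN exprMn s1 mul1r.
    by case: (leP 0 (- (s * v))) => // _; rewrite expr0n sqr_ge0.
  case: (indexP hopt i) iB (gB i) (tB i) => [//|-> _ _ h _|-> _ _ _ h].
    by rewrite h // add0r addr0.
  by rewrite (h isT).2 mulr0 oppr0 maxxx expr0n sqr_ge0.
(* Orthogonality gives |s t - k|_P^2 = |t|_P^2 + |k|_P^2, so the distance to a nearly closest k
   bounds |t|_P. *)
have tle : nP t <= s3 * (s3 * res n) / alpha2.
  apply/ler_addgt0Pl => e e0.
  have hq : s3 * Kresidual A b c zs delta (s *: t) / alpha2 < e + s3 * (s3 * res n) / alpha2.
    have : s3 * Kresidual A b c zs delta (s *: t) / alpha2 <= s3 * (s3 * res n) / alpha2.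
      by rewrite ler_wpM2r ?invr_ge0 ?(ltW a20) // ler_wpM2l ?(ltW s3_gt0) //; exact: le_trans hr.
    lra.
  have [k Kk hk] := sharpness_near_nP hL2 hq.
  apply: le_trans hk; rewrite -(@ler_pXn2r _ 2) ?nnegrE ?nP_ge0 //.
  have sq x : nP x ^+ 2 = dotv x (Peta A eta *m x) by exact: (normP_sq eta0 AL L0 etaL).
  rewrite !sq; move: (t) (image_orthogonal Kk : dotv k (Peta A eta *m t) = 0) => x o.
  rewrite mulmxBr -scalemxAr !dotv_lin (dotv_sym x k (Peta_sym A eta)) o.
  have : s * (s * dotv x (Peta A eta *m x)) = dotv x (Peta A eta *m x).
    by rewrite mulrA -expr2 s1 mul1r.
  have := Peta_psd eta0 AL L0 etaL k; lra.
have := nP_triangle (z n 0%N - T (z n 0%N)) t.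
rewrite addrA subrK => h; apply: le_trans h _; rewrite (alpha_step_inv a20) mulrDr mulr1.
apply: lerD; first exact: lexx.
apply: le_trans tle _; rewrite mulrA s3_sq.
have := eta0; move: alpha2 a20 => a a0 e0.
(* The two factors s3 yield 3/2 over eta alpha2, below the 2 over eta alpha2 contained in the
   inverse of [ae2]. *)
have -> : 3 / (2 * eta) * res n / a = 3 / 2 * (res n * (eta * a)^-1) by field; rewrite !gt_eqF.
have : 0 <= res n * (eta * a)^-1 by rewrite mulr_ge0 // invr_ge0 ltW // mulr_gt0.
lra.
Qed.

End AdaptiveRun.

Theorem theorem4 (R : realType) (m d : nat)
    (A : 'M[R]_(m, d)) (b : 'cV[R]_m) (c : 'cV[R]_d) (eta : R)
    (z00 : 'cV[R]_(d + m)) (tau0 : nat)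
    (z : nat -> nat -> 'cV[R]_(d + m)) (tau : nat -> nat)
    (zs : 'cV[R]_(d + m)) (delta alphaL1 alphaL2 : R) (nbar : nat)
    (hA : A != 0)
    (hfeas : lp_feasible A b)
    (hbnd : lp_bounded A b c)
    (heta0 : 0 < eta)
    (heta : eta <= (2%:R * spectral_norm A)^-1)
    (hrun : adaptive_rHPDHG A b c eta z00 tau0 z tau)
    (hopt : pd_optimal A b c zs)
    (hcvg : iterates_cvg z tau zs)
    (hdelta : is_minimum (nondeg_values A c zs) delta)
    (hL1 : sharpness_constant A b c zs
             (2%:R * (norm2 (z00 - zs) + norm2 zs)) alphaL1)
    (hL2 : sharpness_constant A b c zs delta alphaL2)
    (hnbar : alpha_step eta alphaL1 * delta / (18%:R * Num.sqrt (2%:R * eta))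
               <= residual A b c eta (z nbar 0%N))
    (hnbar_max : forall n : nat,
        alpha_step eta alphaL1 * delta / (18%:R * Num.sqrt (2%:R * eta))
          <= residual A b c eta (z n 0%N) -> (n <= nbar)%N) :
  forall n : nat, (nbar < n)%N ->
    (tau n)%:R <= 2%:R * expR 1 / alpha_step eta alphaL2 /\
    normP A eta (z n 0%N - zs) <=
      2%:R / alpha_step eta alphaL2 * (expR 1)^-1 ^+ (n - nbar - 1)
        * residual A b c eta (z nbar.+1 0%N).
Proof.
move=> n nn.
have n0 : (0 < n)%N by exact: leq_ltn_trans nn.
have [rho1_pos a1 _] := hL1; have [delta0 a2 _] := hL2.
have q0 := alpha_step_gt0 heta0 a2; have q1 := ltW (alpha_step_lt1 heta0 a2).
have small j : residual A b c eta (z (n + j)%N 0%N)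
    < alpha_step eta alphaL1 * delta / (18 * Num.sqrt (2 * eta)).
  rewrite ltNge; apply/negP => /hnbar_max.
  by rewrite leqNgt => /negP; apply; exact: ltn_addr.
have bound : normP A eta (z n 0%N - zs) <= residual A b c eta (z n 0%N) / alpha_step eta alphaL2.
  have [[i iN xi]|still] := pselect (exists2 i, i \in idxN A c zs &
      0 < usubmx (pdhg A b c eta (z n 0%N)) i 0).
    exact: (bound_moving_N hA heta0 heta hrun hopt hcvg delta0 hdelta hL1 hL2 small iN xi).
  apply: (bound_still hA heta0 heta hrun hopt hcvg delta0 hdelta hL1 hL2 n0 small) => i iN.
  apply/eqP; rewrite eq_le pdhg_primal_ge0 andbT leNgt; apply/negP => xi.
  by apply: still; exists i.
split.
  have := @length_le_of_bound _ _ _ _ _ _ _ _ _ _ _ _ hA heta0 heta hrun hopt n n0 _ 0%N q0 q1.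
  by rewrite addn0; exact.
apply: le_trans bound _; have nE : (nbar.+1 + (n - nbar - 1))%N = n.
  by rewrite -subnDA addn1 subnKC.
(* The count starts at loop nbar + 1 >= 1, because loop 0 stops on its counter and not on its
   residual. *)
have := residual_decay hA heta0 heta hrun (n - nbar - 1) (ltn0Sn nbar); rewrite nE => decay.
have r0 : 0 <= residual A b c eta (z n 0%N) by exact: sqrtr_ge0.
rewrite -mulrA mulrAC; apply: ler_wpM2r; first by rewrite invr_ge0 ltW.
apply: (le_trans decay); rewrite ler_peMl ?ler1n //; exact: le_trans r0 decay.
Qed.
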